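(* Let $1\le l\le m$ be integers, $1<p,p_1,\dots,p_m<\infty$ and $1\le q,q_1,\dots,q_m<\infty$ with $\frac1p=\sum_{i=1}^m\frac1{p_i}$ and $\frac1q=\sum_{i=1}^m\frac1{q_i}$, and let $0<\theta<\min_{1\le i\le m}\frac1{p_i}$. Suppose that $\vec b=(b_1,\dots,b_l)\in\mathrm{BMO}^l$ and that the iterated commutator $\mathcal{T}_{\vec b}$ (acting in the first $l$ variables) of an $m$-linear operator $\mathcal{T}$ satisfies the pointwise sparse domination hypothesis. Let $u_1,\dots,u_m:\mathbb{R}^n\times(0,\infty)\to(0,\infty)$ be Lebesgue measurable, and put $p_0=p$, $q_0=q$, $u_0(x,r)=u(x,r)=\prod_{i=1}^mu_i(x,r)$. If there exists a constant $C>0$ such that for all $x,x_1,x_2\in\mathbb{R}^n$, $r,r_1,r_2>0$, $i\in\{0,\dots,m\}$ and $j\in\mathbb{N}$, $$\frac{\|\chi_{B(x_1,r_1)}\|_{L^{p_i,q_i}(\mathbb{R}^n)}}{u_i(x_1,r_1)}\le C\frac{\|\chi_{B(x_2,r_2)}\|_{L^{p_i,q_i}(\mathbb{R}^n)}}{u_i(x_2,r_2)}\quad\text{when }u_i(x_1,r_1)\le u_i(x_2,r_2),$$ and $$u_i(x,2^jr)\le C2^{jn\theta}u_i(x,r),$$ then $$\|\mathcal{T}_{\vec b}(\vec f)\|_{M_{p,q}^u}\le C\|\vec b\|_{\mathrm{BMO}}\,\|M\|_{\mathfrak{B}_{L^{p',q'},u}}^{2+l}\,\|\mathscr{M}\|_{M_{p_1,q_1}^{u_1}\times\cdots\times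 M_{p_m,q_m}^{u_m}\to M_{p,q}^u}\prod_{i=1}^m\|M\|_{M_{p_i,q_i}^{u_i}\to M_{p_i,q_i}^{u_i}}\|f_i\|_{M_{p_i,q_i}^{u_i}},$$ where the constant $C$ in the conclusion is independent of $\vec f$ and $\vec b$.
   Context: Notation. $Q$ denotes cubes in $\mathbb{R}^n$, $\langle f\rangle_Q=\frac1{|Q|}\int_Q f$, $B(x,r)$ is the open ball. $\|b\|_{\mathrm{BMO}}=\sup_Q\frac1{|Q|}\int_Q|b-\langle b\rangle_Q|$ and $\|\vec b\|_{\mathrm{BMO}}=\prod_i\|b_i\|_{\mathrm{BMO}}$. $p',q'$ are conjugate exponents. Sparse families. For a cube $Q_0$, $\mathcal{D}(Q_0)$ is the collection of dyadic subcubes of $Q_0$. A dyadic lattice $\mathscr{D}$ is a collection of cubes such that (i) $Q\in\mathscr{D}$ implies $\mathcal{D}(Q)\subset\mathscr{D}$; (ii) any $Q',Q''\in\mathscr{D}$ lie in $\mathcal{D}(Q)$ for some $Q\in\mathscr{D}$; (iii) every compact set is contained in some $Q\in\mathscr{D}$. A family $\mathcal{S}\subset\mathscr{D}$ is $\eta$-sparse ($0<\eta<1$) if $|\bigcup_{Q'\in\mathcal{S},Q'\subsetneq Q}Q'|\le(1-\eta)|Q|$ for all $Q\in\mathcal{S}$; ''sparse'' means $\eta$-sparse for a fixed $\eta\in(0,1)$ not depending on the functions. Iterated commutator and sparse domination hypothesis. For an $m$-linear operator $\mathcal{T}$ with kernel representation $\mathcal{T}(\vec f)(x)=\int_{\mathbb{R}^{nm}}K(x,\vec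 y)\prod_{s=1}^m f_s(y_s)\,d\vec y$, $$\mathcal{T}_{\vec b}(\vec f)(x)=\int_{\mathbb{R}^{nm}}\prod_{s=1}^l(b_s(x)-b_s(y_s))K(x,\vec y)\prod_{s=1}^m f_s(y_s)\,d\vec y;$$ in general $\mathcal{T}_{\vec b}=[b_1,\cdots[b_l,\mathcal{T}]_l\cdots]_1$ with $[b_s,\mathcal{T}]_s(\vec f)=b_s\mathcal{T}(\vec f)-\mathcal{T}(f_1,\dots,b_sf_s,\dots,f_m)$. Put $\mathcal{T}(b,f,Q,1)=|b-\langle b\rangle_Q|\langle|f|\rangle_Q$ (a function of $x$) and $\mathcal{T}(b,f,Q,2)=\langle|(b-\langle b\rangle_Q)f|\rangle_Q$. The pointwise sparse domination hypothesis: there is $C$ such that for all bounded compactly supported $f_1,\dots,f_m$ there exist $3^n$ sparse collections $\mathcal{S}_1,\dots,\mathcal{S}_{3^n}$ with, for a.e. $x$, $$|\mathcal{T}_{\vec b}(\vec f)(x)|\le C\sum_{j=1}^{3^n}\sum_{\vec\gamma\in\{1,2\}^l}\sum_{Q\in\mathcal{S}_j}\Big(\prod_{s=1}^l\mathcal{T}(b_s,f_s,Q,\gamma_s)\Big)\Big(\prod_{s=l+1}^m\langle|f_s|\rangle_Q\Big)\chi_Q(x).$$ Maximal operators. $Mf(x)=\sup_{Q\ni x}\langle|f|\rangle_Q$ and $\mathscr{M}(\vec f)(x)=\sup\prod_{i=1}^m\frac1{|Q|}\int_Q|f_i|$, supremum over balls $Q\ni x$ (using cubes instead changes $\mathscr{M}$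 only by a constant factor). Spaces. $L^{p,q}(\mathbb{R}^n)$ is the Lorentz space with $\|f\|_{L^{p,q}}=(\int_0^\infty(t^{1/p}f^*(t))^q\frac{dt}t)^{1/q}$ for $q<\infty$ and $\sup_{t>0}t^{1/p}f^*(t)$ for $q=\infty$, $f^*$ being the decreasing rearrangement. The $u$-Morrey-Lorentz space $M_{p,q}^u$ has $\|f\|_{M_{p,q}^u}=\sup_{x\in\mathbb{R}^n,r>0}\frac1{u(x,r)}\|f\chi_{B(x,r)}\|_{L^{p,q}(\mathbb{R}^n)}$. For a function space $Y$ (here $Y=L^{p',q'}(\mathbb{R}^n)$, regarded as a normable Banach function space), a $(Y,u)$-block is a measurable function supported in some ball $B(x_0,r)$ with $Y$-norm at most $1/u(x_0,r)$; $\mathfrak{B}_{Y,u}$ is the set of $\sum_k\lambda_kg_k$ with $g_k$ $(Y,u)$-blocks and $\sum|\lambda_k|<\infty$, with norm $\inf\sum|\lambda_k|$ over such representations. $\|M\|_{\mathfrak{B}_{Y,u}}$ is the operator norm of $M$ on $\mathfrak{B}_{Y,u}$ and $\|S\|_{A\to B}$ denotes operator norm. *)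

(* Defs.v *)
From HB Require Import structures.
From mathcomp Require Import all_boot all_order all_algebra.
From mathcomp Require Import all_classical all_reals all_analysis.
From mathcomp Require Import measurable_realfun.

Set Implicit Arguments.
Unset Strict Implicit.
Unset Printing Implicit Defensive.

Import Order.TTheory GRing.Theory Num.Theory.
Import numFieldNormedType.Exports.

Local Open Scope classical_set_scope.
Local Open Scope ring_scope.

(* Lebesgue measure on R^n = 'rV[R]_n: Lebesgue outer measure restricted to
   its Caratheodory-measurable (i.e. Lebesgue measurable) sets *)

Section LebesgueOuter.
Context {R : realType} {n : nat}.
Local Open Scope ereal_scope.

Definition box (a b : 'rV[R]_n) : set 'rV[R]_n :=
  [set x | forall i, (a ord0 i <= x ord0 i < b ord0 i)%R].

Definition box_volume (a b : 'rV[R]_n) : R :=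
  (\prod_(i < n) Num.max 0 (b ord0 i - a ord0 i))%R.

(* [None] stands for the empty box; it only matters when n = 0. *)
Definition obox (B : option ('rV[R]_n * 'rV[R]_n)) : set 'rV[R]_n :=
  if B is Some ab then box ab.1 ab.2 else set0.

Definition obox_volume (B : option ('rV[R]_n * 'rV[R]_n)) : \bar R :=
  if B is Some ab then (box_volume ab.1 ab.2)%:E else 0.

Definition lebesgue_outer (A : set 'rV[R]_n) : \bar R :=
  ereal_inf [set \sum_(k <oo) obox_volume (B k) |
             B in [set B : nat -> option ('rV[R]_n * 'rV[R]_n) |
                   A `<=` \bigcup_k obox (B k)]].

Lemma obox_volume_ge0 B : 0 <= obox_volume B.
Proof.
case: B => [ab|] //=; rewrite lee_fin; apply: prodr_ge0 => i _.
by rewrite le_max lexx.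
Qed.

Lemma lebesgue_outer_ge0 A : 0 <= lebesgue_outer A.
Proof.
apply: le_ereal_inf_tmp => _ [B _ <-]; apply: nneseries_ge0 => k _ _.
exact: obox_volume_ge0.
Qed.

Lemma lebesgue_outer0 : lebesgue_outer set0 = 0.
Proof.
apply/eqP; rewrite eq_le lebesgue_outer_ge0 andbT.
apply: ereal_inf_lbound; exists (fun=> None) => //=.
by rewrite eseries0.
Qed.

Lemma le_lebesgue_outer :
  {homo lebesgue_outer : A B / A `<=` B >-> A <= B}.
Proof.
move=> A B AB; apply: ereal_inf_le_tmp => _ [F BF <-].
by exists F => //=; exact: subset_trans BF.
Qed.

Lemma lebesgue_outer_sigma_subadditive : sigma_subadditive lebesgue_outer.
Proof.
move=> A; have [[i ioo]|] := pselect (exists i, lebesgue_outer (A i) = +oo).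
  rewrite (eseries_pinfty _ _ ioo) ?leey// => k _.
  by rewrite -ltNye (lt_le_trans _ (lebesgue_outer_ge0 _)).
rewrite -forallNE => Aoo.
suff add2e (e : {posnum R}) :
    lebesgue_outer (\bigcup_n A n)
      <= \sum_(i <oo) lebesgue_outer (A i) + e%:num%:E.
  by apply/lee_addgt0Pr => _/posnumP[].
rewrite (le_trans _ (epsilon_trick _ _ _))//; last first.
  by move=> k; exact: lebesgue_outer_ge0.
pose P k (B : nat -> option ('rV[R]_n * 'rV[R]_n)) :=
  A k `<=` \bigcup_j obox (B j) /\ \sum_(j <oo) obox_volume (B j)
    <= lebesgue_outer (A k) + (e%:num / (2 ^ k.+1)%:R)%:E.
have [G PG] : {G : nat -> nat -> option ('rV[R]_n * 'rV[R]_n) &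
    forall k, P k (G k)}.
  apply: (@choice _ _ P) => k; rewrite /P.
  have en1 : (0 < e%:num / (2 ^ k.+1)%:R)%R by [].
  have : lebesgue_outer (A k) \is a fin_num.
    by rewrite ge0_fin_numE ?lebesgue_outer_ge0// ltey; apply/eqP/Aoo.
  move=> /(lb_ereal_inf_adherent en1) [_ [B AB <-] xS].
  by exists B; split => //; exact/ltW.
pose v := obox_volume \o uncurry G.
have vG_ge0 x : 0 <= v x by case: x => i j; exact: obox_volume_ge0.
apply: (@le_trans _ _ (\esum_(i in setT) v i)).
  apply: ereal_inf_lbound => /=.
  have /card_esym/ppcard_eqP[f] := card_nat2.
  exists (uncurry G \o f).
    move=> t [i _] /((PG i).1 t) [j _ tj].
    exists (f^-1%FUN (i, j)) => //=.
    by rewrite invK ?inE.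
  rewrite -(esum_pred_image v _ xpredT) ?[fun=> _]set_true//.
  by rewrite image_eq.
rewrite (_ : esum _ _ =
    \sum_(i <oo) \sum_(j <oo) obox_volume (G i j)); last first.
  pose J : nat -> set (nat * nat) := fun i => [set (i, j) | j in setT].
  rewrite (_ : setT = \bigcup_k J k); last first.
    by rewrite predeqE => -[a b]; split => // _; exists a => //; exists b.
  rewrite esum_bigcupT /=; last 2 first.
    - apply/trivIsetP => i j _ _ ij.
      rewrite predeqE => -[a b] /=; split => //= -[] [_] _ [<-{a} _].
      by move=> [m' _] [] /esym/eqP; rewrite (negbTE ij).
    - by move=> x; exact: vG_ge0.
  rewrite -(image_id [set: nat]) -fun_true esum_pred_image//; last first.
    by move=> k _; exact: esum_ge0.
  apply: eq_eseriesr => /= j _.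
  rewrite -(esum_pred_image v (pair j) predT)//=; last first.
    by move=> ? ? _ _; exact: (@can_inj _ _ _ snd).
  by congr esum; rewrite predeqE => -[a b]; split; move=> [i _ <-]; exists i.
apply: lee_lim.
- apply: is_cvg_nneseries => *; apply: nneseries_ge0 => *.
  exact: obox_volume_ge0.
- apply: is_cvg_nneseries => *; apply: adde_ge0 => //.
  exact: lebesgue_outer_ge0.
- by near=> k; apply: lee_sum => i _; exact: (PG i).2.
Unshelve. all: by end_near. Qed.

End LebesgueOuter.

HB.instance Definition _ (R : realType) (n : nat) :=
  isOuterMeasure.Build R 'rV[R]_n (@lebesgue_outer R n)
    lebesgue_outer0 lebesgue_outer_ge0 le_lebesgue_outer
    lebesgue_outer_sigma_subadditive.

(* 'rV[R]_n equipped with its Lebesgue sigma-algebra *)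
Notation lebesgue_type R n := (caratheodory_type (@lebesgue_outer R n)).

Definition leb {R : realType} {n : nat} : set (lebesgue_type R n) -> \bar R :=
  @lebesgue_outer R n.

HB.instance Definition _ (R : realType) (n : nat) :=
  isMeasure.Build _ (lebesgue_type R n) R (@leb R n)
    (outer_measure0 (@lebesgue_outer R n))
    (outer_measure_ge0 (@lebesgue_outer R n))
    (@caratheodory_measure_sigma_additive R _ _).

Section Definitions.
Context {R : realType} {n : nat}.
Local Notation Rn := 'rV[R]_n.
Local Open Scope ereal_scope.

(* The library's [ball] on 'rV[R]_n is the one of the sup norm. *)
Definition eball (x : Rn) (r : R) : set Rn :=
  [set y | (Num.sqrt (\sum_(i < n) (y ord0 i - x ord0 i) ^+ 2) < r)%R].

(* A cube is given by its corner and its side length. *)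
Definition cube : Type := (Rn * {posnum R})%type.

Definition cube_set (Q : cube) : set Rn :=
  box Q.1 (Q.1 + const_mx (Q.2)%:num)%R.

Definition avg (f : Rn -> R) (Q : cube) : R :=
  ((fine (leb (cube_set Q)))^-1 * \int[leb]_(x in cube_set Q) f x)%R.

(* [eavg f A] is the average of |f| over A *)
Definition eavg (f : Rn -> \bar R) (A : set Rn) : \bar R :=
  (leb A)^-1 * \int[leb]_(x in A) `|f x|.

Definition lmeasurable (f : Rn -> R) : Prop :=
  measurable_fun (T := lebesgue_type R n) setT f.

Definition elmeasurable (f : Rn -> \bar R) : Prop :=
  measurable_fun (T := lebesgue_type R n) setT f.

Definition bounded_compact (f : Rn -> R) : Prop :=
  [/\ lmeasurable f,
      exists M : R, forall x, (`|f x| <= M)%R &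
      exists2 K : set Rn, compact K & forall x, f x != 0%R -> K x].

Definition bmo_norm (b : Rn -> R) : \bar R :=
  ereal_sup [set eavg (fun x => (b x - avg b Q)%:E) (cube_set Q) |
             Q in [set: cube]].

Definition BMO (b : Rn -> R) : Prop :=
  [/\ lmeasurable b,
      forall K : set Rn, compact K -> leb.-integrable K (EFin \o b) &
      bmo_norm b < +oo].

Definition dyadic_subcubes (Q0 : cube) : set cube :=
  [set Q : cube | exists k : nat,
    ((Q.2)%:num = (Q0.2)%:num / 2 ^+ k)%R /\
    exists2 z : 'I_n -> nat, forall i, (z i < 2 ^ k)%N &
      forall i,
        (Q.1 ord0 i = Q0.1 ord0 i + (Q0.2)%:num / 2 ^+ k * (z i)%:R)%R].

Definition dyadic_lattice (D : set cube) : Prop :=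
  [/\ forall Q, D Q -> dyadic_subcubes Q `<=` D,
      forall Q1 Q2, D Q1 -> D Q2 ->
        exists Q, [/\ D Q, dyadic_subcubes Q Q1 & dyadic_subcubes Q Q2] &
      forall K : set Rn, compact K -> exists2 Q, D Q & K `<=` cube_set Q].

Definition sparse (eta : R) (S : set cube) : Prop :=
  (exists2 D, dyadic_lattice D & S `<=` D) /\
  forall Q, S Q ->
    leb (\bigcup_(Q' in [set Q' | S Q' /\ cube_set Q' `<` cube_set Q])
           cube_set Q')
      <= (1 - eta)%:E * leb (cube_set Q).

Definition subst_arg (m : nat) (f : 'I_m -> Rn -> R) (i : 'I_m)
    (g : Rn -> R) : 'I_m -> Rn -> R :=
  fun j => if j == i then g else f j.

Definition operator (m : nat) : Type := ('I_m -> Rn -> R) -> Rn -> R.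

(* [T] is a total function in Rocq; it acts as an m-linear operator (modulo
   null sets) on tuples f with f_i in the space [dom i], and its values outside
   of these are irrelevant. *)
Definition multilinear_operator (m : nat) (dom : 'I_m -> set (Rn -> R))
    (T : operator m) : Prop :=
  [/\ forall i, dom i `<=` lmeasurable,
      forall i, bounded_compact `<=` dom i,
      forall i (a : R) g h, dom i g -> dom i h ->
        dom i (fun x => a * g x + h x)%R,
      forall f, (forall i, dom i (f i)) -> lmeasurable (T f) &
      forall f i (a : R) g h,
        (forall j, dom j (f j)) -> dom i g -> dom i h ->
        {ae leb, forall x,
          T (subst_arg f i (fun y => a * g y + h y)%R) x =
          (a * T (subst_arg f i g) x + T (subst_arg f i h) x)%R}].

Definition commutator (m : nat) (b : Rn -> R) (i : 'I_m) (T : operator m) :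
    operator m :=
  fun f x =>
    (b x * T f x - T (subst_arg f i (fun y => b y * f i y)) x)%R.

(* [b_1, ... [b_l, T]_l ... ]_1 *)
Definition iter_commutator (l m : nat) (hlm : (l <= m)%N) (b : 'I_l -> Rn -> R)
    (T : operator m) : operator m :=
  foldr (fun s U => commutator (b s) (widen_ord hlm s) U) T (enum 'I_l).

(* T(b, f, Q, 1) for [gamma = false] and T(b, f, Q, 2) for [gamma = true] *)
Definition sparse_factor (b f : Rn -> R) (Q : cube) (gamma : bool) (x : Rn) :
    R :=
  if gamma then avg (fun y => `|(b y - avg b Q) * f y|)%R Q
  else (`|b x - avg b Q| * avg (fun y => `|f y|) Q)%R.

Definition sparse_sum (l m : nat) (hlm : (l <= m)%N) (b : 'I_l -> Rn -> R)
    (f : 'I_m -> Rn -> R) (S : set cube) (gamma : {ffun 'I_l -> bool})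
    (x : Rn) : \bar R :=
  \esum_(Q in S)
    ((\prod_(s < l) sparse_factor (b s) (f (widen_ord hlm s)) Q (gamma s) x) *
     (\prod_(i < m | (l <= i)%N) avg (fun y => `|f i y|) Q) *
     \1_(cube_set Q) x)%R%:E.

Definition sparse_domination (l m : nat) (hlm : (l <= m)%N) (C eta : R)
    (b : 'I_l -> Rn -> R) (Tb : operator m) : Prop :=
  forall f : 'I_m -> Rn -> R, (forall i, bounded_compact (f i)) ->
  exists2 S : 'I_(3 ^ n) -> set cube, forall j, sparse eta (S j) &
    {ae leb, forall x,
      `|Tb f x|%:E <=
      C%:E * \sum_(j < 3 ^ n) \sum_(gamma : {ffun 'I_l -> bool})
               sparse_sum hlm b f (S j) gamma x}.

Definition maximal (f : Rn -> \bar R) (x : Rn) : \bar R :=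
  ereal_sup [set eavg f (cube_set Q) | Q in [set Q : cube | cube_set Q x]].

Definition multi_maximal (m : nat) (f : 'I_m -> Rn -> \bar R) (x : Rn) :
    \bar R :=
  ereal_sup [set y | exists (z : Rn) (r : R), [/\ (0 < r)%R, eball z r x &
                       y = \prod_(i < m) eavg (f i) (eball z r)]].

Definition rearrangement (f : Rn -> \bar R) (t : R) : \bar R :=
  ereal_inf [set s%:E | s in
    [set s : R | (0 <= s)%R /\ leb [set x | s%:E < `|f x|] <= t%:E]].

Definition lorentz (p : R) (q : \bar R) (f : Rn -> \bar R) : \bar R :=
  match q with
  | r%:E =>
      (\int[lebesgue_measure]_(t in `]0%R, +oo[)
         (((t `^ p^-1)%:E * rearrangement f t) `^ r * (t^-1)%:E)) `^ r^-1
  | +oo => ereal_sup [set (t `^ p^-1)%:E * rearrangement f t |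
                      t in `]0%R, +oo[]
  | -oo => 0
  end.

Definition morrey (p : R) (q : \bar R) (u : Rn -> R -> R)
    (f : Rn -> \bar R) : \bar R :=
  ereal_sup [set y | exists (x : Rn) (r : R), (0 < r)%R /\
                       y = ((u x r)^-1)%:E * lorentz p q (f \_ (eball x r))].

Definition morrey_space (p : R) (q : \bar R) (u : Rn -> R -> R) :
    set (Rn -> \bar R) :=
  [set f | elmeasurable f /\ morrey p q u f < +oo].

Section Blocks.
Variables (normY : (Rn -> \bar R) -> \bar R) (u : Rn -> R -> R).

Definition is_block (g : Rn -> R) : Prop :=
  lmeasurable g /\
  exists (x : Rn) (r : R), [/\ (0 < r)%R, forall y, ~ eball x r y -> g y = 0%R &
                  normY (EFin \o g) <= ((u x r)^-1)%:E].

Definition block_decomposition (f : Rn -> \bar R) (lam : nat -> R)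
    (g : nat -> Rn -> R) : Prop :=
  [/\ forall k, is_block (g k),
      \sum_(k <oo) `|lam k|%:E < +oo &
      {ae leb, forall x,
        (fun N : nat => (\sum_(k < N) lam k * g k x)%R%:E) @ \oo --> f x}].

Definition block_space : set (Rn -> \bar R) :=
  [set f | exists lam g, block_decomposition f lam g].

Definition block_norm (f : Rn -> \bar R) : \bar R :=
  ereal_inf [set y | exists lam g, block_decomposition f lam g /\
                       y = \sum_(k <oo) `|lam k|%:E].

End Blocks.

(* the L^{p',q'} norm, where q' = +oo if q = 1 *)
Definition lorentz_conjugate (p q : R) : (Rn -> \bar R) -> \bar R :=
  lorentz (fine (hoelder_conjugate p%:E)) (hoelder_conjugate q%:E).

(* The least C >= 0 such that N' (S f) <= C * N f for all f in D, where N f is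
   the norm of f (or the product of the norms of its components if f is a
   tuple); it is +oo if there is no such C. *)
Definition operator_norm (X Y : Type) (D : set X) (N : X -> \bar R)
    (N' : Y -> \bar R) (S : X -> Y) : \bar R :=
  ereal_inf [set C%:E | C in
    [set C : R | (0 <= C)%R /\ forall f, D f -> N' (S f) <= C%:E * N f]].

Definition maximal_morrey_norm (p q : R) (u : Rn -> R -> R) : \bar R :=
  operator_norm (morrey_space p q%:E u) (morrey p q%:E u) (morrey p q%:E u)
    maximal.

Definition multi_maximal_morrey_norm (m : nat) (ps qs : 'I_m -> R)
    (us : 'I_m -> Rn -> R -> R) (p q : R) (u : Rn -> R -> R) : \bar R :=
  operator_norm
    [set f : 'I_m -> Rn -> \bar R |
      forall i, morrey_space (ps i) (qs i)%:E (us i) (f i)]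
    (fun f => \prod_(i < m) morrey (ps i) (qs i)%:E (us i) (f i))
    (morrey p q%:E u) (@multi_maximal m).

Definition maximal_block_norm (normY : (Rn -> \bar R) -> \bar R)
    (u : Rn -> R -> R) : \bar R :=
  operator_norm (block_space normY u) (block_norm normY u)
    (block_norm normY u) maximal.

(* A weight u : R^n x (0, oo) -> (0, oo) is a total function, only used at
   r > 0. *)

Definition prod_weight (m : nat) (us : 'I_m -> Rn -> R -> R) : Rn -> R -> R :=
  fun x r => (\prod_(i < m) us i x r)%R.

(* Lebesgue measurability of u on R^n x (0, oo), seen as a subset of R^(n+1) *)
Definition weight_measurable (u : Rn -> R -> R) : Prop :=
  measurable_fun (T := lebesgue_type R (n + 1))
    [set z : 'rV[R]_(n + 1) | (0 < rsubmx z ord0 ord0)%R]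
    (fun z : 'rV[R]_(n + 1) => u (lsubmx z) (rsubmx z ord0 ord0)).

Definition weight_condition (C theta p q : R) (u : Rn -> R -> R) : Prop :=
  (forall (x1 x2 : Rn) (r1 r2 : R), (0 < r1)%R -> (0 < r2)%R ->
     (u x1 r1 <= u x2 r2)%R ->
     lorentz p q%:E (EFin \o \1_(eball x1 r1)) * ((u x1 r1)^-1)%:E <=
     C%:E * (lorentz p q%:E (EFin \o \1_(eball x2 r2)) * ((u x2 r2)^-1)%:E)) /\
  (forall (x : Rn) (r : R) (j : nat), (0 < r)%R ->
     (u x (2 ^+ j * r) <= C * 2 `^ (j%:R * n%:R * theta) * u x r)%R).

End Definitions.
Arguments cube : clear implicits.

(* Main.v *)
(* The constant may depend on everything except b and f, in particular on the
   operator norms of the right-hand side. Each of them is positive (test them on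
   the indicator of a small cube; for blocks, the integral of |g| over a fixed
   cube is bounded uniformly over all blocks g). Hence it suffices to bound the
   Morrey-Lorentz norm of T_b f by C prod_s |b_s|_BMO prod_i |f_i|_M: an infinite
   operator norm makes the right-hand side infinite unless one of the other
   factors vanishes, and then the bound itself gives 0.

   Fix a ball B(x0, r). By the John-Nirenberg inequality |b_s - <b_s>_Q| / |b_s|
   has bounded moments of all orders on Q, so each term of a sparse sum is a
   product of weighted averages of the f_i times a function with small tails.
   The cubes of side at most r are split into sparse layers, the g-th one of
   measure O((1 - eta)^g), and by the size of the product of averages; this gives
   a weak-type bound at each level t from the distribution functions of the f_i.
   The cubes of side about 2^k r give a geometric series in k since
   theta < 1/p_i. If the dyadic values of the rearrangements of the f_i are first
   replaced by a summable majorant that varies slowly with the level, the bounds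
   at the levels t = 2^j can be summed over j and yield the Lorentz norm. *)

Require Import Defs.
From mathcomp Require Import all_boot all_order all_algebra.
From mathcomp Require Import all_classical all_reals all_analysis.
From mathcomp Require Import measurable_realfun.
From mathcomp Require Import ring lra.

Set Implicit Arguments.
Unset Strict Implicit.
Unset Printing Implicit Defensive.

Import Order.TTheory GRing.Theory Num.Theory.
Import numFieldNormedType.Exports.

Local Open Scope classical_set_scope.
Local Open Scope ring_scope.

(** * Lebesgue measure of boxes, cubes and balls *)

(** The obstacle is that the deviations of b are unbounded both inside the averages and outside of
    them. All of them are measured by one large order [N]: a weight inside an average has a bounded
    [N]-th moment ([weighted]), a factor outside has a tail of order [N] ([tail_le]). Each use
    spoils a geometric ratio by a power of 2 with a small exponent, of order 1/N, and the slowly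
    varying majorant spoils it by an exponent [de]. The strict inequalities 1 < p, 1 < p_i and theta
    < 1/p_i leave room for these losses; [exponent_parameters] fixes [N] and the remaining exponents
    once for all. The estimates divide by the norms of b_s and f_i, which may vanish. They are
    therefore proved for positive upper bounds of these norms, and the bounds decrease to the norms
    at the very end. Level sets are estimated for finite families of cubes only; a lattice is
    countable, so continuity of the measure from below reaches whole sparse families. The first
    weight condition enters through [eball_ratio]: it makes the Morrey norms of bounded compactly
    supported functions finite and bounds the integrals of blocks over a fixed cube. *)

Section BoxVolume.
Context {R : realType}.
Local Open Scope ereal_scope.

Lemma lebesgue_measure_itvco (a b : R) :
  lebesgue_measure (`[a, b[%classic : set R) = (Num.max 0 (b - a))%:E.
Proof.
rewrite lebesgue_measure_itv/= lte_fin; case: ltP => ab.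
  by rewrite -EFinB; congr EFin; apply/esym/max_idPr; rewrite subr_ge0 ltW.
by congr EFin; apply/esym/max_idPl; rewrite subr_le0.
Qed.

(* Integrating out the last coordinate replaces the coefficients [c], [ck k] by
   their products with a side length, so that the induction needs no measure
   theory in dimension [n]. *)
Lemma box_cover_volume (n : nat) (c : R) (a b : nat -> R)
    (ck : nat -> R) (ak bk : nat -> nat -> R) :
  (0 <= c)%R -> (forall k, (0 <= ck k)%R) ->
  (forall x : nat -> R, (c * \prod_(i < n) \1_(`[a i, b i[%classic) (x i))%:E <=
     \sum_(k <oo) (ck k * \prod_(i < n) \1_(`[ak k i, bk k i[%classic) (x i))%:E) ->
  (c * \prod_(i < n) Num.max 0 (b i - a i))%:E <=
     \sum_(k <oo) (ck k * \prod_(i < n) Num.max 0 (bk k i - ak k i))%:E.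
Proof.
elim: n c ck => [|n IH] c ck c0 ck0 H.
  have := H (fun=> 0%R); rewrite !big_ord0 => /le_trans; apply.
  by apply: lee_nneseries => [k _ _|k _]; rewrite !big_ord0 ?mulr1// lee_fin.
have pos (F : 'I_n -> set R) (x : nat -> R) : (0 <= \prod_(i < n) \1_(F i) (x i) :> R)%R.
  by apply: prodr_ge0 => i _.
rewrite big_ord_recr /= mulrA mulrAC.
under eq_eseriesr do rewrite big_ord_recr /= mulrA mulrAC.
apply: IH => [|k|x].
- by rewrite mulr_ge0// le_max lexx.
- by rewrite mulr_ge0// le_max lexx.
pose upd t i := if i == n then t else x i.
have updE (A : 'I_n -> set R) t : (\prod_(i < n) \1_(A i) (upd t i) = \prod_(i < n) \1_(A i) (x i) :> R)%R.
  by apply: eq_bigr => i _; rewrite /upd ltn_eqF.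
have indE (d : R) (u v : R) : (0 <= d)%R ->
    \int[lebesgue_measure]_t (d * \1_(`[u, v[%classic) t)%:E = (d * Num.max 0 (v - u))%:E.
  move=> d0; under eq_integral do rewrite EFinM.
  rewrite ge0_integralZl_EFin//.
  - by rewrite integral_indic// setIT EFinM; congr (_ * _); exact: lebesgue_measure_itvco.
  - by apply/measurable_EFinP; apply: measurable_indic.
rewrite mulrAC -indE; last by rewrite mulr_ge0// pos.
under eq_eseriesr => k _ do rewrite mulrAC -indE ?mulr_ge0 ?pos//.
rewrite -integral_nneseries//; last 2 first.
- by move=> k; apply/measurable_EFinP; apply: measurable_funM.
- by move=> k t _; rewrite lee_fin !mulr_ge0// pos.
apply: ge0_le_integral => //.
- by move=> t _; rewrite lee_fin !mulr_ge0// pos.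
- by apply/measurable_EFinP; apply: measurable_funM.
- apply: ge0_emeasurable_sum => [k t _ _|k _].
    by rewrite lee_fin !mulr_ge0// pos.
  by apply/measurable_EFinP; apply: measurable_funM.
- move=> t _; have := H (upd t); rewrite big_ord_recr /= updE mulrA.
  rewrite {1}/upd eqxx => /le_trans; apply.
  apply: lee_nneseries => [k _ _|k _]; first by rewrite lee_fin mulr_ge0// prodr_ge0.
  by rewrite big_ord_recr /= updE /upd eqxx mulrA.
Qed.

Lemma prod_indic_box n (a b x : 'rV[R]_n) :
  (\prod_(i < n) \1_(`[a ord0 i, b ord0 i[%classic) (x ord0 i) = \1_(box a b) x :> R)%R.
Proof.
rewrite [RHS]indicE; case: (boolP (x \in box a b)) => [|xab].
  rewrite inE => xab; rewrite big1// => i _.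
  by rewrite indicE mem_set//= in_itv/=; exact: xab.
have [i xi] : exists i, ~~ (a ord0 i <= x ord0 i < b ord0 i)%R.
  apply/existsP; rewrite -negb_forall; apply: contra xab => /forallP xab.
  by rewrite inE => i; exact: xab.
rewrite (bigD1 i)//= indicE memNset ?mul0r//.
by rewrite /= in_itv/=; exact/negP.
Qed.

Lemma leb_box n (a b : 'rV[R]_n) : leb (box a b) = (box_volume a b)%:E.
Proof.
apply/eqP; rewrite eq_le; apply/andP; split.
  apply: ereal_inf_lbound.
  exists (fun k => if k == 0%N then Some (a, b) else None).
    by move=> x xab; exists 0%N.
  rewrite (nneseries_split _ 1)//=; last first.
    by move=> k _; exact: obox_volume_ge0.
  rewrite big_nat1/= [X in _ + X = _]eseries0 ?adde0//.
  by move=> k; case: eqP => // ->.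
apply: le_ereal_inf_tmp => _ [B AB <-].
(* [box_cover_volume] peels off coordinates indexed by [nat]; the value 0 beyond [n] is never
   read. *)
pose ext (v : 'rV[R]_n) (i : nat) : R := oapp (v ord0) 0%R (insub i : option 'I_n).
have extE v (i : 'I_n) : ext v i = v ord0 i by rewrite /ext valK.
(* An absent box gets coefficient 0: for [n = 0] the product of the sides is 1, so emptiness cannot
   be expressed by the endpoints. *)
pose ck k : R := if B k is Some _ then 1%R else 0%R.
pose ak k : nat -> R := if B k is Some ab then ext ab.1 else fun=> 0%R.
pose bk k : nat -> R := if B k is Some ab then ext ab.2 else fun=> 0%R.
have ck0 k : (0 <= ck k)%R by rewrite /ck; case: (B k).
have := @box_cover_volume n 1 (ext a) (ext b) ck ak bk ler01 ck0.
rewrite !mul1r.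
have -> : (\prod_(i < n) Num.max 0 (ext b i - ext a i) = box_volume a b)%R.
  by apply: eq_bigr => i _; rewrite !extE.
have -> : \sum_(k <oo) (ck k * \prod_(i < n) Num.max 0 (bk k i - ak k i))%:E
    = \sum_(k <oo) obox_volume (B k).
  apply: eq_eseriesr => k _; rewrite /ck /ak /bk; case: (B k) => [ab|] /=.
    by rewrite mul1r; congr EFin; apply: eq_bigr => i _; rewrite !extE.
  by rewrite mul0r.
apply => x.
pose y : 'rV[R]_n := \row_i x i.
have -> : (\prod_(i < n) \1_(`[ext a i, ext b i[%classic) (x i) = \1_(box a b) y :> R)%R.
  by rewrite -prod_indic_box; apply: eq_bigr => i _; rewrite !extE mxE.
have -> : \sum_(k <oo) (ck k * \prod_(i < n) \1_(`[ak k i, bk k i[%classic) (x i))%:E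
    = \sum_(k <oo) (\1_(obox (B k)) y)%:E.
  apply: eq_eseriesr => k _; congr EFin; rewrite /ck /ak /bk.
  case: (B k) => [ab|] /=; last by rewrite mul0r indicE in_set0.
  by rewrite -prod_indic_box mul1r; apply: eq_bigr => i _; rewrite !extE mxE.
rewrite mul1r [X in X%:E]indicE; case: (boolP (y \in _)) => [|_]; last first.
  by apply: nneseries_ge0 => k _ _; rewrite lee_fin.
rewrite inE => /AB[k _ Bky].
rewrite (@nneseriesD1 _ _ k)//.
have -> : \1_(obox (B k)) y = 1%R :> R by rewrite indicE mem_set.
by apply: leeDl; apply: nneseries_ge0 => j _ _; rewrite lee_fin.
Qed.

End BoxVolume.

Section Boxes.
Context {R : realType} {n : nat}.
Local Notation Rn := 'rV[R]_n.
Local Notation lT := (lebesgue_type R n).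
Local Open Scope ereal_scope.

(** When the hyperplane x_i = c misses the box, [Num.max] and [Num.min] produce a box of volume 0,
    so one identity covers every position of [c]. *)
Lemma box_volume_split (a b : Rn) (i : 'I_n) (c : R) :
  let a' : Rn := \row_j if j == i then Num.max (a ord0 j) c else a ord0 j in
  let b' : Rn := \row_j if j == i then Num.min (b ord0 j) c else b ord0 j in
  (box_volume a b' + box_volume a' b = box_volume a b)%R.
Proof.
move=> a' b'; pose F (u v : Rn) (j : 'I_n) : R := (Num.max 0 (v ord0 j - u ord0 j))%R.
have P u v : (box_volume u v = F u v i * \prod_(j < n | j != i) F u v j)%R.
  by rewrite /box_volume (bigD1 i).
rewrite !P /F !mxE eqxx.
have E1 : (\prod_(j < n | j != i) Num.max 0 (b' ord0 j - a ord0 j) =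
    \prod_(j < n | j != i) Num.max 0 (b ord0 j - a ord0 j))%R.
  by apply: eq_bigr => j ji; rewrite mxE (negbTE ji).
have E2 : (\prod_(j < n | j != i) Num.max 0 (b ord0 j - a' ord0 j) =
    \prod_(j < n | j != i) Num.max 0 (b ord0 j - a ord0 j))%R.
  by apply: eq_bigr => j ji; rewrite mxE (negbTE ji).
rewrite E1 E2 -mulrDl; congr (_ * _)%R.
move: (a _ _) (b _ _) => u v.
rewrite /Num.max /Num.min; do ! case: ifPn; lra.
Qed.

(** Caratheodory's criterion can be tested on covers: the hyperplane cuts each box of a cover of [X]
    in two without changing the total volume, and the halves cover the two parts of [X]. *)
Lemma measurable_halfspace (i : 'I_n) (c : R) :
  measurable ([set x : Rn | (x ord0 i < c)%R] : set lT).
Proof.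
apply: le_caratheodory_measurable => X.
apply: le_ereal_inf_tmp => _ [B XB <-].
pose lo (B : option (Rn * Rn)) : option (Rn * Rn) := if B is Some ab then
  Some (ab.1, \row_j if j == i then Num.min (ab.2 ord0 j) c else ab.2 ord0 j) else None.
pose hi (B : option (Rn * Rn)) : option (Rn * Rn) := if B is Some ab then
  Some (\row_j if j == i then Num.max (ab.1 ord0 j) c else ab.1 ord0 j, ab.2) else None.
have -> : \sum_(k <oo) obox_volume (B k) =
    \sum_(k <oo) obox_volume (lo (B k)) + \sum_(k <oo) obox_volume (hi (B k)).
  rewrite -nneseriesD; [|by move=> *; exact: obox_volume_ge0..].
  apply: eq_eseriesr => k _; case: (B k) => [[a b]|] /=; last by rewrite adde0.
  by rewrite -EFinD box_volume_split.
apply: leeD.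
- apply: ereal_inf_lbound; exists (lo \o B) => //.
  move=> x [/XB[k _ Bkx] /= xc]; exists k => //=.
  case: (B k) Bkx => [[a b]|] //= xab j; rewrite mxE; have := xab j.
  by case: eqVneq => [->|//]; rewrite lt_min xc andbT.
- apply: ereal_inf_lbound; exists (hi \o B) => //.
  move=> x [/XB[k _ Bkx] /= /negP]; rewrite -leNgt => xc; exists k => //=.
  case: (B k) Bkx => [[a b]|] //= xab j; rewrite mxE; have := xab j.
  by case: eqVneq => [->|//]; rewrite ge_max xc andbT.
Qed.

Lemma measurable_coord (i : 'I_n) :
  measurable_fun (T := lT) setT (fun x : Rn => x ord0 i).
Proof.
apply: (measurability _ (RGenInftyO.measurableE R)) => _ [_ [c ->] <-].
rewrite setTI; have := measurable_halfspace i c.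
by congr measurable; apply/seteqP; split => x /=; rewrite in_itv.
Qed.

Lemma measurable_box (a b : Rn) : measurable (box a b : set lT).
Proof.
have -> : box a b = \bigcap_(i in [set: 'I_n])
    ((fun x : Rn => x ord0 i) @^-1` `[a ord0 i, b ord0 i[).
  apply/seteqP; split => x xab i => [_|]; first by rewrite /= in_itv/=; exact: xab.
  by have := xab i I; rewrite /= in_itv.
apply: fin_bigcap_measurable => // i _.
by rewrite -[X in measurable X]setTI; exact: measurable_coord.
Qed.

Lemma measurable_eball (x : Rn) (r : R) : measurable (eball x r : set lT).
Proof.
have [r0|r0] := leP r 0%R.
  have -> : eball x r = set0; last exact: measurable0.
  apply/seteqP; split => // y /=; rewrite /eball/= => /lt_le_trans /(_ r0).
  by rewrite ltNge sqrtr_ge0.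
pose F (y : Rn) : R := (\sum_(i < n) (y ord0 i - x ord0 i) ^+ 2)%R.
have mF : measurable_fun (T := lT) setT F.
  apply: (@measurable_sum _ lT R setT _ _ (fun i y => (y ord0 i - x ord0 i) ^+ 2)%R) => i.
  apply: (@measurable_funX _ lT R setT (fun y => y ord0 i - x ord0 i)%R).
  by apply: measurable_funB; [exact: measurable_coord|exact: measurable_cst].
have -> : eball x r = F @^-1` `]-oo, (r ^+ 2)%R[.
  apply/seteqP; split => y /=; rewrite /eball/= in_itv/=;
    by rewrite -(@ltr_sqrt _ (F y)) ?exprn_gt0// sqrtr_sqr (gtr0_norm r0).
by rewrite -[X in measurable X]setTI; exact: mF.
Qed.

Lemma eball_coord (x : Rn) (r : R) (y : Rn) i :
  eball x r y -> (`|y ord0 i - x ord0 i| < r)%R.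
Proof.
apply: le_lt_trans; rewrite -sqrtr_sqr ler_sqrt ?sumr_ge0// => [|j _]; last exact: sqr_ge0.
by rewrite (bigD1 i)//= lerDl sumr_ge0// => j _; exact: sqr_ge0.
Qed.

Lemma coord_eball (x : Rn) (r d : R) (y : Rn) : (0 < n)%N ->
  (forall i, `|y ord0 i - x ord0 i| <= d)%R -> (n%:R * d < r)%R -> eball x r y.
Proof.
move=> n0 yd ndr; rewrite /eball/=; apply: le_lt_trans ndr.
have d0 : (0 <= d)%R by apply: le_trans (yd (Ordinal n0)).
have nd0 : (0 <= n%:R * d)%R by rewrite mulr_ge0.
rewrite -[leRHS](ger0_norm nd0) -sqrtr_sqr ler_wsqrtr//.
apply: (@le_trans _ _ (\sum_(i < n) d ^+ 2)%R).
  by apply: ler_sum => i _; rewrite -[leLHS]real_normK ?num_real// lerXn2r ?nnegrE.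
rewrite sumr_const card_ord exprMn -[(_ *+ n)%R]mulr_natl ler_wpM2r ?sqr_ge0//.
by rewrite -natrX ler_nat leq_pmulr.
Qed.

Lemma leb_eball_le (x : Rn) (r : R) : (0 < r)%R ->
  leb (eball x r) <= ((2 * r) ^+ n)%:E.
Proof.
move=> r0; apply: (@le_trans _ _ (leb (box (x - const_mx r)%R (x + const_mx r)%R))).
  apply: le_lebesgue_outer => y xy i; rewrite !mxE.
  by have := eball_coord i xy; rewrite ltr_norml => /andP[]; lra.
rewrite leb_box lee_fin /box_volume (eq_bigr (fun=> 2 * r)%R) => [|i _]; last first.
  by rewrite !mxE max_r; lra.
by rewrite prodr_const card_ord.
Qed.

Lemma leb_cube (Q : cube R n) : leb (cube_set Q) = (((Q.2)%:num) ^+ n)%:E.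
Proof.
rewrite leb_box; congr EFin; rewrite /box_volume (eq_bigr (fun=> (Q.2)%:num)).
  by rewrite prodr_const card_ord.
by move=> i _; rewrite !mxE addrAC subrr add0r max_r.
Qed.

Lemma measurable_cube (Q : cube R n) : measurable (cube_set Q : set lT).
Proof. exact: measurable_box. Qed.

Lemma cube_setP (Q : cube R n) (x : Rn) : cube_set Q x <->
  forall i, (Q.1 ord0 i <= x ord0 i < Q.1 ord0 i + (Q.2)%:num)%R.
Proof. by split => xQ i; have := xQ i; rewrite !mxE. Qed.

Lemma leb_eball_ge (x : Rn) (r : R) : (0 < n)%N -> (0 < r)%R ->
  exists2 Q : cube R n, cube_set Q `<=` eball x r & (Q.2)%:num = (r / n%:R)%R.
Proof.
move=> n0 r0; have s0 : (0 < r / n%:R)%R by rewrite divr_gt0// ltr0n.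
exists ((x - const_mx (r / n%:R / 2))%R, PosNum s0) => //= y /cube_setP /= yQ.
apply: (@coord_eball x r (r / n%:R / 2)%R) => //.
  by move=> i; have := yQ i; rewrite !mxE ler_norml; lra.
have -> : (n%:R * (r / n%:R / 2) = r / 2)%R.
  by rewrite mulrA mulrCA divff ?mulr1// pnatr_eq0 -lt0n.
by rewrite ltr_pdivrMr// ltr_pMr// ltr1n.
Qed.

Definition child (Q : cube R n) (e : {ffun 'I_n -> bool}) : cube R n :=
  (Q.1 + \row_i if e i then (Q.2)%:num / 2 else 0, ((Q.2)%:num / 2)%:pos)%R.

Lemma cube_child (Q : cube R n) : cube_set Q = \bigcup_(e in setT) cube_set (child Q e).
Proof.
have s0 : (0 < (Q.2)%:num)%R by [].
apply/seteqP; split => x.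
  move=> /cube_setP xQ.
  exists [ffun i => (Q.1 ord0 i + (Q.2)%:num / 2 <= x ord0 i)%R] => //.
  apply/cube_setP => i /=; rewrite !mxE ffunE; have := xQ i.
  by case: ifPn; rewrite -?ltNge; lra.
move=> [e _ /cube_setP xQ]; apply/cube_setP => i; have := xQ i; rewrite /= !mxE.
by case: ifPn; lra.
Qed.

Lemma trivIset_child (Q : cube R n) : trivIset setT (fun e => cube_set (child Q e)).
Proof.
have s0 : (0 < (Q.2)%:num)%R by [].
move=> e e' _ _ [x [/cube_setP xe /cube_setP xe']]; apply/ffunP => i.
move: (xe i) (xe' i); rewrite /= !mxE.
by case: (e i); case: (e' i) => //; lra.
Qed.

Lemma child_sub (Q : cube R n) e : cube_set (child Q e) `<=` cube_set Q.
Proof. by rewrite [X in _ `<=` X]cube_child => x xe; exists e. Qed.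

Lemma card_child : #|{: {ffun 'I_n -> bool}}| = (2 ^ n)%N.
Proof. by rewrite card_ffun card_bool card_ord. Qed.

Lemma bigcup_fin (I : finType) (F : I -> set Rn) :
  \bigcup_(i in setT) F i = \big[setU/set0]_(i : I) F i.
Proof.
rewrite -bigcup_seq; apply/seteqP; split => x [i _ Fi]; exists i => //=.
by rewrite mem_index_enum.
Qed.

Lemma leb_bigsetU_le (I : Type) (s : seq I) (F : I -> set Rn) :
  leb (\big[setU/set0]_(i <- s) F i) <= \sum_(i <- s) leb (F i).
Proof.
elim: s => [|i s IH]; first by rewrite !big_nil /leb lebesgue_outer0.
rewrite !big_cons; apply: le_trans (leeD (lexx _) IH).
exact: (@outer_measureU2 _ _ (@lebesgue_outer R n)).
Qed.

Lemma leb_bigsetU (I : choiceType) (s : seq I) (F : I -> set Rn) :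
  uniq s -> {in s, forall i, measurable (F i : set lT)} ->
  {in s &, forall i j, i != j -> F i `&` F j = set0} ->
  leb (\big[setU/set0]_(i <- s) F i) = \sum_(i <- s) leb (F i).
Proof.
elim: s => [|i s IH] /=.
  by rewrite !big_nil /leb lebesgue_outer0.
move=> /andP[si us] mF dF; rewrite !big_cons.
have mU : measurable (\big[setU/set0]_(i <- s) F i : set lT).
  by rewrite big_seq; apply: bigsetU_measurable => j js; apply: mF; rewrite inE js orbT.
rewrite (@measureU _ _ _ leb)//.
- rewrite -IH// => [j js|j k js ks]; first by apply: mF; rewrite inE js orbT.
  by apply: dF; rewrite inE ?js ?ks orbT.
- by apply: mF; rewrite inE eqxx.
- rewrite -subset0 => x [Fix]; rewrite -bigcup_seq => -[j /= js Fjx].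
  have ij : i != j by apply: contraNneq si => ->.
  have <- : (F i `&` F j) x = False by rewrite dF// ?inE ?eqxx ?js ?orbT.
  by split.
Qed.

Lemma leb_child_sum (Q : cube R n) (A : set Rn) : measurable (A : set lT) ->
  leb (A `&` cube_set Q) = \sum_e leb (A `&` cube_set (child Q e)).
Proof.
move=> mA; rewrite cube_child setI_bigcupr bigcup_fin.
rewrite leb_bigsetU ?index_enum_uniq//.
  by move=> e _; apply: measurableI => //; exact: measurable_cube.
move=> e e' _ _ ee'; rewrite -subset0 => x [[_ xe] [_ xe']].
by move/eqP: ee'; apply; apply: (@trivIset_child Q) => //; exists x.
Qed.

Lemma leb_bigcup_nondecreasing_le (F : nat -> set Rn) (c : \bar R) :
  (forall k, measurable (F k : set lT)) -> {homo F : k l / (k <= l)%N >-> k `<=` l} ->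
  (forall k, leb (F k) <= c) -> leb (\bigcup_k F k) <= c.
Proof.
move=> mF ndF Fc.
have ndF' : {homo F : k l / (k <= l)%N >-> (k <= l)%O}.
  by move=> k l kl; apply/subsetPset; exact: ndF.
have cF : leb (F k) @[k --> \oo] --> leb (\bigcup_k F k).
  apply: (@nondecreasing_cvg_mu _ _ _ leb) => //.
  exact: bigcupT_measurable.
rewrite -(cvg_lim _ cF)//; apply: lime_le; first by apply/cvg_ex; eexists; exact: cF.
by near=> k; exact: Fc.
Unshelve. all: by end_near. Qed.

Lemma integral_child (Q : cube R n) (f : Rn -> \bar R) :
  (forall x, 0 <= f x) -> measurable_fun (T := lT) (cube_set Q) f ->
  \int[leb]_(x in cube_set Q) f x = \sum_e \int[leb]_(x in cube_set (child Q e)) f x.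
Proof.
move=> f0 mf; rewrite {1}cube_child bigcup_fin.
rewrite (@ge0_integral_bigsetU _ _ _ leb)//.
- by move=> e; exact: measurable_cube.
- by rewrite /index_enum -enumT enum_uniq.
- by move=> e e' _ _; exact: trivIset_child.
- by rewrite -bigcup_fin -cube_child.
Qed.

End Boxes.

(** * The John-Nirenberg inequality *)

Section Oscillation.
Context {R : realType} {n : nat}.
Local Notation Rn := 'rV[R]_n.
Local Notation lT := (lebesgue_type R n).
Local Open Scope ereal_scope.

Definition vol (Q : cube R n) : R := ((Q.2)%:num ^+ n)%R.

Lemma vol_gt0 Q : (0 < vol Q)%R. Proof. by rewrite exprn_gt0. Qed.

Lemma leb_vol Q : leb (cube_set Q) = (vol Q)%:E. Proof. exact: leb_cube. Qed.

Lemma vol_child Q e : vol (child Q e) = (2^-1 ^+ n * vol Q)%R.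
Proof. by rewrite /vol/= exprMn mulrC. Qed.

Lemma sum_child (x : R) : (\sum_(e : {ffun 'I_n -> bool}) 2^-1 ^+ n * x = x)%R.
Proof.
by rewrite sumr_const card_child -[LHS]mulr_natl mulrA natrX exprVn divff ?mul1r.
Qed.

Lemma leb_cube_sub_fin (Q : cube R n) (A : set Rn) : A `<=` cube_set Q ->
  leb A \is a fin_num.
Proof.
move=> AQ; rewrite ge0_fin_numE; last exact: lebesgue_outer_ge0.
apply: le_lt_trans (le_lebesgue_outer AQ) _.
by have := leb_vol Q; rewrite /leb => ->; rewrite ltry.
Qed.

Lemma integrable_cst_cube (Q : cube R n) (c : R) :
  (@leb R n).-integrable (cube_set Q) (fun=> c%:E).
Proof.
apply/integrableP; split; first exact: measurable_cst.
rewrite integral_cst; last exact: measurable_cube.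
by rewrite [X in _ * X](leb_vol Q) -EFinM ltry.
Qed.

Variable b : Rn -> R.
Hypothesis mb : lmeasurable b.
Hypothesis ib : forall Q : cube R n, leb.-integrable (cube_set Q) (EFin \o b).

Let ibc Q (c : R) : (@leb R n).-integrable (cube_set Q) (EFin \o (fun x => b x - c)%R).
Proof.
have -> : EFin \o (fun x => b x - c)%R = (EFin \o b) \- (fun=> c%:E).
  by apply/funext => x.
apply: (integrableB (measurable_cube Q) (ib Q)).
exact: integrable_cst_cube.
Qed.

(** Not divided by the volume: in this form it is additive over the children of [Q], which drives
    the induction for the John-Nirenberg inequality. *)
Definition osc (Q : cube R n) (c : R) : R :=
  fine (\int[leb]_(x in cube_set Q) (`|b x - c|)%:E).

Lemma measurable_dev Q c : measurable_fun (T := lT) (cube_set Q) (fun x => (`|b x - c|)%:E).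
Proof.
apply: measurable_funTS; apply/measurable_EFinP.
apply: measurableT_comp; first exact: normr_measurable.
by apply: measurable_funB; [exact: mb|exact: measurable_cst].
Qed.

Lemma oscE Q c : \int[leb]_(x in cube_set Q) (`|b x - c|)%:E = (osc Q c)%:E.
Proof.
rewrite fineK//; apply: integrable_fin_num; first exact: measurable_cube.
exact: (integrable_norm (ibc Q c)).
Qed.

Lemma osc_ge0 Q c : (0 <= osc Q c)%R.
Proof. by rewrite fine_ge0// integral_ge0. Qed.

Lemma osc_child Q c : osc Q c = (\sum_e osc (child Q e) c)%R.
Proof.
apply: EFin_inj; rewrite -oscE integral_child//; last exact: measurable_dev.
by rewrite -sumEFin; apply: eq_bigr => e _; rewrite oscE.
Qed.

Lemma avg_dist Q c : (`|avg b Q - c| * vol Q <= osc Q c)%R.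
Proof.
have v0 := vol_gt0 Q; have mQ := measurable_cube Q.
have E : (\int[leb]_(x in cube_set Q) (b x - c) = (avg b Q - c) * vol Q)%R.
  rewrite (RintegralB mQ (ib Q))/=; last first.
    exact: integrable_cst_cube.
  rewrite mulrBl /avg leb_vol/= mulrAC mulVf ?mul1r ?gt_eqF//; congr (_ - _)%R.
  by rewrite /Rintegral integral_cst// [X in _ * X](leb_vol Q).
rewrite -[X in (_ * X)%R]gtr0_norm// -normrM -E.
by apply: le_trans (le_normr_Rintegral mQ (ibc Q c)) _; rewrite /osc.
Qed.

End Oscillation.

(** * A dyadic density theorem *)

Section Density.
Context {R : realType} {n : nat}.
Local Notation Rn := 'rV[R]_n.
Local Notation lT := (lebesgue_type R n).
Local Open Scope ereal_scope.

Fixpoint desc (K : nat) (Q : cube R n) : set (cube R n) :=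
  if K is K'.+1 then \bigcup_(e in setT) desc K' (child Q e) else [set Q].

Definition enlarge (a b : Rn) (d : R) : set Rn :=
  box (a - const_mx d)%R (b + const_mx d)%R.

(** A cube of generation [K] that meets the box lies in the box enlarged by the side of that
    generation. The set [E] is arbitrary: its part is bounded by subadditivity, and only the
    enlarged box is split exactly. *)
Lemma leb_desc_box (E : set Rn) (K : nat) (Q : cube R n) (a b : Rn) (th : R) :
  (0 <= th)%R ->
  (forall Q', desc K Q Q' -> leb (E `&` cube_set Q') <= (th * vol Q')%:E) ->
  leb (E `&` box a b `&` cube_set Q) <=
  th%:E * leb (enlarge a b ((Q.2)%:num / 2 ^+ K)%R `&` cube_set Q).
Proof.
move=> th0; elim: K Q => [|K IH] Q /= HQ.
  have [[x [xB xQ]]|B0] := pselect ((box a b `&` cube_set Q) !=set0); last first.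
    rewrite -setIA (_ : box a b `&` _ = set0); last first.
      by rewrite -subset0 => y yQ; apply: B0; exists y.
    rewrite setI0 {1}/leb lebesgue_outer0.
    by apply: mule_ge0; [rewrite lee_fin|exact: lebesgue_outer_ge0].
  rewrite expr0 divr1 [enlarge _ _ _ `&` _]setIidr; last first.
    move=> y /cube_setP yQ i; move/cube_setP: xQ => xQ; rewrite !mxE.
    by have := xB i; have := yQ i; have := xQ i; lra.
  rewrite leb_vol -EFinM; apply: le_trans (HQ Q erefl); apply: le_lebesgue_outer.
  by move=> y [[]].
apply: (@le_trans _ _ (\sum_e leb (E `&` box a b `&` cube_set (child Q e)))).
  apply: le_trans (leb_bigsetU_le _ _); apply: le_lebesgue_outer => x [xEB].
  rewrite cube_child -bigcup_fin => -[e _ xe].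
  by exists e.
rewrite leb_child_sum; last exact: measurable_box.
rewrite ge0_sume_distrr => [|e _]; last exact: lebesgue_outer_ge0.
apply: lee_sum => e _; have := IH (child Q e).
rewrite /= (_ : (_ / 2 / 2 ^+ K = (Q.2)%:num / 2 ^+ K.+1)%R).
  by apply=> Q' QQ'; apply: HQ; exists e.
by rewrite exprS -mulrA -invfM.
Qed.

Lemma box_volume_enlarge_cvg (a b : Rn) (s : R) :
  (box_volume (a - const_mx (s / 2 ^+ K)) (b + const_mx (s / 2 ^+ K)))%R @[K --> \oo] -->
  box_volume a b.
Proof.
have cs : (s / 2 ^+ K)%R @[K --> \oo] --> 0%R.
  rewrite -(mulr0 s); apply: cvgM; first exact: cvg_cst.
  under eq_fun do rewrite -exprVn.
  by apply: cvg_expr; rewrite ger0_norm// invf_lt1// ltr1n.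
rewrite /box_volume; elim: (index_enum 'I_n) => [|i r IH].
  under eq_fun do rewrite big_nil.
  by rewrite big_nil; exact: cvg_cst.
under eq_fun do rewrite big_cons !mxE.
rewrite big_cons; apply: cvgM; last exact: IH.
have -> : Num.max 0%R (b ord0 i - a ord0 i)%R =
   Num.max 0%R (b ord0 i + 0 - (a ord0 i - 0))%R by rewrite subr0 addr0.
have cd : (b ord0 i + s / 2 ^+ K - (a ord0 i - s / 2 ^+ K))%R @[K --> \oo] -->
    (b ord0 i + 0 - (a ord0 i - 0))%R.
  apply: cvgB; first by apply: cvgD => //; exact: cvg_cst.
  by apply: cvgB => //; exact: cvg_cst.
under eq_fun do rewrite maxr_absE.
rewrite maxr_absE; apply: cvgM; last exact: cvg_cst.
apply: cvgD; first by apply: cvgD => //; exact: cvg_cst.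
by apply: cvg_norm; apply: cvgB => //; exact: cvg_cst.
Qed.

(** This takes the place of Lebesgue's differentiation theorem. As [K] grows the enlargement
    disappears, so [E] has density at most [th] in every box; summing over covers of [E] and taking
    the infimum gives |E| <= th |E|, where |E| is finite. *)
Lemma leb_density0 (E : set Rn) (Q : cube R n) (th : R) :
  (0 < th < 1)%R -> E `<=` cube_set Q ->
  (forall K Q', desc K Q Q' -> leb (E `&` cube_set Q') <= (th * vol Q')%:E) ->
  leb E = 0.
Proof.
move=> /andP[th_gt0 th1] EQ HQ; have th0 := ltW th_gt0.
have Ebox a b : leb (E `&` box a b) <= th%:E * (box_volume a b)%:E.
  have H K : leb (E `&` box a b) <=
     (th * box_volume (a - const_mx ((Q.2)%:num / 2 ^+ K)) (b + const_mx ((Q.2)%:num / 2 ^+ K)))%:E.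
    have -> : E `&` box a b = E `&` box a b `&` cube_set Q.
      by apply/seteqP; split => x [] //= xE xB; split => //; exact: EQ.
    apply: le_trans (leb_desc_box a b th0 (HQ K)) _.
    rewrite EFinM -leb_box lee_wpmul2l ?lee_fin//.
    exact: le_lebesgue_outer.
  have fB : leb (E `&` box a b) \is a fin_num.
    by apply: (@leb_cube_sub_fin _ _ Q) => x [/EQ].
  rewrite -(fineK fB) -EFinM lee_fin.
  have cu : (th * box_volume (a - const_mx ((Q.2)%:num / 2 ^+ K))
      (b + const_mx ((Q.2)%:num / 2 ^+ K)))%R @[K --> \oo] --> (th * box_volume a b)%R.
    by apply: cvgM; [exact: cvg_cst|exact: box_volume_enlarge_cvg].
  apply: (@cvgr_to_ge _ _ _ R _ _ _ cu); near=> K.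
  by have := H K; rewrite -(fineK fB) lee_fin.
have fE : leb E \is a fin_num by exact: leb_cube_sub_fin EQ.
have : leb E <= th%:E * leb E.
  rewrite -lee_pdivrMl//; apply: le_ereal_inf_tmp => _ [B EB <-].
  rewrite lee_pdivrMl// -nneseriesZl; last by move=> k _; exact: obox_volume_ge0.
  apply: (@le_trans _ _ (\sum_(k <oo) leb (E `&` obox (B k)))).
    apply: le_trans (outer_measure_sigma_subadditive (@lebesgue_outer R n) _).
    apply: le_lebesgue_outer => x Ex; have [k _ Bkx] := EB _ Ex.
    by exists k.
  apply: lee_nneseries => [k _ _|k _]; first exact: lebesgue_outer_ge0.
  case: (B k) => [[u v]|] /=; first exact: Ebox.
  by rewrite setI0 /leb lebesgue_outer0 mule0.
rewrite -(fineK fE) -EFinM lee_fin => H; congr EFin; apply/eqP.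
rewrite eq_le fine_ge0 ?lebesgue_outer_ge0// andbT.
by rewrite leNgt; apply/negP => ?; nra.
Unshelve. all: by end_near. Qed.

End Density.

Section JohnNirenberg.
Context {R : realType} {n : nat}.
Local Notation Rn := 'rV[R]_n.
Local Notation lT := (lebesgue_type R n).
Local Open Scope ereal_scope.

Variables (b : Rn -> R) (be : R).
Hypothesis be0 : (0 < be)%R.
Hypothesis mb : lmeasurable b.
Hypothesis ib : forall Q : cube R n, leb.-integrable (cube_set Q) (EFin \o b).
Hypothesis hb : forall Q : cube R n, (osc b Q (avg b Q) <= be * vol Q)%R.

(** A level set of a dyadic maximal function truncated at [K] generations: on each branch the first
    cube whose mean is farther than [mu] from [c] is kept whole. *)
Fixpoint bad (K : nat) (Q : cube R n) (c mu : R) : set Rn :=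
  if (mu < `|avg b Q - c|)%R then cube_set Q
  else if K is K'.+1 then \bigcup_(e in setT) bad K' (child Q e) c mu else set0.

Lemma bad_sub K Q c mu : bad K Q c mu `<=` cube_set Q.
Proof.
elim: K Q => [|K IH] Q /=; case: ifP => // _ x //= [e _ /IH].
exact: child_sub.
Qed.

Lemma measurable_bad K Q c mu : measurable (bad K Q c mu : set lT).
Proof.
elim: K Q => [|K IH] Q /=; case: ifP => // _; try exact: measurable_cube.
by rewrite bigcup_fin; apply: bigsetU_measurable.
Qed.

Lemma bad_shift K Q c c' mu d : (`|c - c'| <= d)%R ->
  bad K Q c mu `<=` bad K Q c' (mu - d)%R.
Proof.
move=> cd; have H Q' : (mu < `|avg b Q' - c| -> mu - d < `|avg b Q' - c'|)%R.
  move=> /lt_le_trans => /(_ (`|avg b Q' - c'| + d)%R); rewrite ltrBlDr; apply.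
  have -> : (avg b Q' - c = (avg b Q' - c') - (c - c'))%R by lra.
  by apply: le_trans (ler_normB _ _) _; rewrite lerD2l.
elim: K Q => [|K IH] Q /=; case: ifP => [/H ->|_] //=.
case: ifP => _ x [e _ /= xe]; first exact: (child_sub (bad_sub xe)).
by exists e => //; exact: IH.
Qed.

Lemma bad_mono K Q c mu : bad K Q c mu `<=` bad K.+1 Q c mu.
Proof.
elim: K Q => [|K IH] Q /=; first by case: ifP => // _ x.
case: ifP => _ x //= [e _ xe]; exists e => //; exact: IH.
Qed.

Lemma desc_bad K Q Q' c mu : desc K Q Q' -> (mu < `|avg b Q' - c|)%R ->
  cube_set Q' `<=` bad K Q c mu.
Proof.
elim: K Q => [|K IH] Q /=; first by move=> -> ->.
move=> [e _ QQ'] H x xQ'; have := IH _ QQ' H _ xQ' => xe.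
by case: ifP => _; [exact: child_sub (bad_sub xe)|exists e].
Qed.

(** The height of one level. A child has 2^n times less volume, so an oscillation of at most
    [2 * be * vol Q] on [Q] is at most [jnL] times the volume of each child. *)
Definition jnL : R := (2 ^+ n.+1 * be)%R.

(** The constants fit the recentring: around the mean the bracket is at most [3 * vol Q], around [c]
    it is at least 9/2 times [vol Q] once the oscillation exceeds [2 * be * vol Q], and the quotient
    is the factor 2/3 of the lost level. At level 0 the bound dominates [vol Q]. *)
Let bnd (Q : cube R n) c j : R :=
  ((2 / 3) ^+ j * (3 / 2 * vol Q + 3 / 2 * (osc b Q c / be)))%R.

Let bnd_ge0 Q c j : (0 <= bnd Q c j)%R.
Proof.
rewrite /bnd mulr_ge0 ?exprn_ge0 ?divr_ge0// addr_ge0// mulr_ge0// ?divr_ge0//.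
- exact/ltW/vol_gt0.
- exact: osc_ge0.
- exact: ltW.
Qed.

Let bnd0 Q c (A : set Rn) : A `<=` cube_set Q -> leb A <= (bnd Q c 0)%:E.
Proof.
move=> AQ; apply: le_trans (le_lebesgue_outer AQ) _.
have := leb_vol Q; rewrite {1}/leb => ->; rewrite lee_fin /bnd expr0 mul1r.
have v0 := vol_gt0 Q.
have : (0 <= osc b Q c / be)%R by rewrite divr_ge0 ?osc_ge0 ?ltW.
lra.
Qed.

Let avg_near Q c d : (osc b Q c <= d * vol Q)%R -> (`|avg b Q - c| <= d)%R.
Proof.
by move=> H; rewrite -(ler_pM2r (vol_gt0 Q)); apply: le_trans H; exact: avg_dist.
Qed.

Let jn_step K : (forall Q c j, (osc b Q c <= jnL * vol Q)%R ->
    leb (bad K Q c (j%:R * jnL)) <= (bnd Q c j)%:E) ->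
  forall Q c j, (osc b Q c <= 2 * be * vol Q)%R ->
    leb (bad K.+1 Q c (j%:R * jnL)) <= (bnd Q c j)%:E.
Proof.
move=> IH Q c [|j] H; first by apply: bnd0; exact: bad_sub.
have L2 : (2 * be <= jnL)%R.
  by rewrite /jnL ler_wpM2r ?(ltW be0)// exprS ler_peMr// exprn_ege1// ler1n.
have Lj : (jnL <= j.+1%:R * jnL)%R by rewrite ler_peMl ?ler1n// (le_trans _ L2)// mulr_ge0// ltW.
rewrite /= (_ : (_ < `|avg b Q - c|)%R = false); last first.
  by apply/negbTE; rewrite -leNgt (le_trans (avg_near H) (le_trans L2 Lj)).
rewrite bigcup_fin; apply: le_trans (leb_bigsetU_le _ _) _.
apply: (@le_trans _ _ (\sum_e (bnd (child Q e) c j.+1)%:E)).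
  apply: lee_sum => e _; apply: IH.
  apply: le_trans (_ : (osc b Q c <= _)%R).
    rewrite (osc_child mb ib Q c) (bigD1 e)//= lerDl sumr_ge0// => i _.
    exact: osc_ge0.
  apply: (le_trans H); rewrite vol_child /jnL exprS exprVn.
  rewrite le_eqVlt; apply/orP; left; apply/eqP.
  by move: (2 ^+ n)%R (@expf_neq0 R 2 n (negbT (pnatr_eq0 R 2))) => u u0; field.
rewrite sumEFin lee_fin /bnd -mulr_sumr big_split/= -!mulr_sumr -mulr_suml.
by rewrite -(osc_child mb ib Q c) (eq_bigr _ (fun e _ => vol_child Q e)) sum_child.
Qed.

(* [bnd] is linear in the oscillation, so it is additive over the children of [Q]
   as long as the mean oscillation around [c] is at most [2 be]; otherwise [c] is
   first replaced by the mean over [Q], which costs one level. *)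
Lemma john_nirenberg_bad K Q c j : (osc b Q c <= jnL * vol Q)%R ->
  leb (bad K Q c (j%:R * jnL)) <= (bnd Q c j)%:E.
Proof.
have Lpos : (0 < jnL)%R by rewrite /jnL mulr_gt0// exprn_gt0.
elim: K Q c j => [|K IH] Q c [|j] H; try by apply: bnd0; exact: bad_sub.
  rewrite /= (_ : (_ < `|avg b Q - c|)%R = false); last first.
    by apply/negbTE; rewrite -leNgt (le_trans (avg_near H))// ler_peMl ?ler1n// ltW.
  by rewrite /leb lebesgue_outer0 lee_fin.
have [a2|a2] := leP (osc b Q c) (2 * be * vol Q)%R; first exact: jn_step.
apply: (@le_trans _ _ (leb (bad K.+1 Q (avg b Q) (j%:R * jnL)))).
  apply: le_lebesgue_outer.
  have -> : (j%:R * jnL = j.+1%:R * jnL - jnL)%R by rewrite -natr1 mulrDl mul1r addrK.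
  by apply: bad_shift; rewrite distrC avg_near.
apply: (@le_trans _ _ (bnd Q (avg b Q) j)%:E).
  apply: jn_step => //; apply: le_trans (hb Q) _.
  by rewrite -mulrA ler_peMl ?ler1n// mulr_ge0 ?ltW// vol_gt0.
rewrite lee_fin /bnd exprSr -[leRHS]mulrA ler_wpM2l ?exprn_ge0 ?divr_ge0//.
have : (osc b Q (avg b Q) / be <= vol Q)%R.
  by rewrite ler_pdivrMr// mulrC hb.
have : (2 * vol Q < osc b Q c / be)%R by rewrite ltr_pdivlMr// mulrAC.
lra.
Qed.

Lemma john_nirenberg Q j :
  leb (cube_set Q `&` [set x | j%:R * jnL < `|b x - avg b Q|]%R) <=
  (7 * (2 / 3) ^+ j * vol Q)%:E.
Proof.
have v0 := vol_gt0 Q.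
have Lpos : (0 < jnL)%R by rewrite /jnL mulr_gt0// exprn_gt0.
have [j2|j2] := ltnP j 2.
  apply: (@le_trans _ _ (leb (cube_set Q))).
    by apply: le_lebesgue_outer => x [].
  rewrite leb_vol lee_fin ler_peMl ?(ltW v0)//.
  by case: j j2 => [|[|]]// _; rewrite ?expr0 ?expr1; lra.
(* Two levels are held back: outside [W] the means stay within [(j - 2) * jnL] of [c], so [b] still
   differs from them by [2 * jnL], which is at least [4 * be]. The factor 7 pays for this, since 3
   <= 7 (2/3)^2. *)
pose c := avg b Q; pose W := \bigcup_K bad K Q c ((j - 2)%:R * jnL)%R.
have leW : leb W <= (7 * (2 / 3) ^+ j * vol Q)%:E.
  apply: leb_bigcup_nondecreasing_le => [K|K K' KK'|K].
  - exact: measurable_bad.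
  - rewrite -(subnK KK'); elim: (K' - K)%N => [//|d IH].
    by apply: (subset_trans IH); rewrite addSn; exact: bad_mono.
  - apply: le_trans (john_nirenberg_bad _ _ _) _.
      apply: le_trans (hb Q) _; rewrite ler_wpM2r ?(ltW v0)// /jnL.
      by rewrite ler_peMl ?(ltW be0)// exprn_ege1// ler1n.
    rewrite lee_fin /bnd -[in leRHS](subnK j2) exprD.
    have : (osc b Q c / be <= vol Q)%R by rewrite ler_pdivrMr// mulrC hb.
    have : (0 <= (2 / 3) ^+ (j - 2) :> R)%R by rewrite exprn_ge0// divr_ge0.
    move: (_ ^+ (j - 2))%R (osc _ _ _ / be)%R => u v u0 vle.
    rewrite [leRHS](_ : _ = u * (28 / 9 * vol Q))%R; last by field.
    by rewrite ler_wpM2l//; lra.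
(* The remainder is null by density: on a descendant that meets [E], Chebyshev's inequality with
   mean oscillation [be] and gap [4 * be] leaves density at most 1/4. *)
pose E := (cube_set Q `&` [set x | j%:R * jnL < `|b x - c|]%R) `\` W.
have mE : measurable (E : set lT).
  apply: measurableD; last by apply: bigcupT_measurable => K; exact: measurable_bad.
  have := @measurable_dev _ _ b mb Q c (measurable_cube Q) _ (emeasurable_itv `](j%:R * jnL)%:E, +oo[).
  congr measurable; apply/seteqP; split => x [xQ] /=; rewrite in_itv/= andbT lte_fin; by split.
suff E0 : leb E = 0.
  apply: (@le_trans _ _ (leb (W `|` E))).
    apply: le_lebesgue_outer => x xE; have [xW|xW] := pselect (W x); [by left|by right].
  apply: (@le_trans _ _ (leb W + leb E)); last by rewrite E0 adde0.
  exact: (outer_measureU2 (@lebesgue_outer R n)).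
apply: (@leb_density0 _ _ E Q (3 / 4)); first by apply/andP; split; lra.
  by move=> x [[]].
move=> K Q' QQ'.
have [[x [Ex xQ']]|E0] := pselect ((E `&` cube_set Q') !=set0); last first.
  rewrite (_ : E `&` _ = set0); last first.
    by rewrite -subset0 => y yE; apply: E0; exists y.
  by rewrite /leb lebesgue_outer0 lee_fin mulr_ge0 ?(ltW (vol_gt0 _))// divr_ge0.
have near : (`|avg b Q' - c| <= (j - 2)%:R * jnL)%R.
  rewrite leNgt; apply/negP => H; apply: Ex.2; exists K => //.
  exact: (desc_bad QQ' H).
have far y : E y -> (4 * be <= `|b y - avg b Q'|)%R.
  move=> [[_ /= yj] _].
  have -> : (b y - avg b Q' = (b y - c) - (avg b Q' - c))%R by lra.
  apply: le_trans (lerB_dist _ _).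
  have : (j%:R = (j - 2)%:R + 2 :> R)%R by rewrite -natrD subnK.
  have : (2 * be <= jnL)%R.
    by rewrite /jnL ler_wpM2r ?(ltW be0)// exprS ler_peMr// exprn_ege1// ler1n.
  by nra.
have mQ' := measurable_cube Q'.
have mD := @measurable_dev _ _ b mb Q' (avg b Q').
have be4 : (0 < 4 * be)%R by rewrite mulr_gt0.
have H := le_integral_abse (@leb R n) mQ' mD be4.
have HI : \int[leb]_(y in cube_set Q') `|(`|b y - avg b Q'|)%:E| = (osc b Q' (avg b Q'))%:E.
  by rewrite -(oscE ib); apply: eq_integral => y _; rewrite /= normr_id.
rewrite HI in H.
have : (4 * be)%:E * leb (E `&` cube_set Q') <= (be * vol Q')%:E.
  apply: le_trans (_ : (osc b Q' (avg b Q'))%:E <= _); last by rewrite lee_fin hb.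
  apply: le_trans H; rewrite lee_wpmul2l ?lee_fin ?mulr_ge0 ?(ltW be0)//.
  apply: le_lebesgue_outer => y [Ey yQ']; split => //=.
  by rewrite lee_fin normr_id far.
rewrite -lee_pdivlMl ?mulr_gt0// -EFinM => /le_trans; apply.
rewrite lee_fin ler_pdivrMl ?mulr_gt0//.
by have := vol_gt0 Q'; nra.
Qed.

End JohnNirenberg.

(** * Geometric series and polynomial growth *)

Section Geometric.
Context {R : realType}.

Lemma sum_geometric_le (r : R) (J : nat) : 0 <= r < 1 ->
  \sum_(j < J) r ^+ j <= (1 - r)^-1.
Proof.
move=> /andP[r0 r1]; have d0 : 0 < 1 - r by rewrite subr_gt0.
rewrite -[leRHS]mul1r ler_pdivlMr//.
suff -> : (\sum_(j < J) r ^+ j) * (1 - r) = 1 - r ^+ J.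
  by rewrite lerBlDr lerDl exprn_ge0.
elim: J => [|J IH]; first by rewrite big_ord0 mul0r expr0 subrr.
by rewrite big_ord_recr/= mulrDl IH exprS; ring.
Qed.

Lemma nneseries_le_bound (a : nat -> R) (M : R) : (forall j, 0 <= a j) ->
  (forall J, \sum_(j < J) a j <= M) -> (\sum_(j <oo) (a j)%:E <= M%:E)%E.
Proof.
move=> a0 aM; apply: lime_le.
  by apply: is_cvg_nneseries => j _ _; rewrite lee_fin.
by near=> J; rewrite /= sumEFin lee_fin big_mkord.
Unshelve. all: by end_near. Qed.

Lemma nneseries_geometric_le (a : nat -> R) (C r : R) : 0 <= r < 1 -> 0 <= C ->
  (forall j, 0 <= a j <= C * r ^+ j) -> (\sum_(j <oo) (a j)%:E <= (C / (1 - r))%:E)%E.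
Proof.
move=> r01 C0 aC; apply: nneseries_le_bound => [j|J].
  by have /andP[] := aC j.
apply: (@le_trans _ _ (\sum_(j < J) C * r ^+ j)).
  by apply: ler_sum => j _; have /andP[] := aC j.
by rewrite -mulr_sumr ler_wpM2l// sum_geometric_le.
Qed.

(** Each further power is bought by passing to the rate d/3, since (1 + d/3)^2 <= 1 + d. *)
Lemma natexp_le_geometric (N : nat) (d : R) : 0 < d <= 1 ->
  exists2 C : R, 0 < C & forall j : nat, j.+1%:R ^+ N <= C * (1 + d) ^+ j.
Proof.
elim: N d => [|N IH] d /andP[d0 d1].
  exists 1 => // j; rewrite expr0 mul1r exprn_ege1//; lra.
have d3 : 0 < d / 3 <= 1 by apply/andP; split; lra.
have [C C0 HC] := IH _ d3.
exists (C * (3 / d)); first by rewrite mulr_gt0// divr_gt0.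
move=> j; rewrite exprSr.
have D0 : 0 <= (1 + d / 3) ^+ j by apply: exprn_ge0; lra.
have H1 : j.+1%:R <= 3 / d * (1 + d / 3) ^+ j.
  have H2 : 1 + j%:R * (d / 3) <= (1 + d / 3) ^+ j.
    elim: (j) => [|i IHi]; first by rewrite mul0r addr0 expr0.
    have i0 : 0 <= i%:R * (d / 3) * (d / 3) by rewrite !mulr_ge0//; lra.
    rewrite exprS -natr1; move: IHi; move: (_ ^+ i) => u IHi; nra.
  rewrite mulrC mulrA ler_pdivlMr// -natr1; have := @ler0n R j; nra.
apply: (le_trans (ler_pM _ _ (HC j) H1)); [exact: exprn_ge0|exact: ler0n|].
rewrite mulrACA ler_wpM2l ?mulr_ge0 ?divr_ge0 ?invr_ge0 ?(ltW C0) ?(ltW d0)//.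
rewrite -exprMn lerXn2r ?nnegrE//; nra.
Qed.

End Geometric.

(** * Moments of mean oscillations *)

Section Moments.
Context {R : realType} {n : nat}.
Local Notation Rn := 'rV[R]_n.
Local Notation lT := (lebesgue_type R n).
Local Open Scope ereal_scope.

Lemma bmo_moment (N : nat) : exists2 K : R, (0 < K)%R &
  forall (b : Rn -> R) (be : R), (0 < be)%R -> lmeasurable b ->
  (forall Q : cube R n, leb.-integrable (cube_set Q) (EFin \o b)) ->
  (forall Q : cube R n, (osc b Q (avg b Q) <= be * vol Q)%R) ->
  forall Q : cube R n,
    \int[leb]_(x in cube_set Q) ((`|b x - avg b Q| / be) ^+ N)%:E <= (K * vol Q)%:E.
Proof.
(* With rate 1/4 the polynomial weights meet the decay 2/3 of [john_nirenberg] in the ratio 5/4 *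
   2/3 = 5/6; the 42 below is 7 / (1 - 5/6). *)
have [C C0 HC] := @natexp_le_geometric R N (1 / 4) ltac:(apply/andP; split; lra).
pose l := (2 ^+ n.+1 : R)%R; have l0 : (0 < l)%R by rewrite exprn_gt0.
exists (l ^+ N * (1 + 42 * (2 ^+ N * C)))%R.
  by rewrite mulr_gt0 ?exprn_gt0// addr_gt0// !mulr_gt0// exprn_gt0.
move=> b be be0 mb ib hb Q; have v0 := vol_gt0 Q; have mQ := measurable_cube Q.
have bi0 : (0 <= be^-1)%R by rewrite invr_ge0 ltW.
pose c := avg b Q.
pose A j : set Rn := cube_set Q `&` [set x | (j%:R * @jnL R n be < `|b x - c|)%R].
have mA j : measurable (A j : set lT).
  have := @measurable_dev _ _ b mb Q c (measurable_cube Q) _ (emeasurable_itv `](j%:R * @jnL R n be)%:E, +oo[).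
  congr measurable; apply/seteqP; split => x [xQ] /=; rewrite in_itv/= andbT lte_fin; by split.
pose w (j : nat) : R := ((2 * j.+1%:R) ^+ N)%R; have w0 j : (0 <= w j)%R by rewrite exprn_ge0.
have mIA j (D : set lT) : measurable_fun (T := lT) D (fun x => (w j * \1_(A j) x)%:E).
  by apply/measurable_EFinP; apply: measurable_funM => //; apply: measurable_indic.
have IA0 j x : 0 <= (w j * \1_(A j) x : R)%:E by rewrite lee_fin mulr_ge0.
apply: (@le_trans _ _ (\int[leb]_(x in cube_set Q) ((l ^+ N)%:E *
    (1 + \sum_(j <oo) (w j * \1_(A j) x)%:E)))).
  apply: ge0_le_integral; first exact: mQ.
  - by move=> x _; rewrite lee_fin exprn_ge0// divr_ge0// ltW.
  - apply/measurable_EFinP; apply: measurable_funX; apply: measurable_funM; last exact: measurable_cst.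
    exact/measurable_EFinP/measurable_dev.
  - apply: emeasurable_funM; first exact: measurable_cst.
    apply: emeasurable_funD; first exact: measurable_cst.
    by apply: ge0_emeasurable_sum => [j x _ _|j _]; [exact: IA0|exact: mIA].
  move=> x xQ; set y := (`|b x - avg b Q| / be)%R.
  have y0 : (0 <= y)%R by rewrite divr_ge0// ltW.
  have S0 : 0 <= \sum_(j <oo) (w j * \1_(A j) x : R)%:E by apply: nneseries_ge0.
  have [yl|yl] := leP y l.
    apply: (@le_trans _ _ ((l ^+ N)%:E * 1)).
      by rewrite mule1 lee_fin lerXn2r ?nnegrE// ltW.
    by rewrite lee_wpmul2l ?lee_fin ?exprn_ge0 ?(ltW l0)// leeDl.
  (* [A] asks for a strict inequality while truncation gives [j <= y / l], so [x] is only certain to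
     lie in [A j.-1]; the factor 2 in [w] absorbs j + 1 <= 2 j. *)
  pose j := Num.truncn (y / l)%R.
  have yl0 : (0 <= y / l)%R by rewrite divr_ge0// ltW.
  have /andP[j1 j2] := truncn_itv yl0.
  have jpos : (0 < j)%N by rewrite truncn_gt0 ler_pdivlMr// mul1r ltW.
  have Ajx : \1_(A j.-1) x = 1%R :> R.
    rewrite indicE mem_set//; split => //=; rewrite /jnL -/l.
    rewrite mulrA -ltr_pdivlMr//; apply: (@lt_le_trans _ _ (j%:R * l)%R).
      by rewrite ltr_pM2r// ltr_nat prednK.
    by rewrite -ler_pdivlMr.
  apply: (@le_trans _ _ ((l ^+ N)%:E * (w j.-1 * \1_(A j.-1) x)%:E)).
    rewrite Ajx mulr1 -EFinM lee_fin /w -exprMn lerXn2r ?nnegrE ?mulr_ge0 ?(ltW l0)//.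
    rewrite prednK// mulrC -ler_pdivrMr//; apply: (le_trans (ltW j2)).
    by rewrite -natrM ler_nat -/j mul2n -addnn -addn1 leq_add2l.
  rewrite lee_wpmul2l ?lee_fin ?exprn_ge0 ?(ltW l0)//.
  rewrite (@nneseriesD1 _ _ j.-1 xpredT)//.
  rewrite addeA addeAC; apply: leeDr; rewrite adde_ge0//.
  by apply: nneseries_ge0 => i _ _; exact: IA0.
have AL j : leb (A j) <= (7 * (2 / 3) ^+ j * vol Q)%:E by exact: john_nirenberg.
rewrite ge0_integralZl; [|exact: mQ| | |]; last first.
- by rewrite lee_fin exprn_ge0// ltW.
- by move=> x _; rewrite adde_ge0// nneseries_ge0.
- apply: emeasurable_funD; first exact: measurable_cst.
  by apply: ge0_emeasurable_sum => [j x _ _|j _]; [exact: IA0|exact: mIA].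
rewrite ge0_integralD; [|exact: mQ|by []|exact: measurable_cst| |]; last first.
- by apply: ge0_emeasurable_sum => [j x _ _|j _]; [exact: IA0|exact: mIA].
- by move=> x _; apply: nneseries_ge0.
rewrite integral_cst// mul1e [X in _ * (X + _) <= _](leb_vol Q).
rewrite integral_nneseries; [|exact: mQ|by []|by []].
rewrite -mulrA EFinM lee_wpmul2l ?lee_fin ?exprn_ge0 ?(ltW l0)//.
rewrite mulrDl mul1r EFinD leeD2l//.
have -> : (42 * (2 ^+ N * C) * vol Q = (7 * (2 ^+ N * C) * vol Q) / (1 - 5 / 6))%R by field.
have i0 j : (0 <= 7 * (2 ^+ N * C) * vol Q * (5 / 6) ^+ j)%R.
  by rewrite !mulr_ge0 ?exprn_ge0 ?divr_ge0 ?(ltW C0) ?(ltW v0).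
apply: le_trans (_ : \sum_(j <oo) (7 * (2 ^+ N * C) * vol Q * (5 / 6) ^+ j)%:E <= _).
  apply: lee_nneseries => [j _ _|j _]; first by apply: integral_ge0 => x _; exact: IA0.
  under eq_integral do rewrite EFinM.
  rewrite ge0_integralZl; [|exact: mQ| |by []|by rewrite lee_fin]; last first.
    by apply/measurable_EFinP; apply: measurable_indic.
  rewrite integral_indic// (_ : A j `&` cube_set Q = A j); last first.
      by apply/setIidPl => x [].
    apply: le_trans (lee_wpmul2l _ (AL j)) _; first by rewrite lee_fin.
    rewrite -EFinM lee_fin /w exprMn.
    have -> : (7 * (2 ^+ N * C) * vol Q * (5 / 6) ^+ j = 2 ^+ N * (C * (1 + 1 / 4) ^+ j) * (7 * (2 / 3) ^+ j * vol Q))%R.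
      rewrite (_ : (5 / 6 = (1 + 1 / 4) * (2 / 3))%R); last by field.
      by rewrite exprMn; ring.
    by rewrite ler_wpM2r ?mulr_ge0 ?exprn_ge0 ?divr_ge0 ?(ltW v0)// ler_wpM2l ?exprn_ge0.
apply: nneseries_geometric_le => //; first by apply/andP; split; lra.
- by rewrite !mulr_ge0 ?exprn_ge0 ?(ltW C0) ?(ltW v0).
- by move=> j; rewrite i0 lexx.
Qed.

End Moments.

(** * Weak-type bounds for sums over sparse families *)

Section WeakAverage.
Context {R : realType} {n : nat}.
Local Notation Rn := 'rV[R]_n.
Local Notation lT := (lebesgue_type R n).
Local Open Scope ereal_scope.

Lemma le_powers (r : R) (y : R) : (1 < r)%R -> (0 <= y)%R -> exists l : nat, (y <= r ^+ l)%R.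
Proof.
move=> r1 y0; have [l yl] : exists l : nat, (y / (r - 1) <= l%:R)%R.
  by exists (Num.truncn (y / (r - 1))).+1; apply/ltW/truncnS_gt.
exists l; move: yl; rewrite ler_pdivrMr ?subr_gt0// => /le_trans; apply.
apply: (@le_trans _ _ (1 + l%:R * (r - 1))%R); first by rewrite lerDr.
elim: l => [|l IH]; first by rewrite mul0r addr0 expr0.
rewrite exprS -natr1; have l0 : (0 <= l%:R * (r - 1) * (r - 1) :> R)%R.
  by rewrite !mulr_ge0//; lra.
move: IH; move: (_ ^+ l)%R => u; nra.
Qed.

(** Truncation at height s^l: since s^N = 2, the factor (s/2)^l is (s^l)^(1-N), and a value [y]
    above the height gains (y / s^l)^(N-1) >= 1. *)
Lemma weight_split (N : nat) (s y : R) (l : nat) : (0 < N)%N -> (0 < s)%R ->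
  (s ^+ N = 2)%R -> (0 <= y)%R -> (y <= s ^+ l + (s / 2) ^+ l * y ^+ N)%R.
Proof.
case: N => // N _ s0 sN y0; have sl : (0 < s ^+ l)%R by rewrite exprn_gt0.
have [ys|ys] := leP y (s ^+ l)%R.
  by rewrite (le_trans ys)// lerDl mulr_ge0// exprn_ge0// ?divr_ge0 ?ltW.
apply: (@le_trans _ _ ((s / 2) ^+ l * y ^+ N.+1)%R); last by rewrite lerDr ltW.
rewrite exprMn exprVn -sN -exprM mulnC exprM exprS; move: (s ^+ l)%R sl ys => u u0 uy.
have u0' : (u != 0)%R by rewrite gt_eqF.
have uN0 : (u ^+ N != 0)%R by rewrite expf_neq0.
have -> : (u * (u * u ^+ N)^-1 * y ^+ N.+1 = y * (y / u) ^+ N)%R.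
  by rewrite exprMn exprVn exprS; field; rewrite u0' uN0.
by rewrite ler_peMr// exprn_ege1// ler_pdivlMr// mul1r ltW.
Qed.

Definition weighted (N : nat) (K : R) (Q : cube R n) (X : Rn -> R) : Prop :=
  [/\ forall x, (0 <= X x)%R,
      measurable_fun (T := lT) (cube_set Q) X &
      \int[leb]_(x in cube_set Q) (X x ^+ N)%:E <= (K * vol Q)%:E].

Lemma weighted_integral_le (N : nat) (K s : R) (Q : cube R n) (X : Rn -> R)
    (E : set Rn) (l : nat) : (0 < N)%N -> (0 < s)%R -> (s ^+ N = 2)%R ->
  measurable (E : set lT) -> weighted N K Q X ->
  \int[leb]_(x in cube_set Q) (X x * \1_E x)%:E <=
    (s ^+ l)%:E * leb (cube_set Q `&` E) + ((s / 2) ^+ l * (K * vol Q))%:E.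
Proof.
move=> N0 s0 sN mE [X0 mX XK]; have mQ := measurable_cube Q.
have mI : measurable_fun (T := lT) (cube_set Q) (\1_E : Rn -> R) by exact: measurable_indic.
have mXN : measurable_fun (T := lT) (cube_set Q) (fun x => (X x ^+ N)%:E).
  by apply/measurable_EFinP; apply: measurable_funX.
have s20 : (0 <= (s / 2) ^+ l)%R by rewrite exprn_ge0// divr_ge0// ltW.
apply: (@le_trans _ _ (\int[leb]_(x in cube_set Q)
    ((s ^+ l)%:E * (\1_E x)%:E + ((s / 2) ^+ l)%:E * (X x ^+ N)%:E))).
  apply: ge0_le_integral; first exact: mQ.
  - by move=> x _; rewrite lee_fin mulr_ge0.
  - by apply/measurable_EFinP; apply: measurable_funM.
  - apply: emeasurable_funD; apply: emeasurable_funM; try exact: measurable_cst.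
      exact/measurable_EFinP.
    exact: mXN.
  move=> x _; rewrite -!EFinM -EFinD lee_fin indicE.
  case: (x \in E); rewrite ?mulr1 ?mulr0; first exact: weight_split.
  by rewrite add0r mulr_ge0// exprn_ge0.
rewrite ge0_integralD; [|exact: mQ|..]; last 4 first.
- by move=> x _; rewrite -EFinM lee_fin mulr_ge0// exprn_ge0// ltW.
- apply: emeasurable_funM; [exact: measurable_cst|exact/measurable_EFinP].
- by move=> x _; rewrite -EFinM lee_fin mulr_ge0// exprn_ge0.
- by apply: emeasurable_funM; [exact: measurable_cst|].
apply: leeD.
  rewrite ge0_integralZl; [|exact: mQ|exact/measurable_EFinP| |]; last 2 first.
  - by move=> x _; rewrite lee_fin.
  - by rewrite lee_fin exprn_ge0// ltW.
  by rewrite integral_indic// setIC.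
rewrite ge0_integralZl; [|exact: mQ|exact: mXN| |]; last 2 first.
- by move=> x _; rewrite lee_fin exprn_ge0.
- by rewrite lee_fin.
by rewrite EFinM lee_wpmul2l// lee_fin.
Qed.

(** A weak-type inequality for weighted means over disjoint cubes, expressed by the distribution of
    [f] on [W]. For a function in weak L^p the heights grow at the rate r = 2^(1/p). *)
Definition average_bound (N : nat) (K r A : R) : Prop :=
  forall (f : Rn -> R) (W : set Rn) (lam t : R) (S : seq (cube R n))
    (X : cube R n -> Rn -> R),
  lmeasurable f -> (0 < lam)%R -> (0 <= t)%R ->
  (forall l, leb (W `&` [set x | lam * r ^+ l < `|f x|]%R) <= (t * 2^-1 ^+ l)%:E) ->
  uniq S -> {in S &, forall Q Q', Q != Q' -> cube_set Q `&` cube_set Q' = set0} ->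
  {in S, forall Q, cube_set Q `<=` W} ->
  {in S, forall Q, weighted N K Q (X Q)} ->
  {in S, forall Q, (A * lam * vol Q)%:E <= \int[leb]_(x in cube_set Q) (X Q x * `|f x|)%:E} ->
  (\sum_(Q <- S) vol Q <= t)%R.

(** The layer of |f| at height lam r^l is paired with the weight truncated at s^l. Up to a constant,
    the bounded part costs (r s / 2)^l t and the moment part (r s / 2)^l K V, where V is the total
    volume of the cubes; [r * s < 2] makes both summable. *)
Lemma weighted_avg_weak (N : nat) (K r s : R) : (0 < N)%N -> (0 <= K)%R ->
  (1 < r)%R -> (0 < s)%R -> (s ^+ N = 2)%R -> (r * s < 2)%R ->
  exists2 A : R, (0 < A)%R & average_bound N K r A.
Proof.
move=> N0 K0 r1 s0 sN rs2.
have r0 : (0 < r)%R by lra.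
pose D := (r / (1 - r * s / 2))%R.
have D0 : (0 < D)%R by rewrite divr_gt0//; lra.
(* [1 + K] and [D * K] cancel the terms proportional to the total volume; the last [D] compares that
   volume with [t]. *)
exists (1 + K + D * K + D)%R; first by have := mulr_ge0 (ltW D0) K0; lra.
move=> f W lam t S X mf lam0 t0 Hf uS dS SW wX HA.
pose E l : set Rn := [set x | lam * r ^+ l < `|f x|]%R.
have mE l : measurable (E l : set lT).
  have mnf : measurable_fun (T := lT) setT (fun x => `|f x|%R).
    by apply: measurableT_comp; [exact: normr_measurable|exact: mf].
  have := mnf measurableT `](lam * r ^+ l)%R, +oo[%classic (measurable_itv _).
  by rewrite setTI; congr measurable; apply/seteqP; split => x /=; rewrite in_itv/= andbT.
have ptw x : (`|f x| %:E <= lam%:E + \sum_(l <oo) (lam * r ^+ l.+1 * \1_(E l) x)%:E).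
  have T0 l : 0 <= (lam * r ^+ l.+1 * \1_(E l) x)%:E.
    by rewrite lee_fin !mulr_ge0 ?exprn_ge0 ?(ltW lam0) ?(ltW r0).
  have [fl|fl] := leP (`|f x|)%R lam.
    by apply: (@le_trans _ _ lam%:E); rewrite ?lee_fin// leeDl// nneseries_ge0.
  have ex : exists l, (`|f x| <= lam * r ^+ l)%R.
    have [|l H] := @le_powers r (`|f x| / lam) r1; first by rewrite divr_ge0// ltW.
    by exists l; rewrite mulrC -ler_pdivrMr.
  (* The least power above |f x| finds the layer: if its exponent is [l.+1], minimality puts [x] in
     [E l]. *)
  have := ex_minnP ex; case=> -[|l] H1 H2.
    by rewrite expr0 mulr1 leNgt fl in H1.
  have El : \1_(E l) x = 1%R :> R.
    rewrite indicE mem_set// /E/= ltNge; apply/negP => /H2; by rewrite ltnn.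
  rewrite (@nneseriesD1 _ _ l xpredT)// El mulr1.
  apply: (@le_trans _ _ (lam * r ^+ l.+1)%:E); first by rewrite lee_fin.
  by rewrite addeCA leeDl// adde_ge0 ?lee_fin ?(ltW lam0)// nneseries_ge0.
have perQ Q : Q \in S -> \int[leb]_(x in cube_set Q) (X Q x * `|f x|)%:E <=
    (lam * ((1 + K) * vol Q))%:E + \sum_(l <oo) ((lam * r ^+ l.+1)%:E *
      ((s ^+ l)%:E * leb (cube_set Q `&` E l) + ((s / 2) ^+ l * (K * vol Q))%:E)).
  move=> QS; have wQ := wX _ QS; have [X0 mX XK] := wQ; have mQ := measurable_cube Q.
  have mXE (A : set Rn) : measurable (A : set lT) ->
      measurable_fun (T := lT) (cube_set Q) (fun x => (X Q x * \1_A x)%:E).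
    by move=> mA; apply/measurable_EFinP; apply: measurable_funM; [exact: mX|exact: measurable_indic].
  have T0 l x : 0 <= (lam * r ^+ l.+1)%:E * (X Q x * \1_(E l) x)%:E.
    by rewrite -EFinM lee_fin !mulr_ge0 ?exprn_ge0 ?(ltW lam0) ?(ltW r0).
  have mT l : measurable_fun (T := lT) (cube_set Q)
      (fun x => (lam * r ^+ l.+1)%:E * (X Q x * \1_(E l) x)%:E).
    by apply: emeasurable_funM; [exact: measurable_cst|exact: mXE].
  have mS : measurable_fun (T := lT) (cube_set Q)
      (fun x => \sum_(l <oo) (lam * r ^+ l.+1)%:E * (X Q x * \1_(E l) x)%:E).
    by apply: ge0_emeasurable_sum => [l x _ _|l _]; [exact: T0|exact: mT].
  apply: (@le_trans _ _ (\int[leb]_(x in cube_set Q) (lam%:E * (X Q x * \1_setT x)%:E +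
     \sum_(l <oo) (lam * r ^+ l.+1)%:E * (X Q x * \1_(E l) x)%:E))).
    apply: ge0_le_integral; first exact: mQ.
    - by move=> x _; rewrite lee_fin mulr_ge0.
    - apply/measurable_EFinP; apply: measurable_funM; first exact: mX.
      apply: measurable_funTS; apply: measurableT_comp; [exact: normr_measurable|exact: mf].
    - apply: emeasurable_funD; last exact: mS.
      by apply: emeasurable_funM; [exact: measurable_cst|exact: mXE].
    move=> x _; rewrite EFinM.
    apply: le_trans (lee_wpmul2l _ (ptw x)) _; first by rewrite lee_fin.
    rewrite ge0_muleDr; last 2 first.
    - by rewrite lee_fin ltW.
    - by apply: nneseries_ge0 => l _ _; rewrite lee_fin !mulr_ge0 ?exprn_ge0 ?(ltW lam0) ?(ltW r0).
    rewrite indicE in_setT mulr1 [X in X + _ <= _]muleC leeD2l//.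
    rewrite -nneseriesZl; last first.
      by move=> l _; rewrite lee_fin !mulr_ge0 ?exprn_ge0 ?(ltW lam0) ?(ltW r0).
    apply: lee_nneseries => [l _ _|l _]; rewrite -!EFinM.
      by rewrite lee_fin !mulr_ge0 ?exprn_ge0 ?(ltW lam0) ?(ltW r0).
    by rewrite lee_fin mulrCA.
  rewrite ge0_integralD; [|exact: mQ|..]; last 4 first.
  - by move=> x _; rewrite -EFinM lee_fin !mulr_ge0// ltW.
  - by apply: emeasurable_funM; [exact: measurable_cst|exact: mXE].
  - by move=> x _; apply: nneseries_ge0 => l _ _; exact: T0.
  - exact: mS.
  apply: leeD.
    rewrite ge0_integralZl; [|exact: mQ|exact: mXE| |]; last 2 first.
    - by move=> x _; rewrite lee_fin !mulr_ge0.
    - by rewrite lee_fin ltW.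
    rewrite EFinM lee_wpmul2l ?lee_fin ?(ltW lam0)//.
    apply: le_trans (weighted_integral_le 0 N0 s0 sN measurableT wQ) _.
    by rewrite !expr0 mul1e mul1r setIT leb_vol -EFinD mulrDl mul1r.
  rewrite integral_nneseries; [|exact: mQ|exact: mT|by []].
  apply: lee_nneseries => [l _ _|l _]; first by apply: integral_ge0 => x _; exact: T0.
  rewrite ge0_integralZl; [|exact: mQ|exact: mXE| |]; last 2 first.
  - by move=> x _; rewrite lee_fin !mulr_ge0.
  - by rewrite lee_fin mulr_ge0 ?exprn_ge0 ?(ltW lam0) ?(ltW r0).
  rewrite lee_wpmul2l ?lee_fin ?mulr_ge0 ?exprn_ge0 ?(ltW lam0) ?(ltW r0)//.
  exact: (weighted_integral_le l N0 s0 sN (mE l) wQ).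
pose V := (\sum_(Q <- S) vol Q)%R.
have V0 : (0 <= V)%R by apply: sumr_ge0 => Q _; exact/ltW/vol_gt0.
have sumE l : \sum_(Q <- S) leb (cube_set Q `&` E l) <= (t * 2^-1 ^+ l)%:E.
  apply: le_trans (Hf l); rewrite -leb_bigsetU//.
  - apply: le_lebesgue_outer => x; rewrite -bigcup_seq => -[Q /= QS [xQ xE]].
    by split => //; exact: (SW Q).
  - by move=> Q QS; apply: measurableI => //; exact: measurable_cube.
  - move=> Q Q' QS QS' QQ'; rewrite -subset0 => x [[xQ _] [xQ' _]].
    by have : (cube_set Q `&` cube_set Q') x by []; rewrite dS.
have H1 : (\sum_(Q <- S) ((1 + K + D * K + D) * lam * vol Q)%:E <=
    (lam * ((1 + K) * V))%:E + (lam * D * (t + K * V))%:E).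
  apply: (@le_trans _ _ (\sum_(Q <- S) ((lam * ((1 + K) * vol Q))%:E + \sum_(l <oo) ((lam * r ^+ l.+1)%:E *
      ((s ^+ l)%:E * leb (cube_set Q `&` E l) + ((s / 2) ^+ l * (K * vol Q))%:E))))).
    rewrite big_seq [leRHS]big_seq; apply: lee_sum => Q QS.
    exact: le_trans (HA Q QS) (perQ Q QS).
  rewrite big_split/=; apply: leeD.
    by rewrite sumEFin lee_fin -!mulr_sumr.
  rewrite -nneseries_sum; last first.
    move=> Q l; rewrite mule_ge0// ?lee_fin ?mulr_ge0 ?exprn_ge0 ?(ltW lam0) ?(ltW r0)//.
    rewrite adde_ge0//; last by rewrite lee_fin !mulr_ge0 ?exprn_ge0 ?divr_ge0 ?(ltW s0) ?(ltW (vol_gt0 Q)).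
    by rewrite mule_ge0// ?lee_fin ?exprn_ge0 ?(ltW s0)// lebesgue_outer_ge0.
  apply: (@le_trans _ _ (\sum_(l <oo) (lam * r * (t + K * V) * (r * s / 2) ^+ l)%:E)).
    apply: lee_nneseries => [l _ _|l _].
      apply: sume_ge0 => Q _; rewrite mule_ge0// ?lee_fin ?mulr_ge0 ?exprn_ge0 ?(ltW lam0) ?(ltW r0)//.
      rewrite adde_ge0//; last by rewrite lee_fin !mulr_ge0 ?exprn_ge0 ?divr_ge0 ?(ltW s0) ?(ltW (vol_gt0 Q)).
      by rewrite mule_ge0// ?lee_fin ?exprn_ge0 ?(ltW s0)// lebesgue_outer_ge0.
    rewrite -ge0_sume_distrr; last first.
      move=> Q _; rewrite adde_ge0//; last by rewrite lee_fin !mulr_ge0 ?exprn_ge0 ?divr_ge0 ?(ltW s0) ?(ltW (vol_gt0 Q)).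
      by rewrite mule_ge0// ?lee_fin ?exprn_ge0 ?(ltW s0)// lebesgue_outer_ge0.
    have -> : (lam * r * (t + K * V) * (r * s / 2) ^+ l =
      (lam * r ^+ l.+1) * (s ^+ l * (t * 2^-1 ^+ l) + (s / 2) ^+ l * (K * V)))%R.
      by rewrite exprS !exprMn; ring.
    rewrite [X in _ <= X]EFinM lee_wpmul2l ?lee_fin ?mulr_ge0 ?exprn_ge0 ?(ltW lam0) ?(ltW r0)//.
    rewrite big_split/= EFinD; apply: leeD.
      rewrite -ge0_sume_distrr; last by move=> Q _; exact: lebesgue_outer_ge0.
      by rewrite [X in _ <= X]EFinM lee_wpmul2l// lee_fin exprn_ge0// ltW.
    by rewrite sumEFin lee_fin -!mulr_sumr.
  apply: le_trans (nneseries_geometric_le (C := (lam * r * (t + K * V))%R) (r := (r * s / 2)%R) _ _ _) _.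
  - by apply/andP; split; [rewrite divr_ge0// mulr_ge0// ltW|lra].
  - by rewrite !mulr_ge0 ?addr_ge0 ?mulr_ge0 ?(ltW lam0) ?(ltW r0).
  - move=> l; rewrite lexx andbT !mulr_ge0 ?addr_ge0 ?mulr_ge0 ?(ltW lam0) ?(ltW r0)//.
    by rewrite exprn_ge0// divr_ge0// mulr_ge0// ltW.
  by rewrite lee_fin /D -!mulrA ler_wpM2l ?(ltW lam0)// ler_wpM2l ?(ltW r0)// mulrC.
move: H1; rewrite sumEFin -EFinD lee_fin -mulr_sumr -/V => H1.
rewrite -(ler_pM2l (mulr_gt0 lam0 D0)).
nra.
Qed.

End WeakAverage.

(** * Layers of a sparse family *)

Section Layers.
Context {R : realType} {n : nat}.
Local Notation Rn := 'rV[R]_n.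
Local Notation lT := (lebesgue_type R n).
Local Open Scope ereal_scope.
Hypothesis n0 : (0 < n)%N.

Lemma cube_corner (Q : cube R n) : cube_set Q Q.1.
Proof. by apply/cube_setP => i; rewrite lexx/= ltrDl. Qed.

Lemma cube_sub_vol (P Q : cube R n) : cube_set P `<=` cube_set Q -> (vol P <= vol Q)%R.
Proof. by move=> PQ; rewrite -lee_fin -!leb_vol; exact: le_lebesgue_outer. Qed.

Lemma cube_sub_eq (P Q : cube R n) : cube_set P `<=` cube_set Q ->
  (vol Q <= vol P)%R -> P = Q.
Proof.
move=> PQ; rewrite /vol ler_pXn2r ?nnegrE// => sQP.
have sPQ : ((P.2)%:num <= (Q.2)%:num)%R.
  by have := cube_sub_vol PQ; rewrite /vol ler_pXn2r ?nnegrE.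
have sE : (P.2)%:num = (Q.2)%:num by apply/eqP; rewrite eq_le sPQ.
have H i : P.1 ord0 i = Q.1 ord0 i.
  have /cube_setP/(_ i)/andP[QP _] := PQ _ (cube_corner P).
  apply/eqP; rewrite eq_le QP andbT leNgt; apply/negP => lt.
  pose y : Rn := \row_j if j == i then Num.max (P.1 ord0 i) (Q.1 ord0 i + (Q.2)%:num)%R
    else P.1 ord0 j.
  have /PQ/cube_setP/(_ i) : cube_set P y.
    apply/cube_setP => j; rewrite !mxE; case: eqVneq => [->|_]; last by rewrite lexx/= ltrDl.
    by rewrite le_max lexx/= gt_max ltrDl sE ltrD2r lt andbT.
  by rewrite !mxE eqxx gt_max ltxx !andbF.
case: P Q H sE {PQ sQP sPQ} => [a s] [b u] /= H sE; congr pair.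
  by apply/rowP => i.
exact/val_inj.
Qed.

Lemma cube_set_inj (P Q : cube R n) : cube_set P = cube_set Q -> P = Q.
Proof. by move=> PQ; apply: cube_sub_eq; rewrite ?PQ// cube_sub_vol// PQ. Qed.

Definition nested (S : seq (cube R n)) := {in S &, forall P Q,
  [\/ cube_set P `&` cube_set Q = set0, cube_set P `<=` cube_set Q
    | cube_set Q `<=` cube_set P]}.

Definition sparse_seq (eta : R) (S : seq (cube R n)) := {in S, forall Q,
  leb (\bigcup_(Q' in [set Q' | Q' \in S /\ cube_set Q' `<` cube_set Q]) cube_set Q')
   <= ((1 - eta) * vol Q)%:E}.

Definition cube_union (S : seq (cube R n)) : set Rn := \bigcup_(Q in [set` S]) cube_set Q.

Lemma seq_argmax (T : eqType) (s : seq T) (f : T -> R) x0 : x0 \in s ->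
  exists2 x, x \in s & {in s, forall y, (f y <= f x)%R}.
Proof.
elim: s x0 => [//|a s IH] x0 _.
case: s IH => [_|b s IH].
  by exists a; rewrite ?mem_head// => y; rewrite inE => /eqP ->.
have [|x xs Hx] := IH b; first exact: mem_head.
have [fxa|fxa] := leP (f x) (f a).
  exists a; first exact: mem_head.
  move=> y; rewrite inE => /predU1P[->//|/Hx /le_trans]; exact.
exists x; first by rewrite inE xs orbT.
by move=> y; rewrite inE => /predU1P[->|/Hx//]; exact: ltW.
Qed.

Definition above (S : seq (cube R n)) (Q : cube R n) : bool :=
  has (fun P => `[< cube_set Q `<` cube_set P >]) S.

Definition tops S := [seq Q <- S | ~~ above S Q].

Lemma tops_cover S Q : Q \in S -> exists2 P, P \in tops S & cube_set Q `<=` cube_set P.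
Proof.
move=> QS; pose s := [seq P <- S | `[< cube_set Q `<=` cube_set P >]].
have [|P] := @seq_argmax _ s vol Q.
  by rewrite mem_filter QS andbT; apply/asboolP.
rewrite mem_filter => /andP[/asboolP QP PS] Pmax; exists P => //.
rewrite mem_filter PS andbT; apply/hasPn => P' P'S; apply/asboolPn => -[PP' P'P].
apply: P'P; rewrite (cube_sub_eq PP')//; apply: Pmax.
by rewrite mem_filter P'S andbT; apply/asboolP; exact: subset_trans PP'.
Qed.

Lemma tops_disjoint S : nested S -> {in tops S &, forall P Q, P != Q ->
  cube_set P `&` cube_set Q = set0}.
Proof.
move=> nS P Q; rewrite !mem_filter => /andP[/hasPn aP PS] /andP[/hasPn aQ QS] PQ.
case: (nS _ _ PS QS) => // PQs.
- have /asboolPn := aP _ QS; case; split => // QP.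
  by move/eqP: PQ; apply; apply: cube_set_inj; apply/seteqP.
- have /asboolPn := aQ _ PS; case; split => // QP.
  by move/eqP: PQ; apply; apply: cube_set_inj; apply/seteqP.
Qed.

Lemma sum_tops S : uniq S -> nested S ->
  (\sum_(Q <- tops S) vol Q)%:E = leb (cube_union S).
Proof.
move=> uS nS; have -> : cube_union S = \big[setU/set0]_(Q <- tops S) cube_set Q.
  rewrite -bigcup_seq; apply/seteqP; split => x [Q /= QS xQ].
    by have [P PS QP] := tops_cover QS; exists P => //; exact: QP.
  by exists Q => //=; move: QS; rewrite mem_filter => /andP[].
rewrite leb_bigsetU ?filter_uniq//.
- by rewrite -sumEFin; apply: eq_bigr => Q _; rewrite leb_vol.
- by move=> Q _; exact: measurable_cube.
- exact: tops_disjoint.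
Qed.

(** The maximal cubes are peeled off repeatedly, and [g] counts the rounds that a cube survives.
    Cubes of one round are disjoint, and sparseness below each maximal cube shrinks the covered set
    by the factor [1 - eta] per round. *)
Lemma sparse_layers (eta : R) (S : seq (cube R n)) : (0 < eta < 1)%R ->
  uniq S -> nested S -> sparse_seq eta S ->
  exists g : cube R n -> nat,
    {in S &, forall P Q, g P = g Q -> P != Q -> cube_set P `&` cube_set Q = set0} /\
    forall i, (\sum_(Q <- S | g Q == i) vol Q)%:E <= ((1 - eta) ^+ i)%:E * leb (cube_union S).
Proof.
move=> /andP[eta0 eta1]; have [m] := ubnP (size S).
elim: m S => // m IH S Sm uS nS sS.
case: (altP (S =P [::])) => [->|Sn0].
  exists (fun=> 0%N); split => // i; rewrite big_nil; apply: mule_ge0; last exact: lebesgue_outer_ge0.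
  by rewrite lee_fin exprn_ge0//; lra.
pose S' := [seq Q <- S | above S Q].
have S'S : {subset S' <= S} by move=> Q; rewrite mem_filter => /andP[].
have S'm : (size S' < m)%N.
  apply: (@leq_trans (size S)); last by rewrite -ltnS.
  have [Q QS] : exists Q, Q \in S by case: (S) Sn0 => // a s _; exists a; exact: mem_head.
  have [P PT _] := tops_cover QS.
  rewrite -(count_predC (above S) S) -!size_filter -addn1 leq_add2l -has_predT.
  by apply/hasP; exists P.
have [||g [g1 g2]] := IH S' S'm (filter_uniq _ uS).
- by move=> P Q /S'S PS /S'S QS; exact: nS.
- move=> Q /S'S QS; apply: le_trans (sS _ QS); apply: le_lebesgue_outer.
  by move=> x [P [/S'S PS PQ] xP]; exists P.
have coverS' : leb (cube_union S') <= (1 - eta)%:E * leb (cube_union S).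
  rewrite -(sum_tops uS nS) -EFinM mulr_sumr -sumEFin.
  apply: (@le_trans _ _ (\sum_(P <- tops S) leb (\bigcup_(Q' in [set Q' | Q' \in S /\ cube_set Q' `<` cube_set P]) cube_set Q'))).
    apply: le_trans (leb_bigsetU_le _ _); apply: le_lebesgue_outer => x [Q /= QS' xQ].
    move: (QS'); rewrite mem_filter => /andP[/hasP[P0 P0S /asboolP QP0] QS].
    have [P PT P0P] := tops_cover P0S.
    rewrite -bigcup_seq; exists P => //; exists Q => //; split => //.
    by split; [exact: subset_trans QP0.1 P0P|move=> PQ; apply: QP0.2; exact: subset_trans PQ].
  rewrite big_seq [leRHS]big_seq; apply: lee_sum => P.
  by rewrite mem_filter => /andP[_ PS]; exact: sS.
exists (fun Q => if above S Q then (g Q).+1 else 0%N); split.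
  move=> P Q PS QS; case: ifPn => aP; case: ifPn => aQ //.
    by move=> [gPQ]; apply: g1 => //; rewrite mem_filter ?aP ?aQ.
  by move=> _; apply: (tops_disjoint nS); rewrite mem_filter ?aP ?aQ.
case=> [|i].
  rewrite expr0 mul1e -sum_tops// big_filter lee_fin le_eqVlt; apply/orP; left.
  apply/eqP; apply: eq_bigl => Q; by case: ifP.
apply: (@le_trans _ _ (((1 - eta) ^+ i)%:E * leb (cube_union S'))).
  apply: le_trans (g2 i); rewrite big_filter_cond lee_fin le_eqVlt; apply/orP; left.
  by apply/eqP; apply: eq_bigl => Q; case: ifP => //= _.
rewrite exprSr EFinM -muleA lee_wpmul2l// lee_fin exprn_ge0//; lra.
Qed.

End Layers.

(** * Thresholds depending on size and layer *)

Section Keyed.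
Context {R : realType} {n : nat}.
Local Notation Rn := 'rV[R]_n.
Local Notation lT := (lebesgue_type R n).
Local Open Scope ereal_scope.

Lemma sum_by_key (T : Type) (s : seq T) (kf gf : T -> nat) (K G : nat) (F : T -> R) :
  (forall x, (kf x < K)%N) -> (forall x, (gf x < G)%N) ->
  (\sum_(x <- s) F x =
   \sum_(k < K) \sum_(g < G) \sum_(x <- s | (kf x == k) && (gf x == g)) F x)%R.
Proof.
move=> kK gG.
under [RHS]eq_bigr => k _ do rewrite (exchange_big_dep predT)//=.
rewrite (exchange_big_dep predT)//=; apply: eq_bigr => x _.
rewrite (bigD1 (Ordinal (kK x)))//= (bigD1 (Ordinal (gG x)))/= ?eqxx//.
rewrite [X in (_ + X + _)%R]big1 => [|g /andP[/andP[_ /eqP gx] /eqP]]; last first.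
  by case; apply: val_inj.
rewrite addr0 [X in (_ + X)%R]big1 ?addr0// => k kx; rewrite big1// => g /andP[/eqP kxx _].
by move/eqP: kx; case; apply: val_inj.
Qed.

Lemma sum_indic_disjoint (s : seq (cube R n)) (P : pred (cube R n)) (x : Rn) :
  uniq s ->
  {in s &, forall Q Q', P Q -> P Q' -> Q != Q' -> cube_set Q `&` cube_set Q' = set0} ->
  (\sum_(Q <- s | P Q) \1_(cube_set Q) x <= 1 :> R)%R.
Proof.
elim: s => [|Q s IH] /=; first by rewrite big_nil.
move=> /andP[Qs us] dS; rewrite big_cons.
have IHs : (\sum_(Q <- s | P Q) \1_(cube_set Q) x <= 1 :> R)%R.
  by apply: IH => // Q1 Q2 Q1s Q2s; apply: dS; rewrite inE ?Q1s ?Q2s orbT.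
case: ifPn => // PQ; case: (boolP (x \in cube_set Q)) => xQ; last first.
  by rewrite indicE (negbTE xQ) add0r.
rewrite big_seq_cond big1 ?addr0 ?indicE ?xQ// => Q' /andP[Q's PQ'].
rewrite indicE; case: (boolP (x \in cube_set Q')) => // xQ'.
have QQ' : Q != Q' by apply: contraNneq Qs => ->.
move: xQ xQ'; rewrite !inE => xQ xQ'.
have : (cube_set Q `&` cube_set Q') x by [].
by rewrite dS// ?mem_head// inE Q's orbT.
Qed.

Lemma sum_geom2_le (a b : R) (K G : nat) : (0 <= a < 1)%R -> (0 <= b < 1)%R ->
  (\sum_(k < K) \sum_(g < G) a ^+ k * b ^+ g <= (1 - a)^-1 * (1 - b)^-1)%R.
Proof.
move=> a01 b01.
under eq_bigr => k _ do rewrite -mulr_sumr.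
rewrite -mulr_suml ler_pM ?sum_geometric_le//.
- by apply: sumr_ge0 => k _; rewrite exprn_ge0//; case/andP: a01.
- by apply: sumr_ge0 => k _; rewrite exprn_ge0//; case/andP: b01.
Qed.

Definition tail_le (N : nat) (H : R) (Q : cube R n) (h : Rn -> R) : Prop :=
  [/\ forall x, (0 <= h x)%R &
  forall mu : R, (0 < mu)%R ->
  leb (cube_set Q `&` [set x | mu < h x]%R) <= (H * mu^-1 ^+ N * vol Q)%:E].

(** [kf] records the size of the coefficient and [gf] the layer. The threshold T sg^kf rh^gf for
    [h Q] balances two series: below it, disjointness bounds the sum because [rho * sg < 1] and
    [rh < 1]; the sets where it is exceeded have summable measure because [B < sg ^+ N] and
    [D < rh ^+ N]. *)
Lemma keyed_weak (N : nat) (H M B D rho sg rh v Lam T : R) (S : seq (cube R n))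
    (kf gf : cube R n -> nat) (al : cube R n -> R) (h : cube R n -> Rn -> R) :
  (0 <= rho)%R -> (0 < sg)%R -> (0 < rh)%R -> (0 <= H)%R -> (0 <= M)%R -> (0 <= v)%R ->
  (0 < T)%R -> (0 <= Lam)%R -> (0 <= B)%R -> (0 <= D)%R ->
  (rho * sg < 1)%R -> (rh < 1)%R -> (B < sg ^+ N)%R -> (D < rh ^+ N)%R ->
  uniq S ->
  {in S &, forall Q Q', kf Q = kf Q' -> gf Q = gf Q' -> Q != Q' ->
     cube_set Q `&` cube_set Q' = set0} ->
  (forall k g, \sum_(Q <- S | (kf Q == k) && (gf Q == g)) vol Q
      <= M * B ^+ k * D ^+ g * v)%R ->
  {in S, forall Q, 0 <= al Q <= Lam * rho ^+ (kf Q)}%R ->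
  {in S, forall Q, tail_le N H Q (h Q)} ->
  leb [set x | Lam * T * ((1 - rho * sg)^-1 * (1 - rh)^-1) <
        \sum_(Q <- S) al Q * h Q x * \1_(cube_set Q) x]%R <=
  (H * M * v * T^-1 ^+ N * ((1 - B / sg ^+ N)^-1 * (1 - D / rh ^+ N)^-1))%:E.
Proof.
move=> rho0 sg0 rh0 H0 M0 v0 T0 Lam0 B0 D0 rs1 rh1 BN DN uS dS HS alS hS.
pose mu (Q : cube R n) := (T * sg ^+ kf Q * rh ^+ gf Q)%R.
have mu0 Q : (0 < mu Q)%R by rewrite !mulr_gt0// exprn_gt0.
pose K := (\max_(Q <- S) kf Q).+1; pose G := (\max_(Q <- S) gf Q).+1.
(* [sum_by_key] wants keys bounded on all cubes, hence the value 0 outside [S]. *)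
pose kf' Q := if Q \in S then kf Q else 0%N; pose gf' Q := if Q \in S then gf Q else 0%N.
have kK Q : (kf' Q < K)%N.
  by rewrite /kf' /K; case: ifPn => // QS; rewrite ltnS; exact: leq_bigmax_seq.
have gG Q : (gf' Q < G)%N.
  by rewrite /gf' /G; case: ifPn => // QS; rewrite ltnS; exact: leq_bigmax_seq.
have byk (F : cube R n -> R) : (\sum_(Q <- S) F Q = \sum_(k < K) \sum_(g < G)
    \sum_(Q <- S | (kf Q == k) && (gf Q == g)) F Q)%R.
  rewrite (sum_by_key _ _ kK gG); apply: eq_bigr => k _; apply: eq_bigr => g _.
  rewrite big_seq_cond [RHS]big_seq_cond; apply: eq_bigl => Q.
  by rewrite /kf' /gf'; case: (Q \in S).
pose Exc := \big[setU/set0]_(Q <- S) (cube_set Q `&` [set x | mu Q < h Q x]%R).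
apply: (@le_trans _ _ (leb Exc)).
  apply: le_lebesgue_outer => x /=; apply: contraPP => xE; apply/negP; rewrite -leNgt.
  apply: (@le_trans _ _ (\sum_(Q <- S) Lam * T * ((rho * sg) ^+ kf Q * rh ^+ gf Q) * \1_(cube_set Q) x)%R).
    rewrite big_seq [leRHS]big_seq; apply: ler_sum => Q QS.
    have /andP[al0 alL] := alS _ QS; have [h0 _] := hS _ QS.
    rewrite indicE; case: (boolP (x \in cube_set Q)); rewrite ?mulr0// inE => xQ; rewrite !mulr1.
    apply: (@le_trans _ _ (Lam * rho ^+ kf Q * mu Q)%R); last by rewrite /mu exprMn le_eqVlt; apply/orP; left; apply/eqP; ring.
    apply: ler_pM => //; rewrite leNgt; apply/negP => hx; apply: xE.
    by rewrite /Exc -bigcup_seq; exists Q.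
  rewrite byk.
  apply: (@le_trans _ _ (\sum_(k < K) \sum_(g < G) Lam * T * ((rho * sg) ^+ k * rh ^+ g))%R).
    apply: ler_sum => k _; apply: ler_sum => g _.
    rewrite (eq_bigr (fun Q => Lam * T * ((rho * sg) ^+ k * rh ^+ g) * \1_(cube_set Q) x)%R); last first.
      by move=> Q /andP[/eqP -> /eqP ->].
    rewrite -mulr_sumr ler_piMr//.
      by rewrite !mulr_ge0 ?exprn_ge0 ?mulr_ge0 ?(ltW T0) ?(ltW sg0) ?(ltW rh0).
    apply: sum_indic_disjoint => // Q Q' QS Q'S /andP[/eqP k1 /eqP g1] /andP[/eqP k2 /eqP g2].
    by apply: dS => //; rewrite ?k1 ?k2 ?g1 ?g2.
  under eq_bigr do rewrite -mulr_sumr.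
  rewrite -mulr_sumr ler_wpM2l ?mulr_ge0 ?(ltW T0)// sum_geom2_le//.
    by rewrite mulr_ge0 ?(ltW sg0).
  by rewrite (ltW rh0).
apply: le_trans (leb_bigsetU_le _ _) _.
apply: (@le_trans _ _ (\sum_(Q <- S) (H * (mu Q)^-1 ^+ N * vol Q)%:E)).
  rewrite big_seq [leRHS]big_seq; apply: lee_sum => Q QS.
  by have [_] := hS _ QS; apply.
rewrite sumEFin lee_fin byk.
apply: (@le_trans _ _ (\sum_(k < K) \sum_(g < G)
   (H * M * v * T^-1 ^+ N) * ((B / sg ^+ N) ^+ k * (D / rh ^+ N) ^+ g))%R); last first.
  under eq_bigr do rewrite -mulr_sumr.
  rewrite -mulr_sumr ler_wpM2l ?mulr_ge0 ?exprn_ge0 ?invr_ge0 ?(ltW T0)// sum_geom2_le//.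
    by rewrite divr_ge0 ?exprn_ge0 ?(ltW sg0)//= ltr_pdivrMr ?exprn_gt0// mul1r.
  by rewrite divr_ge0 ?exprn_ge0 ?(ltW rh0)//= ltr_pdivrMr ?exprn_gt0// mul1r.
apply: ler_sum => k _; apply: ler_sum => g _.
pose m := (T * sg ^+ k * rh ^+ g)%R.
rewrite (eq_bigr (fun Q => H * m^-1 ^+ N * vol Q)%R); last first.
  by move=> Q /andP[/eqP k1 /eqP g1]; rewrite /mu k1 g1.
have m0 : (0 < m)%R by rewrite !mulr_gt0// exprn_gt0.
rewrite -mulr_sumr; apply: le_trans (ler_wpM2l _ (HS k g)) _.
  by rewrite mulr_ge0// exprn_ge0// invr_ge0 ltW.
have sg1 : (sg != 0)%R by rewrite gt_eqF.
have rh2 : (rh != 0)%R by rewrite gt_eqF.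
have T2 : (T != 0)%R by rewrite gt_eqF.
rewrite le_eqVlt; apply/orP; left; apply/eqP.
rewrite /m !exprMn !exprVn !exprMn -!exprM [(k * N)%N]mulnC [(g * N)%N]mulnC !exprM.
field.
by rewrite !expf_neq0.
Qed.

End Keyed.

Section SparseWeak.
Context {R : realType} {n : nat}.
Local Notation Rn := 'rV[R]_n.
Local Notation lT := (lebesgue_type R n).
Local Open Scope ereal_scope.
Hypothesis n0 : (0 < n)%N.

Lemma root_above (eta : R) (N : nat) : (0 < eta < 1)%R ->
  exists rh : R, [/\ 0 < rh, rh < 1 & 1 - eta < rh ^+ N]%R.
Proof.
(* Bernoulli's inequality gives (1 - d)^N >= 1 - N d, and the denominator [N.+1] makes this strictly
   larger than [1 - eta]. *)
move=> /andP[e0 e1]; pose d := (eta / N.+1%:R)%R.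
have d0 : (0 < d)%R by rewrite divr_gt0.
have de : (d <= eta)%R by rewrite ler_pdivrMr// ler_peMr ?(ltW e0)// ler1n.
exists (1 - d)%R; split; [lra|lra|].
have H : (1 - N%:R * d <= (1 - d) ^+ N)%R.
  elim: (N) => [|i IH]; first by rewrite mul0r subr0 expr0.
  have i0 : (0 <= i%:R * d * d :> R)%R by rewrite !mulr_ge0// ltW.
  rewrite exprS -natr1; move: IH; move: (_ ^+ i)%R => u IH.
  have : ((1 - d) * (1 - i%:R * d) <= (1 - d) * u)%R by rewrite ler_wpM2l//; lra.
  lra.
apply: lt_le_trans H; rewrite ltrD2l ltrN2 /d mulrA ltr_pdivrMr//.
by rewrite mulrC ltr_pM2l// ltr_nat.
Qed.

Lemma power_level (rho Lam y : R) : (0 < rho < 1)%R -> (0 < y)%R -> (y <= Lam)%R ->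
  exists k : nat, (Lam * rho ^+ k.+1 < y /\ y <= Lam * rho ^+ k)%R.
Proof.
move=> /andP[r0 r1] y0 yL; have L0 := lt_le_trans y0 yL.
have ex : exists k, (Lam * rho ^+ k < y)%R.
  have [||k Hk] := @le_powers R rho^-1 (Lam / y + 1)%R.
  - by rewrite invf_gt1.
  - by rewrite addr_ge0// divr_ge0// ltW.
  exists k; rewrite mulrC -ltr_pdivlMl ?exprn_gt0// -exprVn mulrC -ltr_pdivrMl// mulrC.
  by apply: lt_le_trans Hk; rewrite ltrDl.
case: (ex_minnP ex) => -[|k] H1 H2.
  by move: H1; rewrite expr0 mulr1 ltNge yL.
by exists k; split => //; rewrite leNgt; apply/negP => /H2; rewrite ltnn.
Qed.

(** Cubes with [al Q > Lam] are covered by a set of measure at most [M * t] and discarded. The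
    others are grouped by the size Lam rho^k of [al Q]; each group has its own sparse layers, and
    both indices are fed to [keyed_weak] with [B = 2] and [D = 1 - eta]. *)
Lemma sparse_weak (N : nat) (eta rho sg H : R) : (0 < eta < 1)%R ->
  (0 < rho < 1)%R -> (0 < sg)%R -> (0 <= H)%R -> (rho * sg < 1)%R -> (2 < sg ^+ N)%R ->
  exists C C' : R, [/\ (0 < C)%R, (0 < C')%R &
  forall (S : seq (cube R n)) (al : cube R n -> R) (h : cube R n -> Rn -> R) (Lam M t : R),
  uniq S -> nested S -> sparse_seq eta S ->
  (0 < Lam)%R -> (0 <= M)%R -> (0 <= t)%R ->
  (forall Q, 0 <= al Q)%R -> {in S, forall Q, tail_le N H Q (h Q)} ->
  (forall k, leb (cube_union [seq Q <- S | Lam * rho ^+ k < al Q]%R) <= (M * 2 ^+ k * t)%:E) ->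
  leb [set x | C * Lam < \sum_(Q <- S) al Q * h Q x * \1_(cube_set Q) x]%R <=
    (C' * M * t)%:E].
Proof.
move=> eta01 rho01 sg0 H0 rs1 sgN; have /andP[eta0 eta1] := eta01.
have [rh [rh0 rh1 rhN]] := root_above N eta01.
have /andP[rho0 rho1] := rho01.
pose C := ((1 - rho * sg)^-1 * (1 - rh)^-1)%R.
pose C2 := ((1 - 2 / sg ^+ N)^-1 * (1 - (1 - eta) / rh ^+ N)^-1)%R.
have C0 : (0 < C)%R by rewrite mulr_gt0 ?invr_gt0 ?subr_gt0.
have C20 : (0 < C2)%R.
  rewrite mulr_gt0 ?invr_gt0 ?subr_gt0 ?ltr_pdivrMr ?mul1r ?exprn_gt0//.
exists C, (1 + H * 2 * C2)%R; split => //.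
  by have := mulr_ge0 H0 (ltW C20); lra.
move=> S al h Lam M t uS nS sS L0 M0 t0 al0 hS HV.
pose S' := [seq Q <- S | (0 < al Q) && (al Q <= Lam)]%R.
have S'S : {subset S' <= S} by move=> Q; rewrite mem_filter => /andP[].
have uS' : uniq S' by exact: filter_uniq.
have [kf Hkf] : {kf : cube R n -> nat & forall Q, Q \in S' ->
    (Lam * rho ^+ (kf Q).+1 < al Q /\ al Q <= Lam * rho ^+ (kf Q))%R}.
  apply: (@choice _ _ (fun Q k => Q \in S' -> (Lam * rho ^+ k.+1 < al Q /\ al Q <= Lam * rho ^+ k)%R)) => Q.
  have [QS'|QS'] := boolP (Q \in S'); last by exists 0%N.
  have /andP[/andP[a0 aL] _] : ((0 < al Q) && (al Q <= Lam))%R && (Q \in S).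
    by move: QS'; rewrite mem_filter.
  by have [k Hk] := power_level rho01 a0 aL; exists k.
pose Sk k := [seq Q <- S' | kf Q == k].
have SkS k : {subset Sk k <= S} by move=> Q; rewrite mem_filter => /andP[_ /S'S].
have [g Hg] : {g : nat -> cube R n -> nat & forall k,
    {in Sk k &, forall P Q, g k P = g k Q -> P != Q -> cube_set P `&` cube_set Q = set0} /\
    forall i, (\sum_(Q <- Sk k | g k Q == i) vol Q)%:E <= ((1 - eta) ^+ i)%:E * leb (cube_union (Sk k))}.
  apply: (@choice _ _ (fun k g => {in Sk k &, forall P Q, g P = g Q -> P != Q -> cube_set P `&` cube_set Q = set0} /\
    forall i, (\sum_(Q <- Sk k | g Q == i) vol Q)%:E <= ((1 - eta) ^+ i)%:E * leb (cube_union (Sk k)))) => k.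
  apply: sparse_layers => //; first exact: filter_uniq.
  - by move=> P Q /SkS PS /SkS QS; exact: nS.
  - move=> Q /SkS QS; apply: le_trans (sS _ QS); apply: le_lebesgue_outer.
    by move=> x [P [/SkS PS PQ] xP]; exists P.
pose gf Q := g (kf Q) Q.
apply: (@le_trans _ _ (leb (cube_union [seq Q <- S | Lam * rho ^+ 0 < al Q]%R `|`
    [set x | Lam * 1 * C < \sum_(Q <- S') al Q * h Q x * \1_(cube_set Q) x]%R))).
  apply: le_lebesgue_outer => x /= Hx.
  have [xV|xV] := pselect (cube_union [seq Q <- S | Lam * rho ^+ 0 < al Q]%R x); first by left.
  right; rewrite /= mulr1 mulrC; apply: (lt_le_trans Hx).
  rewrite [leRHS]big_filter [leRHS]big_mkcond/= big_seq [leRHS]big_seq; apply: ler_sum => Q QS.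
  case: ifPn => // /nandP[|]; rewrite -?leNgt -?ltNge => aQ.
    by rewrite (_ : al Q = 0%R) ?mul0r//; apply/eqP; rewrite eq_le aQ al0.
  rewrite indicE memNset ?mulr0// => xQ; apply: xV; exists Q => //=.
  by rewrite mem_filter expr0 mulr1 aQ.
apply: (@le_trans _ _ (leb (cube_union [seq Q <- S | Lam * rho ^+ 0 < al Q]%R) +
    leb [set x | Lam * 1 * C < \sum_(Q <- S') al Q * h Q x * \1_(cube_set Q) x]%R)).
  exact: (outer_measureU2 (@lebesgue_outer R n)).
have -> : ((1 + H * 2 * C2) * M * t = M * 2 ^+ 0 * t + H * (2 * M) * t * 1^-1 ^+ N * C2)%R.
  by rewrite invr1 expr1n expr0; ring.
rewrite EFinD; apply: leeD; first exact: HV.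
(* [2 * M] because a cube of group [k] is only known to exceed the next level Lam rho^(k+1), where
   the hypothesis offers 2^(k+1). *)
apply: (@keyed_weak _ _ N H (2 * M)%R 2 (1 - eta)%R rho sg rh t Lam 1 S' kf gf al h) => //;
  rewrite ?mulr_ge0 ?(ltW rho0) ?(ltW L0) ?subr_ge0 ?(ltW eta1)//.
- move=> P Q PS QS kPQ gPQ PQ; have [g1 _] := Hg (kf P).
  apply: g1 => //; first by rewrite mem_filter eqxx.
    by rewrite mem_filter kPQ eqxx.
  by move: gPQ; rewrite /gf kPQ.
- move=> k i; have [_ /(_ i) g2] := Hg k.
  rewrite -lee_fin; apply: le_trans (_ : (\sum_(Q <- Sk k | g k Q == i) vol Q)%:E <= _).
    rewrite lee_fin /Sk [leRHS]big_filter_cond le_eqVlt; apply/orP; left; apply/eqP.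
    by apply: eq_bigl => Q; rewrite /gf; case: eqP => // ->.
  apply: (le_trans g2).
  have -> : (2 * M * 2 ^+ k * (1 - eta) ^+ i * t = (1 - eta) ^+ i * (M * 2 ^+ k.+1 * t))%R.
    by rewrite exprS; ring.
  rewrite EFinM lee_wpmul2l//; first by rewrite lee_fin exprn_ge0// subr_ge0 ltW.
  apply: le_trans (HV k.+1); apply: le_lebesgue_outer => x [Q /= QS xQ]; exists Q => //=.
  move: QS; rewrite mem_filter => /andP[/eqP kQ QS']; have [+ _] := Hkf Q QS'.
  by rewrite kQ mem_filter => -> /=; exact: S'S.
- by move=> Q QS'; rewrite al0/=; have [_] := Hkf Q QS'.
- by move=> Q /S'S; exact: hS.
Qed.

End SparseWeak.

(** * Dyadic description of Lorentz norms *)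

Section Dyadic.
Context {R : realType}.
Local Open Scope ereal_scope.

Lemma powRV (x q : R) : (0 <= x)%R -> (x^-1 `^ q = (x `^ q)^-1)%R.
Proof. by move=> x0; rewrite -powR_inv1// -powRrM mulN1r powRN. Qed.

Definition dy (k : int) : R := (2 `^ k%:~R)%R.

Lemma dy_gt0 k : (0 < dy k)%R. Proof. by rewrite powR_gt0. Qed.

Lemma dyD j k : dy (j + k) = (dy j * dy k)%R.
Proof. by rewrite /dy intrD powRD// pnatr_eq0 implybT. Qed.

Lemma dyS k : dy (k + 1) = (2 * dy k)%R.
Proof. by rewrite dyD mulrC /dy powRr1. Qed.

Lemma dy_nat (k : nat) : dy k%:Z = (2 ^+ k)%R.
Proof. by rewrite /dy -powR_mulrn. Qed.

Lemma ler_dy j k : (dy j <= dy k)%R = (j <= k)%R.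
Proof.
have H (i i' : int) : (i <= i')%R -> (dy i <= dy i')%R.
  by move=> ii; apply: ler_powR; rewrite ?ler1n// ler_int.
apply/idP/idP => [jk|/H//]; rewrite leNgt; apply/negP => kj.
have : (dy (k + 1) <= dy j)%R by apply: H; rewrite lezD1.
by rewrite dyS; have := dy_gt0 k; lra.
Qed.

Lemma ltr_dy j k : (dy j < dy k)%R = (j < k)%R.
Proof. by rewrite ltNge ler_dy -ltNge. Qed.

Lemma dy_locate (t : R) : (0 < t)%R -> exists k : int, (dy k < t <= dy (k + 1))%R.
Proof.
move=> t0; pose x := (ln t / ln 2)%R.
have l2 : (0 < ln (2 : R))%R by rewrite ln_gt0// ltr1n.
have tE : t = (2 `^ x)%R.
  by rewrite /powR pnatr_eq0 /x mulfVK ?gt_eqF// lnK.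
have /andP[c1 c2] := ceil_itv x.
exists (Num.ceil x - 1)%R; rewrite subrK /dy; apply/andP; split; last first.
  by rewrite tE; apply: ler_powR; rewrite ?ler1n.
rewrite lt_neqAle {2}tE ler_powR ?ler1n ?ltW// andbT {1}tE.
apply/eqP => E; have : ln (2 `^ (Num.ceil x - 1)%:~R) = ln (2 `^ x : R)%R by rewrite E.
by rewrite !ln_powR => /(mulIf (lt0r_neq0 l2)) H; rewrite H ltxx in c1.
Qed.

Definition dyitv (k : int) : set R := `]dy k, dy (k + 1)%R]%classic.

Lemma dyitv_inj j k t : dyitv j t -> dyitv k t -> j = k.
Proof.
rewrite /dyitv /= !in_itv/= => /andP[j1 j2] /andP[k1 k2].
have := lt_le_trans j1 k2; have := lt_le_trans k1 j2; rewrite !ltr_dy.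
by rewrite !ltzD1 => kj jk; apply/eqP; rewrite eq_le jk kj.
Qed.

Lemma dyitv_sub k : dyitv k `<=` `]0%R, +oo[%classic.
Proof.
move=> t; rewrite /dyitv /= !in_itv/= andbT => /andP[+ _]; apply: lt_trans.
exact: dy_gt0.
Qed.

Lemma leb_dyitv k : lebesgue_measure (dyitv k) = (dy k)%:E.
Proof.
rewrite lebesgue_measure_itv/= lte_fin ltr_dy ltzD1 lexx -EFinB dyS; congr EFin; ring.
Qed.

(** The factor 2 comes from treating non-negative and negative exponents as two sequences. A bound
    for all duplicate-free lists encodes the sum over all integers, here and below. *)
Lemma integral_dyadic_le (f : R -> \bar R) (a : int -> R) (C : R) :
  (forall t, 0 <= f t) -> measurable_fun (`]0%R, +oo[%classic : set R) f ->
  (forall k, (0 <= a k)%R) ->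
  (forall k, \int[lebesgue_measure]_(t in dyitv k) f t <= (a k)%:E) ->
  (forall s : seq int, uniq s -> (\sum_(k <- s) a k <= C)%R) ->
  \int[lebesgue_measure]_(t in `]0%R, +oo[) f t <= (2 * C)%:E.
Proof.
move=> f0 mf a0 fa aC.
have half (e : nat -> int) : injective e ->
    \int[lebesgue_measure]_(t in \bigcup_i dyitv (e i)) f t <= C%:E.
  move=> ei; rewrite ge0_integral_bigcup//.
  - apply: (@le_trans _ _ (\sum_(i <oo) (a (e i))%:E)).
      by apply: lee_nneseries => [i _ _|i _]; [exact: integral_ge0|exact: fa].
    apply: nneseries_le_bound => // J.
    rewrite -(big_mkord xpredT (fun i => a (e i))) -(big_map e xpredT a).
    by apply: aC; rewrite map_inj_uniq// iota_uniq.
  - by move=> i; exact: measurable_itv.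
  - apply: (measurable_funS (measurable_itv _) _ mf).
    by move=> t [i _ /dyitv_sub].
  - by move=> i j _ _ [t [ti tj]]; apply: ei; exact: dyitv_inj ti tj.
pose A := \bigcup_i dyitv (Posz i); pose B := \bigcup_i dyitv (Negz i).
have mA : measurable A by apply: bigcupT_measurable => i; exact: measurable_itv.
have mB : measurable B by apply: bigcupT_measurable => i; exact: measurable_itv.
have E : `]0%R, +oo[%classic = A `|` B.
  apply/seteqP; split => [t|t [|]]; last 2 first.
  - by move=> [i _ /dyitv_sub].
  - by move=> [i _ /dyitv_sub].
  rewrite /= in_itv/= andbT => /dy_locate[[i|i] Hi]; [left|right]; exists i => //;
  by rewrite /dyitv /= in_itv.
rewrite E ge0_integral_setU//.
- rewrite mulr_natl mulr2n EFinD; apply: leeD; apply: half; first by move=> i j [].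
  by move=> i j [].
- by rewrite -E.
- rewrite disj_set2E; apply/eqP; rewrite -subset0 => t [[i _ ti] [j _ tj]].
  by have := dyitv_inj ti tj.
Qed.

Lemma sum_integral_dyadic_le (f : R -> \bar R) (s : seq int) :
  (forall t, 0 <= f t) -> measurable_fun (`]0%R, +oo[%classic : set R) f -> uniq s ->
  \sum_(k <- s) \int[lebesgue_measure]_(t in dyitv k) f t <=
  \int[lebesgue_measure]_(t in `]0%R, +oo[) f t.
Proof.
move=> f0 mf us; have sub : \big[setU/set0]_(k <- s) dyitv k `<=` `]0%R, +oo[%classic.
  by rewrite -bigcup_seq => t [k _ /dyitv_sub].
have mU : measurable (\big[setU/set0]_(k <- s) dyitv k).
  by apply: bigsetU_measurable => k _; exact: measurable_itv.
rewrite -ge0_integral_bigsetU//.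
- exact: ge0_subset_integral.
- by move=> k; exact: measurable_itv.
- by move=> j k _ _ [t [tj tk]]; exact: dyitv_inj tj tk.
- exact: (measurable_funS (measurable_itv _) sub mf).
Qed.

Lemma nonincreasing_emeasurable (f : R -> \bar R) :
  (forall x y : R, (x <= y)%R -> f y <= f x) -> measurable_fun setT f.
Proof.
move=> ndf; apply: (measurability _ (ErealGenOInfty.measurableE R)) => _ [_ [c ->] <-].
rewrite setTI; apply: is_interval_measurable => x y /=; rewrite !in_itv/= !andbT.
move=> cx cy z /andP[_ zy]; rewrite in_itv/= andbT; apply: lt_le_trans cy _.
exact: ndf.
Qed.

End Dyadic.

Section Lorentz.
Context {R : realType} {n : nat}.
Local Notation Rn := 'rV[R]_n.
Local Open Scope ereal_scope.
Implicit Types (g h : Rn -> \bar R) (t p q : R).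

Lemma rearrangement_ge0 g t : 0 <= rearrangement g t.
Proof. by apply: le_ereal_inf_tmp => _ [s [s0 _] <-]; rewrite lee_fin. Qed.

Lemma rearrangement_le g t (s : R) : (0 <= s)%R ->
  leb [set x | s%:E < `|g x|] <= t%:E -> rearrangement g t <= s%:E.
Proof. by move=> s0 H; apply: ereal_inf_lbound; exists s. Qed.

Lemma leb_rearrangement g t (s : R) : rearrangement g t < s%:E ->
  leb [set x | s%:E < `|g x|] <= t%:E.
Proof.
move=> /ereal_inf_lt[_ [s' [s'0 Hs'] <-]] s's; apply: le_trans Hs'.
by apply: le_lebesgue_outer => x /=; apply: le_lt_trans; exact: ltW.
Qed.

Lemma rearrangement_nonincreasing g (t t' : R) : (t <= t')%R ->
  rearrangement g t' <= rearrangement g t.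
Proof.
move=> tt'; apply: le_ereal_inf_tmp => _ [s [s0 Hs] <-].
by apply: rearrangement_le => //; apply: le_trans Hs _; rewrite lee_fin.
Qed.

Definition lorentz_integrand p q g t : \bar R :=
  ((t `^ p^-1)%:E * rearrangement g t) `^ q * (t^-1)%:E.

Lemma lorentzE p q g : lorentz p q%:E g =
  (\int[lebesgue_measure]_(t in `]0%R, +oo[) lorentz_integrand p q g t) `^ q^-1.
Proof. by []. Qed.

(** A real power replaces the inverse of [t]: both agree for [t > 0], and the power makes the
    integrand measurable on the whole line. *)
Let pint p q g t := ((t `^ p^-1)%:E * rearrangement g t) `^ q * (t `^ (-1))%:E.

Let pintE p q g t : (0 < t)%R -> lorentz_integrand p q g t = pint p q g t.
Proof. by move=> t0; rewrite /lorentz_integrand /pint powR_inv1// ltW. Qed.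

Let pint_ge0 p q g t : 0 <= pint p q g t.
Proof. by rewrite mule_ge0 ?poweR_ge0// lee_fin powR_ge0. Qed.

Let measurable_pint p q g : measurable_fun setT (pint p q g).
Proof.
apply: emeasurable_funM; last by apply/measurable_EFinP; exact: measurable_powR.
apply: (measurableT_comp (measurable_poweR q)).
apply: emeasurable_funM; first by apply/measurable_EFinP; exact: measurable_powR.
by apply: nonincreasing_emeasurable => x y; exact: rearrangement_nonincreasing.
Qed.

Let integral_pint p q g : \int[lebesgue_measure]_(t in `]0%R, +oo[) lorentz_integrand p q g t
  = \int[lebesgue_measure]_(t in `]0%R, +oo[) pint p q g t.
Proof.
apply: eq_integral => t; rewrite inE /= in_itv/= andbT; exact: pintE.
Qed.

Lemma lorentz_poweR p q g (L : R) : (0 < q)%R -> (0 <= L)%R -> lorentz p q%:E g <= L%:E ->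
  \int[lebesgue_measure]_(t in `]0%R, +oo[) lorentz_integrand p q g t <= (L `^ q)%:E.
Proof.
move=> q0 L0; rewrite lorentzE integral_pint; set I := integral _ _ _ => H.
have I0 : 0 <= I by apply: integral_ge0 => t _; exact: pint_ge0.
have -> : I = (I `^ q^-1) `^ q.
  by rewrite -poweRrM mulVf ?gt_eqF// poweRe1.
rewrite -poweR_EFin; apply: gt0_ler_poweR => //; first exact: ltW.
- by rewrite in_itv/= leey andbT poweR_ge0.
- by rewrite in_itv/= leey andbT lee_fin.
Qed.

Lemma pint_piece_ge p q g (k : int) : (0 < p)%R -> (0 < q)%R ->
  (2^-1 * ((dy k) `^ p^-1) `^ q)%:E * rearrangement g (dy (k + 1)) `^ q <=
  \int[lebesgue_measure]_(t in dyitv k) pint p q g t.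
Proof.
move=> p0 q0; have d0 := @dy_gt0 R k; have d1 := @dy_gt0 R (k + 1)%R.
set c := (_ `^ p^-1)%R; set r := rearrangement _ _.
have r0 : 0 <= r by exact: rearrangement_ge0.
have c0 : (0 <= c)%R by exact: powR_ge0.
apply: (@le_trans _ _ (\int[lebesgue_measure]_(t in dyitv k) ((c%:E * r) `^ q * ((dy (k + 1))^-1)%:E))).
  rewrite integral_cst; last exact: measurable_itv.
  rewrite [X in _ <= _ * X](leb_dyitv k) -muleA -EFinM poweRM// ?lee_fin// poweR_EFin.
  rewrite muleAC -EFinM (_ : (_ * _)%R = (2^-1 * c `^ q)%R)//.
  by rewrite dyS mulrC; congr (_ * _)%R; field; rewrite gt_eqF.
apply: ge0_le_integral; first exact: measurable_itv.
- by move=> t _; rewrite mule_ge0 ?poweR_ge0// lee_fin invr_ge0 ltW.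
- exact: measurable_cst.
- by apply: measurable_funTS; exact: measurable_pint.
move=> t tk; have t0 : (0 < t)%R by have := dyitv_sub tk; rewrite /= in_itv/= andbT.
move: tk; rewrite /dyitv /= in_itv/= => /andP[t1 t2].
apply: lee_pmul.
- exact: poweR_ge0.
- by rewrite lee_fin invr_ge0 ltW.
- apply: gt0_ler_poweR; first exact: ltW.
  + by rewrite in_itv/= leey andbT mule_ge0.
  + by rewrite in_itv/= leey andbT mule_ge0 ?lee_fin ?powR_ge0 ?rearrangement_ge0.
  apply: lee_pmul => //; last exact: rearrangement_nonincreasing.
  by rewrite lee_fin ge0_ler_powR ?invr_ge0 ?nnegrE ?ltW.
- by rewrite lee_fin powR_inv1 ?(ltW t0)// lef_pV2 ?posrE.
Qed.

Lemma pint_piece_le p q g (k : int) (y : R) : (0 < p)%R -> (0 < q)%R -> (0 <= y)%R ->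
  rearrangement g (dy k) <= y%:E ->
  \int[lebesgue_measure]_(t in dyitv k) pint p q g t <=
  ((2 `^ p^-1 * (dy k `^ p^-1 * y)) `^ q)%:E.
Proof.
move=> p0 q0 y0 gy; have d0 := @dy_gt0 R k; have d1 := @dy_gt0 R (k + 1)%R.
apply: (@le_trans _ _ (\int[lebesgue_measure]_(t in dyitv k)
    ((((dy (k + 1)) `^ p^-1 * y) `^ q)%:E * ((dy k)^-1)%:E))).
  apply: ge0_le_integral; first exact: measurable_itv.
  - by move=> t _; exact: pint_ge0.
  - by apply: measurable_funTS; exact: measurable_pint.
  - exact: measurable_cst.
  move=> t tk; have t0 : (0 < t)%R by have := dyitv_sub tk; rewrite /= in_itv/= andbT.
  move: tk; rewrite /dyitv /= in_itv/= => /andP[t1 t2].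
  apply: lee_pmul.
  - exact: poweR_ge0.
  - by rewrite lee_fin powR_ge0.
  - rewrite -[leRHS]poweR_EFin; apply: gt0_ler_poweR; first exact: ltW.
    + by rewrite in_itv/= leey andbT mule_ge0 ?lee_fin ?powR_ge0 ?rearrangement_ge0.
    + by rewrite in_itv/= leey andbT lee_fin mulr_ge0// powR_ge0.
    rewrite EFinM; apply: lee_pmul.
    + by rewrite lee_fin powR_ge0.
    + exact: rearrangement_ge0.
    + by rewrite lee_fin ge0_ler_powR ?invr_ge0 ?nnegrE ?(ltW p0) ?(ltW t0) ?(ltW d1).
    + by apply: le_trans gy; exact/rearrangement_nonincreasing/ltW.
  - by rewrite lee_fin powR_inv1 ?(ltW t0)// lef_pV2 ?posrE// ltW.
rewrite -EFinM integral_cst; last exact: measurable_itv.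
rewrite [X in _ * X <= _](leb_dyitv k) -EFinM lee_fin mulfVK ?gt_eqF//.
by rewrite dyS [((2 * dy k) `^ p^-1)%R]powRM ?(ltW d0)// -[(_ * _ * y)%R]mulrA lexx.
Qed.

(** By monotonicity the value at 2^k is charged to the dyadic interval that ends there, hence the
    shift by one in the proof; each such interval also forces that value to be finite. *)
Lemma lorentz_dyadic_sum p q g (L : R) : (0 < p)%R -> (0 < q)%R -> (0 <= L)%R ->
  lorentz p q%:E g <= L%:E ->
  exists x : int -> R, [/\ forall k, (0 <= x k)%R,
    forall k, rearrangement g (dy k) = (x k)%:E &
    forall s : seq int, uniq s ->
      (\sum_(k <- s) (dy k `^ p^-1 * x k) `^ q <= 2 * (2 `^ p^-1) `^ q * L `^ q)%R].
Proof.
move=> p0 q0 L0 HL; have := lorentz_poweR q0 L0 HL; rewrite integral_pint => HI.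
have mp : measurable_fun (`]0%R, +oo[%classic : set R) (pint p q g).
  by apply: measurable_funTS; exact: measurable_pint.
have p2 : (0 < 2 `^ p^-1 :> R)%R by rewrite powR_gt0.
have piece k : (2^-1 * ((dy k) `^ p^-1) `^ q)%:E * rearrangement g (dy (k + 1)) `^ q <= (L `^ q)%:E.
  apply: le_trans (pint_piece_ge g k p0 q0) _; apply: le_trans HI.
  apply: ge0_subset_integral => //; [exact: measurable_itv|exact: dyitv_sub].
have fin k : rearrangement g (dy k) \is a fin_num.
  rewrite ge0_fin_numE ?rearrangement_ge0//.
  have := piece (k - 1)%R; rewrite subrK => H.
  have c0 : (0 < 2^-1 * ((dy (k - 1)) `^ p^-1) `^ q :> R)%R by rewrite mulr_gt0// !powR_gt0// dy_gt0.
  move: H; rewrite -lee_pdivlMl ?c0// -EFinM => H.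
  by apply: (@lty_poweRy _ _ q); [rewrite gt_eqF|exact: le_lt_trans H (ltry _)].
exists (fun k => fine (rearrangement g (dy k))); split.
- by move=> k; rewrite fine_ge0 ?rearrangement_ge0.
- by move=> k; rewrite fineK.
move=> s us.
have us' : uniq [seq (k - 1)%R | k <- s] by rewrite map_inj_uniq// => i j /addIr.
have := le_trans (sum_integral_dyadic_le (pint_ge0 p q g) mp us') HI.
rewrite big_map => H.
have {H} : (\sum_(k <- s) (2^-1 * (((2 `^ p^-1)^-1 * (dy k `^ p^-1 * fine (rearrangement g (dy k)))) `^ q))%:E <= (L `^ q)%:E).
  apply: le_trans H; apply: lee_sum => k _.
  apply: le_trans (pint_piece_ge g (k - 1)%R p0 q0); rewrite subrK.
  have z0 : (0 <= fine (rearrangement g (dy k)))%R by rewrite fine_ge0 ?rearrangement_ge0.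
  rewrite -[rearrangement g (dy k) in leRHS](fineK (fin k)) poweR_EFin -EFinM lee_fin.
  move: (fine _) z0 => z z0.
  have -> : dy k = (2 * dy (k - 1) :> R)%R by rewrite -dyS subrK.
  have w0 := @dy_gt0 R (k - 1)%R.
  rewrite [((2 * dy (k - 1)) `^ p^-1)%R]powRM ?(ltW w0)// -[leRHS]mulrA -[X in (_ <= _ * X)%R]powRM ?powR_ge0//.
  by rewrite ler_wpM2l ?invr_ge0// -[(_ * _ * z)%R]mulrA mulKf ?gt_eqF.
rewrite sumEFin lee_fin -mulr_sumr.
rewrite (eq_bigr (fun k => ((2 `^ p^-1)^-1 `^ q * (dy k `^ p^-1 * fine (rearrangement g (dy k))) `^ q)%R)); last first.
  move=> k _; apply: powRM; first by rewrite invr_ge0 powR_ge0.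
  by apply: mulr_ge0; [exact: powR_ge0|rewrite fine_ge0 ?rearrangement_ge0].
rewrite -mulr_sumr mulrA -ler_pdivlMl ?mulr_gt0 ?powR_gt0 ?invr_gt0//.
move=> /le_trans; apply; rewrite ler_wpM2r ?powR_ge0// invfM invrK.
by rewrite powRV ?(ltW p2)// invrK lexx.
Qed.

Lemma lorentz_le_dyadic p q g (y : int -> R) (C : R) : (0 < p)%R -> (0 < q)%R ->
  (forall k, (0 <= y k)%R) -> (forall k, rearrangement g (dy k) <= (y k)%:E) ->
  (forall s : seq int, uniq s -> (\sum_(k <- s) (dy k `^ p^-1 * y k) `^ q <= C)%R) ->
  lorentz p q%:E g <= ((2 * (2 `^ p^-1) `^ q * C) `^ q^-1)%:E.
Proof.
move=> p0 q0 y0 gy HC; rewrite lorentzE integral_pint -[leRHS]poweR_EFin.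
have C0 : (0 <= C)%R by have := HC [::] isT; rewrite big_nil.
apply: gt0_ler_poweR; first by rewrite invr_ge0 ltW.
- by rewrite in_itv/= leey andbT; apply: integral_ge0 => t _; exact: pint_ge0.
- by rewrite in_itv/= leey andbT lee_fin !mulr_ge0// powR_ge0.
rewrite -mulrA; apply: (@integral_dyadic_le _ _ (fun k => (2 `^ p^-1 * (dy k `^ p^-1 * y k)) `^ q)%R).
- by move=> t; exact: pint_ge0.
- by apply: measurable_funTS; exact: measurable_pint.
- by move=> k; exact: powR_ge0.
- by move=> k; exact: pint_piece_le.
move=> s us; rewrite (eq_bigr (fun k => (2 `^ p^-1) `^ q * (dy k `^ p^-1 * y k) `^ q)%R); last first.
  by move=> k _; rewrite powRM ?powR_ge0// mulr_ge0 ?powR_ge0.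
by rewrite -mulr_sumr ler_wpM2l ?powR_ge0// HC.
Qed.

End Lorentz.

(** * Sparse sums on a ball *)

Section Local.
Context {R : realType} {n m : nat}.
Local Notation Rn := 'rV[R]_n.
Local Notation lT := (lebesgue_type R n).
Local Open Scope ereal_scope.
Hypothesis n0 : (0 < n)%N.

(** An infinite integral yields 0, the same default as in [avg], so that [avg_scale] holds without
    integrability. *)
Definition wavg (X : Rn -> R) (f : Rn -> R) (Q : cube R n) : R :=
  (fine (\int[leb]_(x in cube_set Q) (X x * `|f x|)%:E) / vol Q)%R.

Lemma wavg_gt X f Q (a : R) : (0 <= a)%R -> (a < wavg X f Q)%R ->
  (a * vol Q)%:E <= \int[leb]_(x in cube_set Q) (X x * `|f x|)%:E.
Proof.
move=> a0; rewrite /wavg; case: (integral _ _ _) => [y| |] /=.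
- by rewrite ltr_pdivlMr ?vol_gt0// lee_fin => /ltW.
- by rewrite leey.
- by rewrite mul0r ltNge a0.
Qed.

Lemma wavg_ge0 X f Q : (forall x, 0 <= X x)%R -> (0 <= wavg X f Q)%R.
Proof.
move=> X0; apply: divr_ge0; last exact/ltW/vol_gt0.
by apply: fine_ge0; apply: integral_ge0 => x _; rewrite lee_fin mulr_ge0.
Qed.

Lemma pow2E (y : R) (l : nat) : ((2 `^ y) ^+ l = 2 `^ (l%:R * y))%R.
Proof. by rewrite mulrC powRrM powR_mulrn// powR_ge0. Qed.

Lemma pow2_le (a b : R) : (a <= b)%R -> (2 `^ a <= 2 `^ b :> R)%R.
Proof. by move=> ab; apply: ler_powR; rewrite ?ler1n. Qed.

Lemma pow2_lt (a b : R) : (a < b)%R -> (2 `^ a < 2 `^ b :> R)%R.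
Proof.
move=> ab; rewrite lt_neqAle pow2_le ?ltW// andbT; apply/eqP => E.
have : ln (2 `^ a : R)%R = ln (2 `^ b : R)%R by rewrite E.
rewrite !ln_powR => /(mulIf (lt0r_neq0 _)) H; rewrite H ?ltxx// in ab.
by rewrite ln_gt0// ltr1n.
Qed.

Lemma pow2_gt0 (a : R) : (0 < 2 `^ a :> R)%R. Proof. by rewrite powR_gt0. Qed.

Lemma pow2D (a b : R) : (2 `^ (a + b) = 2 `^ a * 2 `^ b :> R)%R.
Proof. by rewrite powRD// pnatr_eq0 implybT. Qed.

Lemma pow2_root (N : nat) : (0 < N)%N -> ((2 `^ N%:R^-1) ^+ N = 2 :> R)%R.
Proof. by move=> N0; rewrite pow2E mulfV ?powRr1// pnatr_eq0 -lt0n. Qed.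

Lemma prod_pow2 (I : Type) (s : seq I) (F : I -> R) :
  (\prod_(i <- s) 2 `^ F i = 2 `^ (\sum_(i <- s) F i) :> R)%R.
Proof. by elim: s => [|i s IH]; rewrite ?big_nil ?powRr0// !big_cons pow2D IH. Qed.

(* The factor [2 ^ (de |k|)] allows [xi] to be built from a majorant of the
   rearrangements that varies slowly with the level [t]. *)
Lemma local_small (N : nat) (K H eta de sg : R) (ps : 'I_m -> R) :
  (0 < N)%N -> (0 <= K)%R -> (0 <= H)%R -> (0 < eta < 1)%R -> (0 < de)%R ->
  (forall i, 0 < (ps i)^-1 /\ (ps i)^-1 + de + N%:R^-1 < 1)%R ->
  (0 < sg < \sum_i ((ps i)^-1 - de))%R -> (1 < N%:R * sg)%R ->
  exists C C' : R, [/\ (0 < C)%R, (0 < C')%R &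
  forall (f : 'I_m -> Rn -> R) (W : set Rn) (xi : 'I_m -> R) (t : R)
    (S : seq (cube R n)) (X : 'I_m -> cube R n -> Rn -> R) (h : cube R n -> Rn -> R),
  (forall i, lmeasurable (f i)) -> (forall i, 0 < xi i)%R -> (0 < t)%R ->
  (forall i (k : int), leb (W `&` [set x | xi i * 2 `^ (- (k%:~R * (ps i)^-1) + de * `|k|%:~R) < `|f i x|]%R)
      <= (dy k * t)%:E) ->
  uniq S -> nested S -> sparse_seq eta S -> {in S, forall Q, cube_set Q `<=` W} ->
  (forall i Q, weighted N K Q (X i Q)) -> (forall Q, tail_le N H Q (h Q)) ->
  leb [set x | C * \prod_i xi i <
     \sum_(Q <- S) (\prod_i wavg (X i Q) (f i) Q) * h Q x * \1_(cube_set Q) x]%R <= (C' * t)%:E].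
Proof.
move=> N0 K0 H0 eta01 de0 psP /andP[sg0 sg1] Nsg.
have exA i : exists a : R, (0 < a)%R /\ @average_bound R n N K (2 `^ ((ps i)^-1 + de))%R a.
  have [p1 p2] := psP i.
  have [||a a0 Ha] := @weighted_avg_weak R n N K (2 `^ ((ps i)^-1 + de))%R (2 `^ N%:R^-1)%R N0 K0 _ (pow2_gt0 _) (pow2_root N0).
  - by rewrite -[ltLHS](powRr0 2); apply: pow2_lt; rewrite addr_gt0.
  - by rewrite -pow2D -[ltRHS](@powRr1 R 2)//; apply: pow2_lt.
  by exists a.
have [A HA] := choice exA.
(* If the product of the averages exceeds Lam rho^k, one factor exceeds its own share 2^(-k (1/p_i -
   de)). The numerical hypotheses on [de], [sg] and [N] are the conditions of [weighted_avg_weak]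
   and [sparse_weak] written for exponents. *)
pose rho := (2 `^ (- \sum_i ((ps i)^-1 - de)) : R)%R.
have rho01 : (0 < rho < 1)%R.
  by rewrite pow2_gt0/= -[ltRHS](powRr0 2); apply: pow2_lt; rewrite oppr_lt0 (lt_trans sg0).
have [||C [C' [C0 C'0 HC]]] := @sparse_weak R n n0 N eta rho (2 `^ sg)%R H eta01 rho01 (pow2_gt0 _) H0.
- by rewrite -pow2D -[ltRHS](powRr0 2); apply: pow2_lt; lra.
- by rewrite pow2E -[ltLHS](@powRr1 R 2)//; apply: pow2_lt.
have A0 : (0 < \prod_i A i)%R by apply: prodr_gt0 => i _; have [] := HA i.
exists (C * \prod_i A i)%R, (C' * m%:R + 1)%R; split; first by rewrite mulr_gt0.
  by rewrite ltr_wpDl// mulr_ge0// ltW.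
move=> f W xi t S X h mf xi0 t0 Hf uS nS sS SW wX hS.
pose al Q := (\prod_i wavg (X i Q) (f i) Q)%R.
have w0 i Q : (0 <= wavg (X i Q) (f i) Q)%R by apply: wavg_ge0; have [] := wX i Q.
have al0 Q : (0 <= al Q)%R by apply: prodr_ge0.
pose Lam := (\prod_i (A i * xi i))%R.
have Lam0 : (0 < Lam)%R by apply: prodr_gt0 => i _; rewrite mulr_gt0//; have [] := HA i.
apply: (@le_trans _ _ (C' * m%:R * t)%:E); last by rewrite lee_fin ler_wpM2r ?(ltW t0)// lerDl.
have := HC S al h Lam m%:R t uS nS sS Lam0 (ler0n _ _) (ltW t0) al0.
rewrite /Lam big_split/= mulrA; apply => [Q _|k]; first exact: hS.
pose lam i := (xi i * 2 `^ (- (k%:R * ((ps i)^-1 - de))))%R.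
have lam0 i : (0 < lam i)%R by rewrite mulr_gt0// pow2_gt0.
pose Si i := [seq Q <- S | A i * lam i < wavg (X i Q) (f i) Q]%R.
have SiS i : {subset Si i <= S} by move=> Q; rewrite mem_filter => /andP[].
apply: (@le_trans _ _ (leb (\big[setU/set0]_(i < m) cube_union (Si i)))).
  apply: le_lebesgue_outer => x [Q /= QS xQ].
  move: QS; rewrite mem_filter => /andP[aQ QS].
  have [i Hi] : exists i, (A i * lam i < wavg (X i Q) (f i) Q)%R.
    apply/existsP; rewrite -[X in is_true X]negbK negb_exists; apply/negP => /forallP Hn.
    move: aQ; rewrite ltNge => /negP; apply.
    apply: (@le_trans _ _ (\prod_i (A i * lam i))%R).
      apply: ler_prod => i _; rewrite w0/= leNgt; exact: Hn.
    rewrite /lam (eq_bigr (fun i => A i * xi i * 2 `^ (- (k%:R * ((ps i)^-1 - de))))%R); last first.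
      by move=> i _; rewrite mulrA.
    rewrite big_split/= big_split/= prod_pow2 /rho pow2E le_eqVlt; apply/orP; left; apply/eqP.
    by congr (_ * 2 `^ _)%R; rewrite sumrN mulrN mulr_sumr.
  rewrite -bigcup_fin; exists i => //; exists Q => //=.
  by rewrite mem_filter Hi.
apply: le_trans (leb_bigsetU_le _ _) _.
apply: (@le_trans _ _ (\sum_(i < m) (2 ^+ k * t)%:E)); last first.
  by rewrite sumEFin sumr_const card_ord -[X in X%:E <= _]mulr_natl mulrA.
apply: lee_sum => i _.
have nSi : nested (Si i) by move=> P Q /SiS PS /SiS QS; exact: nS.
have tS : {subset tops (Si i) <= Si i} by move=> Q; rewrite mem_filter => /andP[].
rewrite -(sum_tops n0 (filter_uniq _ uS) nSi) lee_fin.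
have [A0i HAi] := HA i.
apply: (HAi (f i) W (lam i) (2 ^+ k * t)%R _ (X i)) => //.
- by rewrite mulr_ge0 ?exprn_ge0// ltW.
- move=> l; apply: le_trans (_ : (dy (k%:Z - l%:Z) * t)%:E <= _); last first.
    rewrite dyD dy_nat.
    have -> : (dy (- l%:Z) = 2^-1 ^+ l :> R)%R by rewrite /dy mulrNz powRN exprVn -dy_nat.
    by rewrite lee_fin mulrAC.
  (* The allowance 2^(de k) in [lam i] and the 2^(de l) in the growth rate together dominate 2^(de
     |k - l|), because |k - l| <= k + l. *)
  apply: le_trans (Hf i (k%:Z - l%:Z)%R); apply: le_lebesgue_outer => x [xW /= Hx]; split => //=.
  apply: le_lt_trans Hx; rewrite /lam -mulrA ler_wpM2l ?(ltW (xi0 i))// pow2E -pow2D.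
  apply: pow2_le.
  have [lk|kl] := leqP l k.
    have -> : (`|(k%:Z - l%:Z)%R| = k%:Z - l%:Z)%R by rewrite ger0_norm// subr_ge0 lez_nat.
    rewrite intrB -!pmulrn; have := @ler0n R l; nra.
  have -> : (`|(k%:Z - l%:Z)%R| = l%:Z - k%:Z)%R.
    by rewrite ler0_norm ?opprB// subr_le0 lez_nat ltnW.
  rewrite !intrB -!pmulrn; have := mulr_ge0 (ler0n R k) (ltW de0); nra.
- by rewrite !filter_uniq.
- exact: tops_disjoint.
- by move=> Q /tS /SiS; exact: SW.
- move=> Q /tS; rewrite mem_filter => /andP[+ _]; apply: wavg_gt.
  by rewrite mulr_ge0// ltW.
Qed.

(** Cubes with [kf Q = k] are disjoint with side above 2^k r, so it suffices to bound the average
    over each cube alone: the growth 2^(k n th) of [f i] against the volume factor 2^(-k n / p_i)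
    produces the ratio [rho]. *)
Lemma local_large (N : nat) (K H th : R) (ps : 'I_m -> R) (sg : R) :
  (0 < N)%N -> (0 <= K)%R -> (0 <= H)%R ->
  (forall i, 0 < (ps i)^-1 < 1)%R -> (forall i, (ps i)^-1 + N%:R^-1 < 1)%R ->
  (0 < sg < n%:R * \sum_i ((ps i)^-1 - th))%R -> (n%:R < N%:R * sg)%R ->
  exists C C' : R, [/\ (0 < C)%R, (0 < C')%R &
  forall (f : 'I_m -> Rn -> R) (W : nat -> set Rn) (G : 'I_m -> R) (r t : R)
    (S : seq (cube R n)) (kf : cube R n -> nat)
    (X : 'I_m -> cube R n -> Rn -> R) (h : cube R n -> Rn -> R),
  (forall i, lmeasurable (f i)) -> (forall i, 0 < G i)%R -> (0 < t)%R -> (0 < r)%R ->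
  (forall i (k : nat) (v : R), (0 < v)%R ->
     leb (W k `&` [set x | G i * 2 `^ (k%:R * (n%:R * th)) * v `^ (- (ps i)^-1) < `|f i x|]%R)
      <= v%:E) ->
  (forall k, leb (W k) <= ((2 ^+ (n + 3) * 2 ^+ k * r) ^+ n)%:E) ->
  uniq S ->
  {in S, forall Q, 2 ^+ kf Q * r < (Q.2)%:num}%R ->
  {in S, forall Q, cube_set Q `<=` W (kf Q)} ->
  {in S &, forall Q Q', kf Q = kf Q' -> Q != Q' -> cube_set Q `&` cube_set Q' = set0} ->
  (forall i Q, weighted N K Q (X i Q)) -> (forall Q, tail_le N H Q (h Q)) ->
  leb [set x | C * (\prod_i (G i * (r ^+ n) `^ (- (ps i)^-1))) * (r ^+ n / t) `^ N%:R^-1 <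
     \sum_(Q <- S) (\prod_i wavg (X i Q) (f i) Q) * h Q x * \1_(cube_set Q) x]%R <= (C' * t)%:E].
Proof.
move=> N0 K0 H0 p01 pN /andP[sg0 sg1] Nsg.
have exA i : exists a : R, (0 < a)%R /\ @average_bound R n N K (2 `^ (ps i)^-1)%R a.
  have /andP[p1 p2] := p01 i.
  have [||a a0 Ha] := @weighted_avg_weak R n N K (2 `^ (ps i)^-1)%R (2 `^ N%:R^-1)%R N0 K0 _ (pow2_gt0 _) (pow2_root N0).
  - by rewrite -[ltLHS](powRr0 2); apply: pow2_lt.
  - by rewrite -pow2D -[ltRHS](@powRr1 R 2)//; apply: pow2_lt.
  by exists a.
have [A HA] := choice exA.
pose rho := (2 `^ (- (n%:R * \sum_i ((ps i)^-1 - th))) : R)%R.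
pose B := (2 ^+ n : R)%R.
have BN : (B < (2 `^ sg) ^+ N)%R by rewrite /B -powR_mulrn// pow2E; exact: pow2_lt.
have rs1 : (rho * 2 `^ sg < 1)%R.
  by rewrite -pow2D -[ltRHS](powRr0 2); apply: pow2_lt; lra.
pose C1 := (\prod_i (A i * 2))%R.
have C10 : (0 < C1)%R by apply: prodr_gt0 => i _; rewrite mulr_gt0//; have [] := HA i.
pose C2 := ((1 - rho * 2 `^ sg)^-1 * (1 - 2^-1)^-1)%R.
have C20 : (0 < C2)%R by rewrite mulr_gt0 ?invr_gt0 ?subr_gt0//; lra.
pose M := ((2 ^+ (n + 3)) ^+ n : R)%R.
pose C3 := ((1 - B / (2 `^ sg) ^+ N)^-1 * (1 - 0 / 2^-1 ^+ N)^-1)%R.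
have C30 : (0 < C3)%R.
  have pN0 : (0 < (2 `^ sg) ^+ N :> R)%R by rewrite exprn_gt0// pow2_gt0.
  by rewrite /C3 mul0r subr0 invr1 mulr1 invr_gt0 subr_gt0 ltr_pdivrMr// mul1r.
have M0 : (0 < M)%R by rewrite !exprn_gt0.
exists (C1 * C2)%R, (H * M * C3 + 1)%R; split.
- by rewrite mulr_gt0.
- by rewrite ltr_wpDl// mulr_ge0 ?(ltW C30)// mulr_ge0// ltW.
move=> f W G r t S kf X h mf G0 t0 r0 Hf HW uS sS SW dS wX hS.
have rn0 : (0 < r ^+ n)%R by rewrite exprn_gt0.
(* Chosen so that T^(-N) r^n = t, which turns the measure bound of [keyed_weak] into a multiple of
   [t]. *)
pose T := ((r ^+ n / t) `^ N%:R^-1)%R.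
have T0 : (0 < T)%R by rewrite powR_gt0// divr_gt0.
pose Lam := (C1 * \prod_i (G i * (r ^+ n) `^ (- (ps i)^-1)))%R.
have Lam0 : (0 <= Lam)%R.
  by rewrite mulr_ge0 ?(ltW C10)// prodr_ge0// => i _; rewrite mulr_ge0 ?powR_ge0// ltW.
pose al Q := (\prod_i wavg (X i Q) (f i) Q)%R.
have w0 i Q : (0 <= wavg (X i Q) (f i) Q)%R by apply: wavg_ge0; have [] := wX i Q.
have al0 Q : (0 <= al Q)%R by apply: prodr_ge0.
have NT : (T^-1 ^+ N = t / r ^+ n)%R.
  rewrite exprVn -(@powR_mulrn _ T N) ?(ltW T0)// /T -powRrM mulVf ?pnatr_eq0 -?lt0n//.
  by rewrite powRr1 ?invf_div// divr_ge0 ?(ltW rn0) ?(ltW t0).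
(* The weak-type inequality is applied to the family consisting of [Q] alone with [t] replaced by
   half its volume: a larger average would give [vol Q <= vol Q / 2]. *)
have wle i Q : Q \in S -> (wavg (X i Q) (f i) Q <= A i * (G i * 2 `^ ((kf Q)%:R * (n%:R * th)) *
    (vol Q / 2) `^ (- (ps i)^-1)))%R.
  move=> QS; rewrite leNgt; apply/negP => Hlt.
  have [A0i HAi] := HA i; set lam := (G i * _ * _)%R in Hlt.
  have v0 := vol_gt0 Q; have v20 : (0 < vol Q / 2)%R by rewrite divr_gt0.
  have lam0 : (0 < lam)%R by rewrite !mulr_gt0 ?powR_gt0.
  have := HAi (f i) (W (kf Q)) lam (vol Q / 2)%R [:: Q] (X i) (mf i) lam0 (ltW v20).
  rewrite big_seq1 => H1; suff : (vol Q <= vol Q / 2)%R by lra.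
  apply: H1 => //.
  - move=> l; apply: le_trans (Hf i (kf Q) (vol Q / 2 * 2^-1 ^+ l)%R _); last by rewrite mulr_gt0// exprn_gt0.
    apply: le_lebesgue_outer => x [xW /= Hx]; split => //=; apply: le_lt_trans Hx.
    have -> : ((vol Q / 2 * 2^-1 ^+ l) `^ (- (ps i)^-1) =
        (vol Q / 2) `^ (- (ps i)^-1) * (2 `^ (ps i)^-1) ^+ l)%R.
      rewrite powRM ?(ltW v20)// ?exprn_ge0// exprVn powRV ?exprn_ge0//.
      by congr (_ * _)%R; rewrite powRN invrK pow2E powRrM powR_mulrn.
    by rewrite mulrA lexx.
  - by move=> Q1 Q2; rewrite !inE => /eqP -> /eqP ->; rewrite eqxx.
  - by move=> Q1; rewrite inE => /eqP ->; exact: SW.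
  - move=> Q1; rewrite inE => /eqP ->; apply: wavg_gt => //.
    by rewrite mulr_ge0// ltW.
have alle Q : Q \in S -> (0 <= al Q <= Lam * rho ^+ kf Q)%R.
  move=> QS; rewrite al0/=.
  have -> : (Lam * rho ^+ kf Q = \prod_i (A i * 2 * (G i * (r ^+ n) `^ (- (ps i)^-1)) *
      2 `^ ((kf Q)%:R * (- (n%:R * ((ps i)^-1 - th))))))%R.
    rewrite big_split/= big_split/= /Lam -/C1; congr (_ * _)%R.
    by rewrite prod_pow2 /rho pow2E; congr (2 `^ _)%R; rewrite -mulr_sumr sumrN mulr_sumr.
  apply: ler_prod => i _; rewrite w0/=; apply: (le_trans (wle i Q QS)).
  have /andP[p1 p2] := p01 i; have [A0i _] := HA i.
  rewrite -!mulrA ler_wpM2l ?(ltW A0i)// [leRHS]mulrCA ler_wpM2l ?(ltW (G0 i))//.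
  have volr : ((2 ^+ kf Q * r) ^+ n <= vol Q)%R.
    by rewrite /vol lerXn2r ?nnegrE ?mulr_ge0 ?exprn_ge0 ?(ltW r0)//; exact/ltW/sS.
  have v0 := vol_gt0 Q; have kr0 : (0 < (2 ^+ kf Q * r) ^+ n)%R by rewrite exprn_gt0// mulr_gt0// exprn_gt0.
  apply: (@le_trans _ _ (2 `^ ((kf Q)%:R * (n%:R * th)) * (((2 ^+ kf Q * r) ^+ n / 2) `^ (- (ps i)^-1)))%R).
    rewrite ler_wpM2l ?powR_ge0// !powRN lef_pV2 ?posrE ?powR_gt0 ?divr_gt0//.
    by rewrite ge0_ler_powR ?nnegrE ?divr_ge0 ?(ltW v0) ?(ltW kr0) ?(ltW p1)// ler_pM2r.
  have zE : ((2^-1 : R) `^ (- (ps i)^-1) <= 2)%R.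
    by rewrite powRV// powRN invrK -[leRHS](@powRr1 R 2)// pow2_le// ltW.
  have E1 : (((2 ^+ kf Q) ^+ n : R) `^ (- (ps i)^-1) = 2 `^ ((kf Q)%:R * (n%:R * - (ps i)^-1)))%R.
    by rewrite -exprM -powR_mulrn// -powRrM natrM mulrA.
  have E2 : (2 `^ ((kf Q)%:R * - (n%:R * ((ps i)^-1 - th))) =
      2 `^ ((kf Q)%:R * (n%:R * th)) * 2 `^ ((kf Q)%:R * (n%:R * - (ps i)^-1)) :> R)%R.
    by rewrite -pow2D; congr (2 `^ _)%R; ring.
  rewrite exprMn powRM ?mulr_ge0 ?exprn_ge0 ?(ltW r0)// ?invr_ge0//.
  rewrite powRM ?exprn_ge0 ?(ltW r0)// E1 E2.
  set u := (2 `^ ((kf Q)%:R * (n%:R * th)))%R; set w := (2 `^ ((kf Q)%:R * (n%:R * - (ps i)^-1)))%R.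
  set rp := ((r ^+ n) `^ (- (ps i)^-1))%R; set z := (2^-1 `^ _)%R in zE *.
  rewrite [leLHS](_ : _ = u * w * rp * z)%R; last by ring.
  rewrite [leRHS](_ : _ = u * w * rp * 2)%R; last by ring.
  by rewrite ler_wpM2l// !mulr_ge0 ?powR_ge0.
apply: (@le_trans _ _ (leb [set x | Lam * T * C2 <
     \sum_(Q <- S) al Q * h Q x * \1_(cube_set Q) x]%R)).
  apply: le_lebesgue_outer => x /=; apply: le_lt_trans.
  by rewrite /Lam le_eqVlt; apply/orP; left; apply/eqP; rewrite /T; ring.
have -> : ((H * M * C3 + 1) * t = H * M * (r ^+ n) * T^-1 ^+ N * C3 + t)%R.
  by rewrite NT; field; rewrite gt_eqF.
apply: (@le_trans _ _ (H * M * (r ^+ n) * T^-1 ^+ N * C3)%:E); last by rewrite lee_fin lerDl ltW.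
(* Cubes of one scale are already disjoint, so the second key is constantly 0 and [D = 0], with 0^0
   = 1 keeping that single layer. *)
apply: (@keyed_weak R n N H M B 0 rho (2 `^ sg)%R 2^-1 (r ^+ n) Lam T S kf (fun=> 0%N) al h) => //.
- exact: powR_ge0.
- exact: ltW.
- exact: ltW.
- by rewrite exprn_ge0.
- by rewrite invf_lt1// ltr1n.
- by move=> Q Q' QS Q'S kQ _; exact: dS.
move=> k [|g]; last by rewrite big1 ?exprS ?mul0r ?mulr0 ?mul0r// => Q /andP[_ /eqP].
rewrite expr0 mulr1 -lee_fin.
have -> : (M * B ^+ k * r ^+ n = (2 ^+ (n + 3) * 2 ^+ k * r) ^+ n)%R.
  by rewrite !exprMn /M /B -!exprM [(k * n)%N]mulnC.
apply: le_trans (HW k).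
under eq_bigl do rewrite eqxx andbT.
rewrite -sumEFin -big_filter (eq_bigr (fun Q => leb (cube_set Q))); last by move=> Q _; rewrite leb_vol.
rewrite -leb_bigsetU ?filter_uniq//.
- apply: le_lebesgue_outer => x; rewrite -bigcup_seq => -[Q /=].
  by rewrite mem_filter => /andP[/eqP <- QS]; exact: SW.
- by move=> Q _; exact: measurable_cube.
- move=> Q Q'; rewrite !mem_filter => /andP[/eqP kQ QS] /andP[/eqP kQ' Q'S].
  by apply: dS => //; rewrite kQ kQ'.
Qed.

End Local.

(** * Dyadic lattices *)

Section Lattice.
Context {R : realType} {n : nat}.
Local Notation Rn := 'rV[R]_n.
Hypothesis n0 : (0 < n)%N.

(** In units of the side of [P], measured from the corner of [Q0], both cubes have integer corners
    and sides; a common point then forces the unit interval of [P] into the interval of [Q] in every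
    coordinate. *)
Lemma dyadic_sub_le (Q0 P Q : cube R n) (x : Rn) : dyadic_subcubes Q0 P ->
  dyadic_subcubes Q0 Q -> cube_set P x -> cube_set Q x ->
  (P.2)%:num <= (Q.2)%:num -> cube_set P `<=` cube_set Q.
Proof.
move=> [a [sP [z za Pz]]] [b [sQ [w wb Qw]]] /cube_setP xP /cube_setP xQ sPQ.
have s0 : 0 < (Q0.2)%:num by [].
have ba : (b <= a)%N.
  rewrite leqNgt; apply/negP => ab; move: sPQ; rewrite sP sQ leNgt => /negP; apply.
  by rewrite ltr_pM2l// ltf_pV2 ?posrE ?exprn_gt0// ltr_eXn2l// ltr1n.
have aE : (2 ^+ a = 2 ^+ b * 2 ^+ (a - b) :> R) by rewrite -exprD subnKC.
have tP0 : 0 < (P.2)%:num by [].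
have sE : (Q.2)%:num = (P.2)%:num * 2 ^+ (a - b).
  rewrite sP sQ aE; field; by rewrite !expf_neq0.
move=> y /cube_setP yP; apply/cube_setP => i.
have := xP i; have := xQ i; have := yP i; rewrite Pz Qw -sP -sQ sE.
set t := (P.2)%:num in tP0 *; set c := Q0.1 ord0 i.
rewrite -natrX -!mulrA -natrM => yi xQi xPi.
have lo : ((2 ^ (a - b) * w i)%N <= z i)%N.
  rewrite -ltnS -(@ltr_nat R) -natr1 -(ltr_pM2l tP0); lra.
have hi : ((z i).+1 <= 2 ^ (a - b) * (w i).+1)%N.
  rewrite -ltnS -(@ltr_nat R) -!natr1 natrM -natr1 -(ltr_pM2l tP0) mulrDr mulrDr.
  rewrite natrM in xQi; rewrite !mulrDr !mulr1; lra.
have lo' : t * (2 ^ (a - b) * w i)%N%:R <= t * (z i)%:R by rewrite ler_pM2l// ler_nat.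
have hi' : t * (z i)%:R + t <= t * (2 ^ (a - b) * w i)%N%:R + t * (2 ^ (a - b))%N%:R.
  rewrite -[X in _ + X <= _]mulr1 -!mulrDr ler_pM2l// natr1 -natrD ler_nat.
  by rewrite -mulnSr.
lra.
Qed.

Variable D : set (cube R n).
Hypothesis latD : dyadic_lattice D.

Lemma lattice_sub (P Q : cube R n) (x : Rn) : D P -> D Q ->
  cube_set P x -> cube_set Q x -> (P.2)%:num <= (Q.2)%:num -> cube_set P `<=` cube_set Q.
Proof.
move=> DP DQ xP xQ PQ; have [_ H _] := latD; have [Q0 [_ d1 d2]] := H _ _ DP DQ.
exact: dyadic_sub_le d1 d2 xP xQ PQ.
Qed.

Lemma lattice_nested (S : seq (cube R n)) : {in S, forall Q, D Q} -> nested S.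
Proof.
move=> SD P Q PS QS.
have [[x [xP xQ]]|PQ0] := pselect ((cube_set P `&` cube_set Q) !=set0); last first.
  by apply: Or31; rewrite -subset0 => y yPQ; apply: PQ0; exists y.
have [PQ|/ltW QP] := leP (P.2)%:num (Q.2)%:num.
  by apply: Or32; exact: (lattice_sub (SD _ PS) (SD _ QS) xP xQ).
by apply: Or33; exact: (lattice_sub (SD _ QS) (SD _ PS) xQ xP).
Qed.

Lemma lattice_side (P Q : cube R n) : D P -> D Q ->
  exists a b : nat, (P.2)%:num * 2 ^+ a = (Q.2)%:num * 2 ^+ b.
Proof.
move=> DP DQ; have [_ H _] := latD; have [Q0 [_ [a [sP _]] [b [sQ _]]]] := H _ _ DP DQ.
by exists a, b; rewrite sP sQ; field; rewrite !expf_neq0.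
Qed.

(** Sides in a lattice differ by powers of two, so two of them in the half-open range from [c] to
    [2 * c] are equal, and cubes of equal side with a common point coincide. *)
Lemma lattice_same_scale (P Q : cube R n) (c : R) (x : Rn) : D P -> D Q ->
  c < (P.2)%:num <= 2 * c -> c < (Q.2)%:num <= 2 * c -> cube_set P x -> cube_set Q x -> P = Q.
Proof.
move=> DP DQ /andP[P1 P2] /andP[Q1 Q2] xP xQ.
have [a [b abE]] := lattice_side DP DQ.
have sE : (P.2)%:num = (Q.2)%:num.
  wlog ab : P Q a b abE DP DQ P1 P2 Q1 Q2 xP xQ / (a <= b)%N => [H|].
    have [ab|/ltnW ba] := leqP a b; first exact: (H P Q a b).
    by apply/esym; apply: (H Q P b a).
  have abE' : (P.2)%:num = (Q.2)%:num * 2 ^+ (b - a).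
    have a0 : (2 ^+ a != 0 :> R) by rewrite expf_neq0.
    by apply: (mulIf a0); rewrite abE -mulrA -exprD subnK.
  case: (b - a)%N abE' => [|k]; first by rewrite expr0 mulr1.
  rewrite exprS => E; have k1 : 1 <= 2 ^+ k :> R by rewrite exprn_ege1// ler1n.
  have : (Q.2)%:num * 2 <= (P.2)%:num by rewrite E ler_pM2l// ler_peMr.
  lra.
apply: (cube_sub_eq n0); last by rewrite /vol sE.
by apply: (lattice_sub DP DQ xP xQ); rewrite sE.
Qed.

Lemma rat_point (Q : cube R n) : exists z : 'rV[rat]_n, cube_set Q (map_mx ratr z).
Proof.
have H (i : 'I_n) : exists q : rat, Q.1 ord0 i <= ratr q < Q.1 ord0 i + (Q.2)%:num.
  have [|q] := @rat_in_itvoo R (Q.1 ord0 i) (Q.1 ord0 i + (Q.2)%:num); first by rewrite ltrDl.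
  by rewrite in_itv/= => /andP[q1 q2]; exists q; rewrite ltW.
have [q Hq] := choice H.
by exists (\row_i q i); apply/cube_setP => i; rewrite !mxE.
Qed.

(** A cube is determined by countable data: two exponents that fix its side relative to a chosen
    [Q0], and a rational point that it contains, because cubes of equal side with a common point
    coincide. *)
Lemma lattice_countable (S : set (cube R n)) : S `<=` D -> countable S.
Proof.
move=> SD; have [[Q0 SQ0]|S0] := pselect (S !=set0); last first.
  by have -> : S = set0 by rewrite -subset0 => Q SQ; apply: S0; exists Q.
pose F (k : nat * nat * 'rV[rat]_n) : set (cube R n) :=
  [set Q | [/\ S Q, (Q.2)%:num * 2 ^+ k.1.1 = (Q0.2)%:num * 2 ^+ k.1.2 & cube_set Q (map_mx ratr k.2)]].
have SF : S `<=` \bigcup_k F k.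
  move=> Q SQ; have [a [b ab]] := lattice_side (SD _ SQ) (SD _ SQ0).
  have [z Qz] := rat_point Q.
  by exists (a, b, z).
apply: sub_countable (subset_card_le SF) _.
apply: bigcup_countable; first exact: countableP.
move=> [[a b] z] _; apply: finite_set_countable.
have [[Q1 FQ1]|F0] := pselect (F (a, b, z) !=set0); last first.
  have -> : F (a, b, z) = set0 by rewrite -subset0 => Q FQ; apply: F0; exists Q.
  exact: finite_set0.
apply: (@sub_finite_set _ _ [set Q1]); last exact: finite_set1.
move=> Q [SQ /= sQ zQ]; have [SQ1 /= sQ1 zQ1] := FQ1.
have a0 : (2 ^+ a != 0 :> R) by rewrite expf_neq0.
have sE : (Q.2)%:num = (Q1.2)%:num by apply: (mulIf a0); rewrite sQ sQ1.
apply: (cube_sub_eq n0); last by rewrite /vol sE.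
by apply: (lattice_sub (SD _ SQ) (SD _ SQ1) zQ zQ1); rewrite sE.
Qed.

End Lattice.

Section LocalSum.
Context {R : realType} {n m : nat}.
Local Notation Rn := 'rV[R]_n.
Local Notation lT := (lebesgue_type R n).
Local Open Scope ereal_scope.
Hypothesis n0 : (0 < n)%N.

Lemma cube_sub_eball (Q : cube R n) (x0 z : Rn) (r s : R) : (0 < r)%R ->
  cube_set Q z -> eball x0 r z -> (n%:R * ((Q.2)%:num + r) < s)%R -> cube_set Q `<=` eball x0 s.
Proof.
move=> r0 /cube_setP zQ zB sE y /cube_setP yQ.
apply: (coord_eball n0 _ sE) => i; have := eball_coord i zB.
by have := zQ i; have := yQ i; rewrite ltr_norml ler_norml => /andP[? ?] /andP[? ?] /andP[? ?]; lra.
Qed.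

Lemma local_sum (N : nat) (K H eta de sg sg' th : R) (ps : 'I_m -> R) :
  (0 < N)%N -> (0 <= K)%R -> (0 <= H)%R -> (0 < eta < 1)%R -> (0 < de)%R ->
  (forall i, 0 < (ps i)^-1 /\ (ps i)^-1 + de + N%:R^-1 < 1)%R ->
  (0 < sg < \sum_i ((ps i)^-1 - de))%R -> (1 < N%:R * sg)%R ->
  (0 < sg' < n%:R * \sum_i ((ps i)^-1 - th))%R -> (n%:R < N%:R * sg')%R ->
  exists C C' : R, [/\ (0 < C)%R, (0 < C')%R &
  forall (D : set (cube R n)) (f : 'I_m -> Rn -> R) (x0 : Rn) (r : R) (xi G : 'I_m -> R) (t : R)
    (S : seq (cube R n)) (X : 'I_m -> cube R n -> Rn -> R) (h : cube R n -> Rn -> R),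
  dyadic_lattice D -> {in S, forall Q, D Q} ->
  (forall i, lmeasurable (f i)) -> (forall i, 0 < xi i)%R -> (forall i, 0 < G i)%R ->
  (0 < t)%R -> (0 < r)%R ->
  (forall i (k : int), leb (eball x0 (2 ^+ (n + 2) * r) `&`
      [set x | xi i * 2 `^ (- (k%:~R * (ps i)^-1) + de * `|k|%:~R) < `|f i x|]%R)
      <= (dy k * t)%:E) ->
  (forall i (k : nat) (v : R), (0 < v)%R ->
     leb (eball x0 (2 ^+ (n + 2) * 2 ^+ k * r) `&`
       [set x | G i * 2 `^ (k%:R * (n%:R * th)) * v `^ (- (ps i)^-1) < `|f i x|]%R)
      <= v%:E) ->
  uniq S -> sparse_seq eta S ->
  (forall i Q, weighted N K Q (X i Q)) -> (forall Q, tail_le N H Q (h Q)) ->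
  leb (eball x0 r `&` [set x | C * (\prod_i xi i +
      (\prod_i (G i * (r ^+ n) `^ (- (ps i)^-1))) * (r ^+ n / t) `^ N%:R^-1) <
     \sum_(Q <- S) (\prod_i wavg (X i Q) (f i) Q) * h Q x * \1_(cube_set Q) x]%R) <= (C' * t)%:E].
Proof.
move=> N0 K0 H0 eta01 de0 psP sgP Nsg sgP' Nsg'.
have [C1 [C1' [C10 C1'0 HC1]]] := @local_small R n m n0 N K H eta de sg ps N0 K0 H0 eta01 de0 psP sgP Nsg.
have p01 i : (0 < (ps i)^-1 < 1)%R.
  have [p0 p1] := psP i; have : (0 <= N%:R^-1 :> R)%R by rewrite invr_ge0.
  by rewrite p0/=; lra.
have pN i : ((ps i)^-1 + N%:R^-1 < 1)%R by have [p0 p1] := psP i; lra.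
have [C2 [C2' [C20 C2'0 HC2]]] := @local_large R n m N K H th ps sg' N0 K0 H0 p01 pN sgP' Nsg'.
exists (C1 + C2)%R, (C1' + C2')%R; split; rewrite ?addr_gt0//.
move=> D f x0 r xi G t S X h latD SD mf xi0 G0 t0 r0 Hf Hg uS sS wX hS.
pose meet Q := `[< exists z, cube_set Q z /\ eball x0 r z >].
pose S1 := [seq Q <- S | meet Q && ((Q.2)%:num <= r)%R].
pose S2 := [seq Q <- S | meet Q && (r < (Q.2)%:num)%R].
have S1S : {subset S1 <= S} by move=> Q; rewrite mem_filter => /andP[].
have S2S : {subset S2 <= S} by move=> Q; rewrite mem_filter => /andP[].
(* A cube of side s that meets the ball lies in the ball of radius n (s + r) about [x0]. The
   resulting factors, 2 n for s <= r and 3 n for s <= 2 * 2^k r, are both below 2^(n+2). *)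
have n2 : (n%:R * 2 < 2 ^+ (n + 2) :> R)%R.
  rewrite -natrX -natrM ltr_nat expnD mulnC; apply: leq_ltn_trans (_ : n * 4 < _)%N.
    by rewrite mulnC leq_mul2l orbT.
  by rewrite ltn_pmul2r// ltn_expl.
have [kf Hkf] : {kf : cube R n -> nat & forall Q, Q \in S2 ->
    (2 ^+ kf Q * r < (Q.2)%:num <= 2 * (2 ^+ kf Q * r))%R}.
  apply: (@choice _ _ (fun Q k => Q \in S2 -> (2 ^+ k * r < (Q.2)%:num <= 2 * (2 ^+ k * r))%R)) => Q.
  have [|_] := boolP (Q \in S2); last by exists 0%N.
  rewrite mem_filter => /andP[/andP[_ rQ] _].
  have s0 : (0 < (Q.2)%:num / r)%R by rewrite divr_gt0.
  have [k /andP[k1 k2]] := dy_locate s0.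
  have : (0 <= k)%R.
    rewrite -ltzD1 -(@ltr_dy R) (_ : dy 0 = 1%R); last by rewrite /dy powRr0.
    by apply: lt_le_trans k2; rewrite ltr_pdivlMr// mul1r.
  case: k k1 k2 => // k k1 k2 _; exists k => _.
  rewrite -dy_nat; move: k1 k2; rewrite dyS ltr_pdivlMr// ler_pdivrMr// mulrA.
  by move=> -> ->.
apply: (@le_trans _ _ (leb (
  [set x | C1 * \prod_i xi i < \sum_(Q <- S1) (\prod_i wavg (X i Q) (f i) Q) * h Q x * \1_(cube_set Q) x]%R `|`
  [set x | C2 * (\prod_i (G i * (r ^+ n) `^ (- (ps i)^-1))) * (r ^+ n / t) `^ N%:R^-1 <
     \sum_(Q <- S2) (\prod_i wavg (X i Q) (f i) Q) * h Q x * \1_(cube_set Q) x]%R))).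
  apply: le_lebesgue_outer => x [xB /=] Hx.
  have Y0 : (0 <= (\prod_i (G i * (r ^+ n) `^ (- (ps i)^-1))) * (r ^+ n / t) `^ N%:R^-1)%R.
    by rewrite mulr_ge0 ?powR_ge0// prodr_ge0// => i _; rewrite mulr_ge0 ?powR_ge0// ltW.
  have Y1 : (0 <= \prod_i xi i)%R by apply: prodr_ge0 => i _; exact: ltW.
  have [|xS1] := ltP (C1 * \prod_i xi i)%R (\sum_(Q <- S1) (\prod_i wavg (X i Q) (f i) Q) * h Q x * \1_(cube_set Q) x)%R; first by left.
  right; rewrite /= -mulrA.
  have E : (\sum_(Q <- S) (\prod_i wavg (X i Q) (f i) Q) * h Q x * \1_(cube_set Q) x =
     \sum_(Q <- S1) (\prod_i wavg (X i Q) (f i) Q) * h Q x * \1_(cube_set Q) x +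
     \sum_(Q <- S2) (\prod_i wavg (X i Q) (f i) Q) * h Q x * \1_(cube_set Q) x)%R.
    rewrite !big_filter [X in (_ = X + _)%R]big_mkcond [X in (_ = _ + X)%R]big_mkcond -big_split/=.
    apply: eq_bigr => Q _; case: (boolP (meet Q)) => mQ /=.
      by case: leP => _; rewrite ?addr0 ?add0r.
    rewrite addr0 indicE memNset ?mulr0// => xQ.
    by move/asboolPn: mQ; apply; exists x.
  move: Hx; rewrite E mulrDl !mulrDr; nra.
apply: le_trans (outer_measureU2 (@lebesgue_outer R n) _ _) _.
rewrite mulrDl EFinD; apply: leeD.
- apply: (HC1 f (eball x0 (2 ^+ (n + 2) * r)%R) xi t S1 X h) => //.
  + exact: filter_uniq.
  + by apply: (lattice_nested latD) => Q /S1S; exact: SD.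
  + move=> Q /S1S QS; apply: le_trans (sS _ QS); apply: le_lebesgue_outer.
    by move=> x [P [/S1S PS PQ] xP]; exists P.
  + move=> Q; rewrite mem_filter => /andP[/andP[/asboolP[z [zQ zB]] Qr] _].
    apply: (cube_sub_eball r0 zQ zB).
    apply: (@le_lt_trans _ _ (n%:R * 2 * r)%R); last by rewrite ltr_pM2r.
    rewrite -mulrA ler_wpM2l//; lra.
- apply: (HC2 f (fun k => eball x0 (2 ^+ (n + 2) * 2 ^+ k * r)%R) G r t S2 kf X h) => //.
  + move=> k; have kr : (0 < 2 ^+ (n + 2) * 2 ^+ k * r)%R by rewrite !mulr_gt0 ?exprn_gt0.
    apply: le_trans (leb_eball_le x0 kr) _; rewrite lee_fin le_eqVlt; apply/orP; left; apply/eqP.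
    have -> : (2 ^+ (n + 3) = 2 * 2 ^+ (n + 2) :> R)%R by rewrite -exprS addnS.
    by rewrite !mulrA.
  + exact: filter_uniq.
  + by move=> Q QS; have /andP[] := Hkf Q QS.
  + move=> Q QS; have /andP[k1 k2] := Hkf Q QS.
    move: QS; rewrite mem_filter => /andP[/andP[/asboolP[z [zQ zB]] Qr] _].
    apply: (cube_sub_eball r0 zQ zB).
    have p1 : (1 <= 2 ^+ kf Q :> R)%R by rewrite exprn_ege1// ler1n.
    have rp : (r <= 2 ^+ kf Q * r)%R by rewrite ler_peMl// ltW.
    have n4 : (n%:R * 3 < 2 ^+ (n + 2) :> R)%R.
      rewrite -natrX -natrM ltr_nat expnD; apply: leq_ltn_trans (_ : n * 4 < _)%N.
        by rewrite leq_mul2l orbT.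
      by rewrite ltn_pmul2r// ltn_expl.
    apply: (@le_lt_trans _ _ (n%:R * 3 * (2 ^+ kf Q * r))%R).
      by rewrite -mulrA ler_wpM2l//; lra.
    by rewrite -[ltRHS]mulrA ltr_pM2r// mulr_gt0// exprn_gt0.
  + move=> P Q PS QS kPQ PQ; rewrite -subset0 => x [xP xQ].
    move/eqP: PQ; apply; apply: (lattice_same_scale n0 latD (SD _ (S2S _ PS)) (SD _ (S2S _ QS)) (Hkf P PS) _ xP xQ).
    by rewrite kPQ; exact: Hkf.
Qed.

End LocalSum.

(** * From finite families of cubes to countable ones *)

Section Exhaustion.
Context {R : realType} {n : nat}.
Local Notation Rn := 'rV[R]_n.
Local Notation lT := (lebesgue_type R n).
Local Open Scope ereal_scope.

Lemma ler_sum_sub (T : choiceType) (s s' : seq T) (F : T -> R) : uniq s -> uniq s' ->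
  {subset s <= s'} -> (forall x, 0 <= F x)%R -> (\sum_(x <- s) F x <= \sum_(x <- s') F x)%R.
Proof.
move=> us us' ss' F0; rewrite [leRHS](bigID (mem s))/= -[X in (_ <= X + _)%R]big_filter.
rewrite (perm_big [seq x <- s' | x \in s]).
  by rewrite lerDl sumr_ge0.
apply: uniq_perm => //; first exact: filter_uniq.
by move=> x; rewrite mem_filter; case: (boolP (x \in s)) => //= /ss' ->.
Qed.

(** An injection of [S] into the integers exhausts the sum by increasing finite sums, whose
    superlevel sets increase to the one in question; continuity from below concludes. *)
Lemma leb_esum_le (S : set (cube R n)) (F : cube R n -> Rn -> R) (B : set Rn) (c : R) (M : \bar R) :
  countable S -> measurable (B : set lT) ->
  (forall Q x, 0 <= F Q x)%R -> (forall Q, measurable_fun (T := lT) setT (F Q)) ->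
  (forall s : seq (cube R n), uniq s -> {in s, forall Q, S Q} ->
     leb (B `&` [set x | c < \sum_(Q <- s) F Q x]%R) <= M) ->
  leb (B `&` [set x | c%:E < \esum_(Q in S) (F Q x)%:E]) <= M.
Proof.
move=> /countable_injP[f finj] mB F0 mF HM.
have ex k : exists s : seq (cube R n), uniq s /\ forall Q, Q \in s <-> S Q /\ (f Q < k)%N.
  elim: k => [|k [s [us Hs]]]; first by exists [::]; split => // Q; split => // -[].
  have [[Q [SQ fQ]]|H] := pselect (exists Q, S Q /\ f Q = k); last first.
    exists s; split => // Q; rewrite Hs; split => -[SQ fQ]; split => //; first exact: leqW.
    rewrite ltn_neqAle; apply/andP; split => //.
    by apply/negP => /eqP[fk]; apply: H; exists Q.
  exists (Q :: s); split => /=.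
    rewrite us andbT; apply/negP => /Hs[_]; by rewrite fQ ltnn.
  move=> P; rewrite inE; split.
    by move=> /predU1P[->|/Hs[SP fP]]; [rewrite fQ|split => //; exact: leqW].
  move=> [SP]; rewrite ltnS leq_eqVlt => /predU1P[fP|fP]; last by apply/orP; right; apply/Hs.
  by apply/orP; left; apply/eqP; apply: finj; rewrite ?inE// fP fQ.
have [s Hs] := choice ex.
have us k : uniq (s k) by have [] := Hs k.
have ms k : measurable_fun (T := lT) setT (fun x => \sum_(Q <- s k) F Q x)%R.
  exact: measurable_sum.
pose E k := B `&` [set x | c < \sum_(Q <- s k) F Q x]%R.
apply: (@le_trans _ _ (leb (\bigcup_k E k))).
  apply: le_lebesgue_outer => x [xB /= /ereal_sup_gt[_ [A [finA AS] <-] cA]].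
  have [l Al] := (finite_seqP A).1 finA.
  have [k Hk] : exists k, {in l, forall Q, (f Q < k)%N}.
    exists (\max_(Q <- l) f Q).+1 => Q Ql; rewrite ltnS; exact: leq_bigmax_seq.
  exists k => //; split => //=.
  have : (\sum_(Q \in A) (F Q x)%:E <= (\sum_(Q <- s k) F Q x)%:E).
    rewrite sumEFin lee_fin; apply: ler_sum_sub; [exact: finite_support_uniq|exact: us| |by []].
    move=> Q; rewrite in_finite_support; last exact: sub_finite_set finA => ? [].
    rewrite inE => -[AQ _]; apply/(Hs k).2; split; first exact: AS.
    by apply: Hk; rewrite Al in AQ.
  by move=> /(lt_le_trans cA); rewrite lte_fin.
apply: leb_bigcup_nondecreasing_le.
- move=> k; apply: measurableI => //.
  have := ms k measurableT `]c, +oo[%classic (measurable_itv _).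
  by rewrite setTI; congr measurable; apply/seteqP; split => x /=; rewrite in_itv/= andbT.
- move=> k k' kk' x [xB /= H]; split => //=; apply: (lt_le_trans H).
  apply: ler_sum_sub => // Q /(Hs k).2[SQ fQ]; apply/(Hs k').2; split => //.
  exact: leq_trans kk'.
- move=> k; apply: HM => // Q; by move/(Hs k).2 => [].
Qed.

End Exhaustion.

(** * The terms of the sparse sums of a commutator *)

Section Factors.
Context {R : realType} {n l m : nat}.
Local Notation Rn := 'rV[R]_n.
Local Notation lT := (lebesgue_type R n).
Local Open Scope ereal_scope.

Definition dev (b : Rn -> R) (be : R) (Q : cube R n) (x : Rn) : R := (`|b x - avg b Q| / be)%R.

(* The oscillations with [gamma s] true are absorbed in the averages of [f_s],
   the others remain as functions of [x]. *)
Definition inner (b : 'I_l -> Rn -> R) (be : 'I_l -> R) (gamma : {ffun 'I_l -> bool})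
    (i : 'I_m) (Q : cube R n) (x : Rn) : R :=
  if insub (i : nat) is Some s then (if gamma s then dev (b s) (be s) Q x else 1%R) else 1%R.

Definition outer (b : 'I_l -> Rn -> R) (be : 'I_l -> R) (gamma : {ffun 'I_l -> bool})
    (Q : cube R n) (x : Rn) : R :=
  (\prod_(s < l) if gamma s then 1 else dev (b s) (be s) Q x)%R.

(** A positive upper bound of the BMO norm instead of the norm itself, so that [dev] may divide by
    it even when [b] has norm 0. *)
Definition bmo_bound (b : Rn -> R) (be : R) : Prop :=
  [/\ (0 < be)%R, lmeasurable b,
      forall Q : cube R n, leb.-integrable (cube_set Q) (EFin \o b) &
      forall Q : cube R n, (osc b Q (avg b Q) <= be * vol Q)%R].

Lemma dev_ge0 b be Q x : (0 <= be)%R -> (0 <= dev b be Q x)%R.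
Proof. by move=> be0; rewrite divr_ge0. Qed.

Lemma measurable_devn b be Q : lmeasurable b -> measurable_fun (T := lT) setT (dev b be Q).
Proof.
move=> mb; apply: measurable_funM; last exact: measurable_cst.
apply: measurableT_comp; first exact: normr_measurable.
by apply: measurable_funB; [exact: mb|exact: measurable_cst].
Qed.

Lemma inner_weighted (N : nat) : exists2 K : R, (0 < K)%R &
  forall b be gamma, (forall s, bmo_bound (b s) (be s)) ->
  forall i Q, weighted N K Q (inner b be gamma i Q).
Proof.
have [K K0 HK] := @bmo_moment R n N.
exists (K + 1)%R; first by rewrite addr_gt0.
move=> b be gamma Hb i Q; have v0 := vol_gt0 Q.
have H1 : weighted N (K + 1) Q (fun=> 1%R).
  split => //.
  under eq_integral do rewrite expr1n.
  rewrite integral_cst; last exact: measurable_cube.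
  rewrite mul1e [X in X <= _](leb_vol Q) lee_fin ler_peMl ?(ltW v0)//; lra.
rewrite /inner; case: insubP => [s _ _|_]; last exact: H1.
case: (gamma s); last exact: H1.
have [be0 mb ib ob] := Hb s; split.
- by move=> x; apply: dev_ge0; exact: ltW.
- by apply: measurable_funTS; exact: measurable_devn.
apply: le_trans (HK (b s) (be s) be0 mb ib ob Q) _.
by rewrite lee_fin ler_wpM2r ?(ltW v0)// lerDl.
Qed.

Lemma outer_ge0 b be gamma Q x : (forall s, bmo_bound (b s) (be s)) ->
  (0 <= outer b be gamma Q x)%R.
Proof.
move=> Hb; apply: prodr_ge0 => s _; case: ifP => // _.
by apply: dev_ge0; have [/ltW] := Hb s.
Qed.

Lemma measurable_outer b be gamma Q : (forall s, bmo_bound (b s) (be s)) ->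
  measurable_fun (T := lT) setT (outer b be gamma Q).
Proof.
move=> Hb; apply: measurable_prod => s _; case: (gamma s); first exact: measurable_cst.
by apply: measurable_devn; have [] := Hb s.
Qed.

(** If a product of [l] factors, each 1 or a deviation, exceeds [mu >= 1], some deviation has an
    [l]-th power above [mu]; Chebyshev's inequality with moments of order [l * N] gives a tail of
    order [N]. For [mu < 1] the bound exceeds the volume of [Q]. *)
Lemma outer_tail (N : nat) : (0 < l)%N -> exists2 H : R, (0 < H)%R &
  forall b be gamma, (forall s, bmo_bound (b s) (be s)) ->
  forall Q, tail_le N H Q (outer b be gamma Q).
Proof.
move=> l0; have [K K0 HK] := @bmo_moment R n (l * N).
exists (l%:R * K + 1)%R; first by rewrite ltr_wpDl// mulr_ge0// ltW.
move=> b be gamma Hb Q; have v0 := vol_gt0 Q; have mQ := measurable_cube Q.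
split => [x|mu mu0]; first exact: outer_ge0.
have [mu1|mu1] := ltP mu 1%R.
  apply: (@le_trans _ _ (leb (cube_set Q))).
    by apply: le_lebesgue_outer => x [].
  rewrite leb_vol lee_fin ler_peMl ?(ltW v0)//.
  apply: (@le_trans _ _ (1 * 1)%R); first by rewrite mulr1.
  apply: ler_pM => //; last by apply: exprn_ege1; rewrite invf_ge1// ltW.
  by rewrite lerDr mulr_ge0// ltW.
pose d s x := dev (b s) (be s) Q x.
have d0 s x : (0 <= d s x)%R by apply: dev_ge0; have [/ltW] := Hb s.
pose A s : set Rn := cube_set Q `&` [set x | mu ^+ N <= d s x ^+ (l * N)]%R.
apply: (@le_trans _ _ (leb (\big[setU/set0]_(s < l) A s))).
  apply: le_lebesgue_outer => x [xQ /= Hx].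
  rewrite -bigcup_fin.
  have [s Hs] : exists s, (mu < d s x ^+ l)%R.
    apply/existsP; rewrite -[X in is_true X]negbK negb_exists; apply/negP => /forallP Hn.
    move: Hx; rewrite ltNge => /negP; apply.
    have o0 := outer_ge0 gamma Q x Hb.
    rewrite -(@ler_pXn2r _ l)// ?nnegrE ?(ltW mu0)// /outer -prodrXl.
    apply: (@le_trans _ _ (\prod_(s < l) mu)%R); last by rewrite prodr_const card_ord.
    apply: ler_prod => s _; case: (gamma s); first by rewrite expr1n mu1 ler01.
    by rewrite exprn_ge0 ?d0//= leNgt; exact: Hn.
  exists s => //; split => //=; rewrite exprM lerXn2r ?nnegrE ?exprn_ge0 ?(ltW mu0)//.
  exact: ltW.
apply: le_trans (leb_bigsetU_le _ _) _.
apply: (@le_trans _ _ (\sum_(s < l) (K * mu^-1 ^+ N * vol Q)%:E)); last first.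
  rewrite sumEFin sumr_const card_ord lee_fin -[leLHS]mulr_natl !mulrA.
  by rewrite ler_wpM2r ?(ltW v0)// ler_wpM2r ?exprn_ge0 ?invr_ge0 ?(ltW mu0)// lerDl.
apply: lee_sum => s _; have [be0 mb ib ob] := Hb s.
have mg : measurable_fun (T := lT) (cube_set Q) (fun x => (d s x ^+ (l * N))%:E).
  apply: measurable_funTS; apply/measurable_EFinP; apply: measurable_funX; exact: measurable_devn.
have muN : (0 < mu ^+ N)%R by rewrite exprn_gt0.
have := le_integral_abse (@leb R n) mQ mg muN.
have -> : \int[leb]_(x in cube_set Q) `|(d s x ^+ (l * N))%:E| =
    \int[leb]_(x in cube_set Q) (d s x ^+ (l * N))%:E.
  by apply: eq_integral => x _; rewrite gee0_abs// lee_fin exprn_ge0.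
have -> : cube_set Q `&` [set x | (mu ^+ N)%:E <= `|(d s x ^+ (l * N))%:E|] = A s.
  apply: eq_set => x; rewrite /= ger0_norm ?exprn_ge0//; congr (_ /\ _).
move=> /le_trans /(_ (HK (b s) (be s) be0 mb ib ob Q)).
rewrite -lee_pdivlMl// -EFinM => /le_trans; apply.
by rewrite lee_fin exprVn mulrA [(_ * K)%R]mulrC.
Qed.

Lemma avg_scale (b f : Rn -> R) (be : R) (Q : cube R n) : (0 < be)%R ->
  lmeasurable b -> lmeasurable f ->
  avg (fun y => `|(b y - avg b Q) * f y|)%R Q = (be * wavg (dev b be Q) f Q)%R.
Proof.
move=> be0 mb mf; rewrite {1}/avg leb_vol/= /wavg /Rintegral.
have -> : \int[leb]_(x in cube_set Q) (`|(b x - avg b Q) * f x|)%:E =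
    be%:E * \int[leb]_(x in cube_set Q) (dev b be Q x * `|f x|)%:E.
  rewrite -ge0_integralZl; [|exact: measurable_cube| | |]; last 3 first.
  - apply: measurable_funTS; apply/measurable_EFinP; apply: measurable_funM.
      exact: measurable_devn.
    by apply: measurableT_comp; [exact: normr_measurable|exact: mf].
  - by move=> x _; rewrite lee_fin mulr_ge0// dev_ge0// ltW.
  - by rewrite lee_fin ltW.
  apply: eq_integral => x _; rewrite -EFinM normrM /dev; congr EFin.
  by field; rewrite gt_eqF.
have /= -> y : fine (be%:E * y) = (be * fine y)%R.
  case: y => [y| |]//=; rewrite ?gt0_muley ?gt0_muleNy ?lte_fin//= mulr0//.
by rewrite mulrC mulrA.
Qed.

Lemma avg_wavg1 (f : Rn -> R) (Q : cube R n) :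
  avg (fun y => `|f y|)%R Q = wavg (fun=> 1%R) f Q.
Proof.
rewrite /avg leb_vol/= /wavg /Rintegral mulrC; congr (fine _ / _)%R.
by apply: eq_integral => x _; rewrite mul1r.
Qed.

Lemma sparse_term (hlm : (l <= m)%N) b be (gamma : {ffun 'I_l -> bool}) (f : 'I_m -> Rn -> R) Q x :
  (forall s, bmo_bound (b s) (be s)) -> (forall i, lmeasurable (f i)) ->
  ((\prod_(s < l) sparse_factor (b s) (f (widen_ord hlm s)) Q (gamma s) x) *
   (\prod_(i < m | (l <= i)%N) avg (fun y => `|f i y|) Q) =
   (\prod_(s < l) be s) * ((\prod_(i < m) wavg (inner b be gamma i Q) (f i) Q) *
   outer b be gamma Q x))%R.
Proof.
move=> Hb mf; rewrite [in RHS](bigID (fun i : 'I_m => (i < l)%N))/= big_ord_narrow/=.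
have -> : (\prod_(i < m | (l <= i)%N) avg (fun y => `|f i y|) Q =
    \prod_(i < m | ~~ (i < l)%N) wavg (inner b be gamma i Q) (f i) Q)%R.
  rewrite (eq_bigl (fun i : 'I_m => ~~ (i < l)%N)); last by move=> i; rewrite -leqNgt.
  apply: eq_bigr => i il; rewrite avg_wavg1 /inner insubF//; exact/negbTE.
rewrite [RHS](_ : _ = (\prod_(s < l) be s * (\prod_(s < l) wavg (inner b be gamma (widen_ord hlm s) Q) (f (widen_ord hlm s)) Q) *
   outer b be gamma Q x) * \prod_(i < m | ~~ (i < l)%N) wavg (inner b be gamma i Q) (f i) Q)%R; last by ring.
congr (_ * _)%R; rewrite /outer -!big_split/=; apply: eq_bigr => s _.
have [be0 mb _ _] := Hb s.
rewrite /inner /= valK /sparse_factor; case: (gamma s).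
  by rewrite mulr1; exact: avg_scale.
by rewrite avg_wavg1 /dev; field; rewrite gt_eqF.
Qed.

End Factors.

(** * The Lorentz norm of the commutator on a ball *)

Section IntegerSums.
Context {R : realType}.

Lemma sum_int_geometric_le (rho : R) (s : seq int) : 0 <= rho < 1 -> uniq s ->
  \sum_(k <- s) rho ^+ `|k|%N <= 2 / (1 - rho).
Proof.
move=> /andP[rho0 rho1] us; have r1 : 0 < 1 - rho by rewrite subr_gt0.
pose M := (\max_(k <- s) `|k|%N).+1.
pose s' := map Posz (iota 0 M) ++ map Negz (iota 0 M).
have us' : uniq s'.
  rewrite cat_uniq; apply/and3P; split.
  - by rewrite map_inj_uniq ?iota_uniq// => ? ? [].
  - by apply/hasPn => _ /mapP[a _ ->]; apply/negP => /mapP[].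
  - by rewrite map_inj_uniq ?iota_uniq// => ? ? [].
have ss' : {subset s <= s'}.
  move=> k ks; have : (`|k|%N < M)%N by rewrite ltnS; exact: leq_bigmax_seq.
  case: k ks => k ks kM; rewrite mem_cat; apply/orP; [left|right]; apply: map_f; rewrite mem_iota add0n//.
  exact: ltnW.
apply: le_trans (ler_sum_sub us us' ss' _) _; first by move=> k; rewrite exprn_ge0.
have H : \sum_(j <- iota 0 M) rho ^+ j <= (1 - rho)^-1.
  have -> : iota 0 M = index_iota 0 M by rewrite /index_iota subn0.
  by rewrite big_mkord; apply: sum_geometric_le; rewrite rho0.
rewrite big_cat !big_map mulrDl mul1r; apply: lerD => //.
apply: le_trans H; apply: ler_sum => j _; rewrite exprS ler_piMl ?exprn_ge0//; exact: ltW.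
Qed.

(** [Z j] is the supremum over [k] of rho^|k| a (j + k), plus rho^|j| for positivity. It is summed
    by choosing a near-maximiser for each [j] with error rho^|j|, then enlarging to a sum over all
    chosen shifts; the 2 in [A + 2] counts the two terms rho^|j|. *)
Lemma smooth_majorant (rho A : R) : 0 < rho < 1 -> 0 <= A ->
  exists2 C : R, 0 < C & forall a : int -> R, (forall k, 0 <= a k) ->
  (forall s, uniq s -> \sum_(k <- s) a k <= A) ->
  exists Z : int -> R, [/\ forall j, 0 < Z j,
    forall j k, rho ^+ `|k|%N * a (j + k) <= Z j &
    forall s, uniq s -> \sum_(j <- s) Z j <= C].
Proof.
move=> /andP[rho0 rho1] A0; have r1 : 0 < 1 - rho by rewrite subr_gt0.
exists ((A + 2) * (2 / (1 - rho))); first by rewrite mulr_gt0 ?divr_gt0// ltr_wpDl.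
move=> a a0 aA.
have rk (k : int) : (0 <= rho ^+ `|k|%N) && (rho ^+ `|k|%N <= 1) by rewrite exprn_ge0 ?exprn_ile1//= ltW.
have aA1 k : a k <= A by have := aA [:: k] isT; rewrite big_seq1.
have exz j : exists zk : R * int, (forall k, rho ^+ `|k|%N * a (j + k) <= zk.1) /\
    zk.1 <= rho ^+ `|zk.2|%N * a (j + zk.2) + rho ^+ `|j|%N.
  pose E := [set rho ^+ `|k|%N * a (j + k) | k in [set: int]].
  have hE : has_sup E.
    split; first by exists (rho ^+ `|0%R : int|%N * a (j + 0)); exists 0.
    exists A => _ [k _ <-]; have /andP[k0 k1] := rk k.
    by apply: le_trans (aA1 (j + k)); rewrite ler_piMl.
  have e0 : 0 < rho ^+ `|j|%N by rewrite exprn_gt0.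
  have [_ [k _ <-] Hk] := sup_adherent e0 hE.
  exists (sup E, k); split => [k'|]/=; first by apply: ub_le_sup; [exact: hE.2|exists k'].
  by rewrite -lerBlDr ltW.
have [zk Hzk] := choice exz.
have zk0 j : 0 <= (zk j).1.
  apply: le_trans ((Hzk j).1 0); by rewrite mulr_ge0 ?a0 ?exprn_ge0// ltW.
exists (fun j => (zk j).1 + rho ^+ `|j|%N); split.
- by move=> j; rewrite ltr_wpDl ?exprn_gt0.
- by move=> j k; apply: le_trans ((Hzk j).1 k) _; rewrite lerDl exprn_ge0// ltW.
move=> s us; pose S2 := \sum_(j <- s) rho ^+ `|j|%N.
apply: (@le_trans _ _ (\sum_(j <- s) rho ^+ `|(zk j).2|%N * a (j + (zk j).2) + 2 * S2)).
  rewrite mulr_sumr -big_split/=; apply: ler_sum => j _.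
  have := (Hzk j).2; lra.
have HS2 : S2 <= 2 / (1 - rho) by apply: sum_int_geometric_le; rewrite // ltW.
have -> : (A + 2) * (2 / (1 - rho)) = A * (2 / (1 - rho)) + 2 * (2 / (1 - rho)) by ring.
suff H : \sum_(j <- s) rho ^+ `|(zk j).2|%N * a (j + (zk j).2) <= A * (2 / (1 - rho)) by lra.
pose ks := undup [seq (zk j).2 | j <- s].
apply: (@le_trans _ _ (\sum_(k <- ks) \sum_(j <- s) rho ^+ `|k|%N * a (j + k))).
  rewrite exchange_big/= big_seq [leRHS]big_seq; apply: ler_sum => j js.
  rewrite [leRHS](big_rem (zk j).2)/=; last by rewrite mem_undup; apply: (map_f (fun j => (zk j).2)).
  by rewrite lerDl sumr_ge0// => k _; rewrite mulr_ge0 ?a0 ?exprn_ge0// ltW.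
apply: (@le_trans _ _ (\sum_(k <- ks) rho ^+ `|k|%N * A)).
  apply: ler_sum => k _; rewrite -mulr_sumr ler_wpM2l ?exprn_ge0 ?(ltW rho0)//.
  rewrite -(big_map (fun j => j + k) xpredT a); apply: aA.
  by rewrite map_inj_uniq//; exact: addIr.
rewrite -mulr_suml mulrC ler_wpM2l//; apply: sum_int_geometric_le; first by rewrite ltW.
exact: undup_uniq.
Qed.

End IntegerSums.

Lemma powRK (R : realType) (q y : R) : 0 < q -> 0 <= y -> (y `^ q) `^ q^-1 = y.
Proof. by move=> q0 y0; rewrite -powRrM mulfV ?gt_eqF// powRr1. Qed.

Section LorentzWeak.
Context {R : realType} {n : nat}.
Local Notation Rn := 'rV[R]_n.
Local Open Scope ereal_scope.

(** The embedding into weak L^p, for all [q] at once. A factor 2 in the constant provides the strict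
    inequality that [leb_rearrangement] asks for. *)
Lemma lorentz_weak (p : R) (q : \bar R) : (0 < p)%R -> 0 < q ->
  exists2 C : R, (0 < C)%R & forall (g : Rn -> \bar R) (L t : R), (0 < L)%R -> (0 < t)%R ->
  lorentz p q g <= L%:E -> leb [set x | (C * L * t `^ (- p^-1))%:E < `|g x|] <= t%:E.
Proof.
move=> p0; case: q => [q| |]// q0.
- have Q0 : (0 < 2 * (2 `^ p^-1) `^ q :> R)%R by rewrite mulr_gt0 ?powR_gt0.
  pose c := ((2 * (2 `^ p^-1) `^ q) `^ q^-1)%R.
  have c0 : (0 < c)%R by rewrite powR_gt0.
  exists (2 * 2 `^ p^-1 * c)%R; first by rewrite !mulr_gt0 ?powR_gt0.
  move=> g L t L0 t0 gL; apply: leb_rearrangement.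
  have [x [x0 Hx Hs]] := lorentz_dyadic_sum p0 q0 (ltW L0) gL.
  have [k /andP[kt tk]] := dy_locate t0.
  apply: (le_lt_trans (rearrangement_nonincreasing g (ltW kt))); rewrite Hx lte_fin.
  have dk := @dy_gt0 R k.
  have H1 : (dy k `^ p^-1 * x k <= c * L)%R.
    have := Hs [:: k] isT; rewrite big_seq1 => /(@ge0_ler_powR R q^-1) H.
    have := H (ltac:(by rewrite invr_ge0 ltW)) (powR_ge0 _ _) (mulr_ge0 (ltW Q0) (powR_ge0 _ _)).
    by rewrite [X in (_ <= X)%R -> _]powRM ?(ltW Q0) ?powR_ge0// !powRK// ?(ltW L0)// mulr_ge0 ?powR_ge0.
  have H2 : (t `^ p^-1 <= 2 `^ p^-1 * dy k `^ p^-1)%R.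
    have <- : (dy (k + 1) `^ p^-1 = 2 `^ p^-1 * dy k `^ p^-1 :> R)%R.
      by rewrite dyS; apply: powRM => //; exact: ltW.
    apply: ge0_ler_powR; [by rewrite invr_ge0 ltW| | |exact: tk]; rewrite nnegrE ltW//.
    exact: dy_gt0.
  have tp : (0 < t `^ p^-1)%R by rewrite powR_gt0.
  have dp : (0 < dy k `^ p^-1)%R by rewrite powR_gt0.
  rewrite powRN ltr_pdivlMr//.
  apply: (@le_lt_trans _ _ (2 `^ p^-1 * (c * L))%R); last first.
    have E : (0 < 2 `^ p^-1 * (c * L))%R by apply: mulr_gt0; [exact: powR_gt0|exact: mulr_gt0].
    by rewrite -!mulrA mulrA -mulrA ltr_pMl// ltr1n.
  apply: (@le_trans _ _ (x k * (2 `^ p^-1 * dy k `^ p^-1))%R); first exact: ler_wpM2l.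
  by rewrite mulrCA ler_wpM2l ?powR_ge0// mulrC.
- exists 2%R => // g L t L0 t0 gL; apply: leb_rearrangement.
  have tp : (0 < t `^ p^-1)%R by rewrite powR_gt0.
  have : (t `^ p^-1)%:E * rearrangement g t <= L%:E.
    by apply: le_trans gL; apply: ereal_sup_ubound; exists t => //=; rewrite in_itv/= t0.
  rewrite muleC -lee_pdivlMr// => /le_lt_trans; apply; rewrite lte_fin powRN.
  by rewrite -mulrA ltr_pMl ?divr_gt0// ltr1n.
Qed.

End LorentzWeak.

(** * Choice of the exponents *)

Section Exponents.
Context {R : realType} {m : nat}.

(** The reciprocal of a sum of reciprocals, plus 1, avoids a minimum over a possibly empty index
    set. *)
Lemma pos_lower_bound (F : 'I_m -> R) : (forall i, 0 < F i) ->
  exists2 d : R, 0 < d & forall i, d < F i.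
Proof.
move=> F0; have s0 : 0 <= \sum_i (F i)^-1 by apply: sumr_ge0 => i _; rewrite invr_ge0 ltW.
have s1 : 0 < \sum_i (F i)^-1 + 1 by rewrite ltr_wpDl.
exists (\sum_i (F i)^-1 + 1)^-1; first by rewrite invr_gt0.
move=> i; rewrite -[ltRHS]invrK ltf_pV2 ?posrE ?invr_gt0 ?F0//.
rewrite (bigD1 i)//= -addrA ltrDl ltr_wpDl// sumr_ge0// => j _; rewrite invr_ge0 ltW//.
Qed.

Lemma exponent_parameters (n : nat) (p theta : R) (ps : 'I_m -> R) : (0 < n)%N -> (0 < m)%N ->
  1 < p -> (forall i, 1 < ps i) -> (forall i, theta < (ps i)^-1) ->
  exists N (de sg sg' : R), [/\ (0 < N)%N, 0 < de,
    forall i, 0 < (ps i)^-1 /\ (ps i)^-1 + de + N%:R^-1 < 1,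
    0 < sg < \sum_i ((ps i)^-1 - de) /\ 1 < N%:R * sg &
    [/\ 0 < sg' < n%:R * \sum_i ((ps i)^-1 - theta), n%:R < N%:R * sg' & N%:R^-1 < p^-1]].
Proof.
move=> n0 m0 p1 ps1 th.
have w0 i : 0 < (ps i)^-1 by rewrite invr_gt0 (lt_trans _ (ps1 i)).
have w1 i : (ps i)^-1 < 1 by rewrite invf_lt1// (lt_trans _ (ps1 i)).
(* [de] below 1/p_i keeps the products of averages decaying; below half of 1 - 1/p_i it also leaves
   room for 1/N < [de]. *)
have [de de0 Hde] := @pos_lower_bound (fun i => Num.min (ps i)^-1 ((1 - (ps i)^-1) / 2))
   (ltac:(by move=> i; rewrite lt_min w0 divr_gt0// subr_gt0)).
have sum_pos (F : 'I_m -> R) : (forall i, 0 < F i) -> 0 < \sum_i F i.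
  move=> F0; rewrite (bigD1 (Ordinal m0))//= ltr_wpDr// sumr_ge0// => i _; exact: ltW.
have S1 : 0 < \sum_i ((ps i)^-1 - de).
  by apply: sum_pos => i; rewrite subr_gt0; have := Hde i; rewrite lt_min => /andP[].
have S2 : 0 < n%:R * \sum_i ((ps i)^-1 - theta).
  by rewrite mulr_gt0 ?ltr0n//; apply: sum_pos => i; rewrite subr_gt0.
set s1 := \sum_i _ in S1; set s2 := n%:R * _ in S2.
(* Each summand is the lower bound that one requirement puts on [N]; the summand [p] yields 1/N <
   1/p, needed when the levels are summed. *)
pose x := de^-1 + (s1 / 2)^-1 + n%:R * (s2 / 2)^-1 + p.
have [N HN] : exists N : nat, x < N%:R by exists (Num.truncn x).+1; exact: truncnS_gt.
have d0 : 0 < de^-1 by rewrite invr_gt0.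
have d1 : 0 < (s1 / 2)^-1 by rewrite invr_gt0 divr_gt0.
have d2 : 0 < n%:R * (s2 / 2)^-1 by rewrite mulr_gt0 ?ltr0n// invr_gt0 divr_gt0.
have p0 : 0 < p by apply: lt_trans p1.
have N0 : 0 < N%:R :> R by apply: lt_trans HN; rewrite /x; lra.
exists N, de, (s1 / 2), (s2 / 2); rewrite -/s1 -/s2; split => //.
- by rewrite -(ltr0n R).
- move=> i; split => //; have := Hde i; rewrite lt_min => /andP[_ h].
  have : N%:R^-1 < de by rewrite -[de]invrK ltf_pV2 ?posrE//; rewrite /x in HN; lra.
  lra.
- split; first by apply/andP; split; lra.
  by rewrite -ltr_pdivrMr ?divr_gt0// div1r; rewrite /x in HN; lra.
- split; first by apply/andP; split; lra.
    by rewrite -ltr_pdivrMr ?divr_gt0//; rewrite /x in HN; lra.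
  by rewrite ltf_pV2 ?posrE//; rewrite /x in HN; lra.
Qed.

End Exponents.

Section DyadicLevels.
Context {R : realType} {n : nat}.
Local Notation Rn := 'rV[R]_n.
Local Open Scope ereal_scope.

Lemma powR_add_le (a b q : R) : (0 <= a)%R -> (0 <= b)%R -> (0 <= q)%R ->
  ((a + b) `^ q <= 2 `^ q * (a `^ q + b `^ q))%R.
Proof.
move=> a0 b0 q0; wlog ab : a b a0 b0 / (a <= b)%R => [H|].
  by have [ab|/ltW ba] := leP a b; [exact: H|rewrite addrC [X in (_ <= _ * X)%R]addrC; exact: H].
apply: (@le_trans _ _ ((2 * b) `^ q)%R).
  apply: ge0_ler_powR => //; rewrite ?nnegrE; first exact: addr_ge0.
    exact: mulr_ge0.
  lra.
by rewrite powRM// ler_wpM2l ?powR_ge0// lerDr powR_ge0.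
Qed.

Lemma dy_powR_abs (k : int) (e : R) : (k <= 0)%R -> ((dy k : R) `^ e = (2 `^ (- e)) ^+ `|k|%N)%R.
Proof.
move=> k0; have -> : k = (- `|k|%N%:Z)%R by rewrite abszE ler0_norm ?opprK.
rewrite abszN absz_nat /dy -powRrM pow2E; congr (_ `^ _)%R.
by rewrite rmorphN /= mulNr mulrN.
Qed.

Lemma level_split (a D v E z p nu : R) : (0 < a)%R -> (0 < D)%R -> (0 < v)%R -> (nu < p^-1)%R ->
  ((a * D) `^ p^-1 * (E * (a `^ (- p^-1) * z + v `^ (- p^-1) * (v / a) `^ nu)) =
   D `^ p^-1 * E * (z + (a / v) `^ (p^-1 - nu)))%R.
Proof.
move=> a0 D0 v0 nup; rewrite (powRM _ (ltW a0) (ltW D0)).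
have -> : ((a / v) `^ (p^-1 - nu) = a `^ p^-1 * v `^ (- p^-1) * (v / a) `^ nu)%R.
  rewrite powRB ?gt_eqF ?divr_gt0//.
  rewrite powRM ?invr_ge0 ?(ltW a0) ?(ltW v0)// powRV ?(ltW v0)// powRN.
  by rewrite -[(v / a)%R]invrK invf_div powRV ?divr_ge0 ?(ltW a0) ?(ltW v0).
have : (a `^ p^-1 * a `^ (- p^-1) = 1)%R by rewrite powRN mulfV// gt_eqF ?powR_gt0.
move: (a `^ p^-1)%R (a `^ (- p^-1))%R (v `^ (- p^-1))%R ((v / a) `^ nu)%R (D `^ p^-1)%R => x x' w u d xx'.
transitivity (d * E * ((x * x') * z + x * w * u))%R; first by ring.
by rewrite xx' mul1r.
Qed.

(** Multiplied by 2^(j/p), the first term leaves Z_j^(1/q), whose q-th powers are summable, and the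
    second becomes (2^j / v)^(1/p - nu). The latter is geometric for levels up to about [K * v];
    beyond them the support bound makes the rearrangement vanish. The shift [c0] absorbs constants
    in front of the level. *)
Lemma lorentz_from_levels (p q nu K CZ : R) (c0 : nat) : (0 < p)%R -> (1 <= q)%R ->
  (nu < p^-1)%R -> (0 < K)%R -> (0 <= CZ)%R ->
  exists2 C : R, (0 < C)%R & forall (g : Rn -> \bar R) (v E : R) (Z : int -> R),
  (0 < v)%R -> (0 <= E)%R -> (forall j, 0 < Z j)%R ->
  (forall s, uniq s -> \sum_(j <- s) Z j <= CZ)%R ->
  leb [set x | 0 < `|g x|] <= (K * v)%:E ->
  (forall j, rearrangement g (dy (j + c0%:Z)) <=
     (E * ((dy j) `^ (- p^-1) * Z j `^ q^-1 + v `^ (- p^-1) * (v / dy j) `^ nu))%:E) ->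
  lorentz p q%:E g <= (C * E)%:E.
Proof.
move=> p0 q1 nup K0 CZ0; have q0 : (0 < q)%R by apply: lt_le_trans q1.
pose e := ((p^-1 - nu) * q)%R; have e0 : (0 < e)%R by rewrite mulr_gt0// subr_gt0.
pose rho : R := (2 `^ (- e))%R.
have rho0 : (0 < rho)%R by exact: pow2_gt0.
have rho1 : (rho < 1)%R by rewrite -(powRr0 2) pow2_lt// oppr_lt0.
have r1 : (0 < 1 - rho)%R by rewrite subr_gt0.
pose D : R := dy c0%:Z; have D0 : (0 < D)%R by exact: dy_gt0.
have D1 : (1 <= D)%R by rewrite /D dy_nat exprn_ege1// ler1n.
pose M := (2 `^ q * (CZ + K `^ e * (2 / (1 - rho))))%R.
have M0 : (0 < M)%R.
  by rewrite mulr_gt0 ?powR_gt0// ltr_wpDl// mulr_gt0 ?powR_gt0 ?divr_gt0.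
pose B := (2 * (2 `^ p^-1) `^ q * M)%R.
have B0 : (0 < B)%R.
  by apply: mulr_gt0 => //; apply: mulr_gt0 => //; rewrite !powR_gt0.
exists (D `^ p^-1 * B `^ q^-1)%R; first by rewrite mulr_gt0 ?powR_gt0.
move=> g v E Z v0 E0 Z0 HZ supp Hlev.
have Kv0 : (0 < K * v)%R by exact: mulr_gt0.
have [k0 /andP[k0l k0r]] := dy_locate Kv0.
pose y (k : int) := if (dy k < K * v)%R then
  (E * ((dy (k - c0%:Z)) `^ (- p^-1) * Z (k - c0%:Z) `^ q^-1 + v `^ (- p^-1) * (v / dy (k - c0%:Z)) `^ nu))%R else 0%R.
have y0 k : (0 <= y k)%R.
  rewrite /y; case: ifP => // _; apply: mulr_ge0 => //; apply: addr_ge0; apply: mulr_ge0; exact: powR_ge0.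
have Hy k : rearrangement g (dy k) <= (y k)%:E.
  rewrite /y; case: ltP => [_|kv]; last first.
    by apply: rearrangement_le => //; apply: le_trans supp _; rewrite lee_fin.
  by have := Hlev (k - c0%:Z)%R; rewrite subrK.
have term k : ((dy k `^ p^-1 * y k) `^ q <= (D `^ p^-1 * E) `^ q * (2 `^ q * (Z (k - c0%:Z) +
    K `^ e * rho ^+ `|(k - k0)%R|%N)))%R.
  have Pos : (0 <= Z (k - c0%:Z) + K `^ e * rho ^+ `|(k - k0)%R|%N)%R.
    by rewrite addr_ge0 ?(ltW (Z0 _))// mulr_ge0 ?powR_ge0// exprn_ge0// ltW.
  rewrite /y; case: ifP => kv; last first.
    have -> : ((dy k `^ p^-1 * 0) `^ q = 0)%R by rewrite mulr0 powR0// lt0r_neq0.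
    apply: mulr_ge0; first exact: powR_ge0.
    by apply: mulr_ge0 => //; exact: powR_ge0.
  set j := (k - c0%:Z)%R; have dj := @dy_gt0 R j; have Zj := Z0 j.
  have dkE : (dy k = dy j * D :> R)%R by rewrite /D -dyD /j subrK.
  have Ej : (dy k `^ p^-1 * (E * (dy j `^ (- p^-1) * Z j `^ q^-1 + v `^ (- p^-1) * (v / dy j) `^ nu)) =
     D `^ p^-1 * E * (Z j `^ q^-1 + (dy j / v) `^ (p^-1 - nu)))%R.
    by rewrite dkE; exact: level_split.
  rewrite Ej powRM; [|by apply: mulr_ge0 => //; exact: powR_ge0|by apply: addr_ge0; exact: powR_ge0].
  rewrite ler_wpM2l ?powR_ge0//.
  apply: le_trans (powR_add_le (powR_ge0 _ _) (powR_ge0 _ _) (ltW q0)) _.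
  rewrite ler_wpM2l ?powR_ge0//; apply: lerD.
    by rewrite -powRrM mulVf ?gt_eqF// powRr1// ltW.
  rewrite -powRrM -/e.
  have kk0 : (k - k0 <= 0)%R.
    by rewrite subr_le0 -ltzD1 -(@ltr_dy R); apply: lt_le_trans kv k0r.
  rewrite -dy_powR_abs// -powRM ?(ltW K0) ?(ltW (dy_gt0 _))//.
  apply: ge0_ler_powR; [exact: ltW|by rewrite nnegrE divr_ge0 ?(ltW dj) ?(ltW v0)
    |by rewrite nnegrE mulr_ge0 ?(ltW K0) ?(ltW (dy_gt0 _))|].
  rewrite ler_pdivrMr//.
  apply: (@le_trans _ _ (dy k)); first by rewrite dkE ler_peMr// ltW.
  have -> : (dy k = dy (k - k0) * dy k0 :> R)%R by rewrite -dyD subrK.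
  by rewrite mulrAC mulrC; apply: ler_wpM2r; [exact/ltW/dy_gt0|exact: ltW].
have Hs s : uniq s -> (\sum_(k <- s) (dy k `^ p^-1 * y k) `^ q <= (D `^ p^-1 * E) `^ q * M)%R.
  move=> us; apply: le_trans (ler_sum _ _) _; first by move=> k _; exact: term.
  rewrite -mulr_sumr ler_wpM2l ?powR_ge0// -mulr_sumr ler_wpM2l ?powR_ge0// big_split/=.
  apply: lerD.
    rewrite -(big_map (fun k => k - c0%:Z)%R xpredT Z); apply: HZ.
    by rewrite map_inj_uniq//; exact: addIr.
  rewrite -mulr_sumr ler_wpM2l ?powR_ge0//.
  rewrite -(big_map (fun k => k - k0)%R xpredT (fun k : int => rho ^+ `|k|%N)%R).
  apply: sum_int_geometric_le; first by rewrite rho1 ltW.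
  by rewrite map_inj_uniq//; exact: addIr.
apply: le_trans (lorentz_le_dyadic p0 q0 y0 Hy Hs) _; rewrite lee_fin le_eqVlt; apply/orP; left; apply/eqP.
have DE0 : (0 <= D `^ p^-1 * E)%R by rewrite mulr_ge0 ?powR_ge0.
have -> : (2 * (2 `^ p^-1) `^ q * ((D `^ p^-1 * E) `^ q * M) = (D `^ p^-1 * E) `^ q * B)%R.
  by rewrite [LHS]mulrCA.
rewrite (powRM _ (powR_ge0 _ _) (ltW B0)) powRK//.
by rewrite mulrAC.
Qed.

End DyadicLevels.

(** The sparse bound frozen at one tuple [f], with any function [g] in the place of the commutator:
    the estimates use nothing else about it. *)
Definition dominated {R : realType} {n l m : nat} (hlm : (l <= m)%N) (C0 : R)
    (b : 'I_l -> 'rV[R]_n -> R) (f : 'I_m -> 'rV[R]_n -> R)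
    (S : 'I_(3 ^ n) -> set (cube R n)) (g : 'rV[R]_n -> R) : Prop :=
  {ae leb, forall x, (`|g x|%:E <=
    C0%:E * \sum_(j < 3 ^ n) \sum_(gamma : {ffun 'I_l -> bool}) sparse_sum hlm b f (S j) gamma x)%E}.

Section SparseSum.
Context {R : realType} {n l m : nat}.
Hypotheses (n0 : (0 < n)%N) (l0 : (0 < l)%N).
Variable hlm : (l <= m)%N.
Local Notation Rn := 'rV[R]_n.
Local Notation lT := (lebesgue_type R n).
Local Open Scope ereal_scope.

Definition weighted_term (b : 'I_l -> Rn -> R) (be : 'I_l -> R) (f : 'I_m -> Rn -> R)
    (gamma : {ffun 'I_l -> bool}) (Q : cube R n) (x : Rn) : R :=
  ((\prod_i wavg (inner b be gamma i Q) (f i) Q) * outer b be gamma Q x * \1_(cube_set Q) x)%R.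

Lemma inner_ge0 (b : 'I_l -> Rn -> R) be gamma (i : 'I_m) Q x : (forall s : 'I_l, bmo_bound (b s) (be s)) ->
  (0 <= inner b be gamma i Q x)%R.
Proof.
move=> Hb; rewrite /inner; case: insubP => // s _ _; case: (gamma s) => //.
by apply: dev_ge0; have [/ltW] := Hb s.
Qed.

Lemma weighted_term_ge0 b be f gamma Q x : (forall s, bmo_bound (b s) (be s)) ->
  (0 <= weighted_term b be f gamma Q x)%R.
Proof.
move=> Hb; rewrite /weighted_term indicE; apply: mulr_ge0; last exact: ler0n.
apply: mulr_ge0; last exact: outer_ge0.
by apply: prodr_ge0 => i _; apply: wavg_ge0 => y; exact: inner_ge0.
Qed.

Lemma sparse_sumE b be f (S : set (cube R n)) gamma x : (forall s, bmo_bound (b s) (be s)) ->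
  (forall i, lmeasurable (f i)) ->
  sparse_sum hlm b f S gamma x =
  \esum_(Q in S) ((\prod_(s < l) be s) * weighted_term b be f gamma Q x)%R%:E.
Proof.
move=> Hb mf; apply: eq_esum => Q _; congr EFin.
by rewrite (sparse_term hlm gamma Q x Hb mf) /weighted_term !mulrA.
Qed.

Lemma prod_be_gt0 (b : 'I_l -> Rn -> R) be : (forall s, bmo_bound (b s) (be s)) ->
  (0 < \prod_(s < l) be s)%R.
Proof. by move=> Hb; apply: prodr_gt0 => s _; have [] := Hb s. Qed.

Lemma sparse_sum_ge0 b be f (S : set (cube R n)) gamma x : (forall s, bmo_bound (b s) (be s)) ->
  (forall i, lmeasurable (f i)) -> 0 <= sparse_sum hlm b f S gamma x.
Proof.
move=> Hb mf; rewrite (sparse_sumE S gamma x Hb mf); apply: esum_ge0 => Q _; rewrite lee_fin.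
by apply: mulr_ge0; [exact/ltW/(prod_be_gt0 Hb)|exact: weighted_term_ge0].
Qed.

Lemma sparse_sum_weak (b : 'I_l -> Rn -> R) be f (S : set (cube R n)) (eta Lam : R) gamma
    (B : set Rn) (M : \bar R) :
  (forall s, bmo_bound (b s) (be s)) -> (forall i, lmeasurable (f i)) ->
  sparse eta S -> measurable (B : set lT) ->
  (forall (D : set (cube R n)) (s : seq (cube R n)), dyadic_lattice D ->
     {in s, forall Q, D Q} -> uniq s -> sparse_seq eta s ->
     leb (B `&` [set x | Lam < \sum_(Q <- s) weighted_term b be f gamma Q x]%R) <= M) ->
  leb (B `&` [set x | ((\prod_(s < l) be s) * Lam)%:E < sparse_sum hlm b f S gamma x]) <= M.
Proof.
move=> Hb mf [[D latD SD] sS] mB HM.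
have W0 := prod_be_gt0 Hb.
have -> : [set x | ((\prod_(s < l) be s) * Lam)%:E < sparse_sum hlm b f S gamma x] =
  [set x | ((\prod_(s < l) be s) * Lam)%:E <
     \esum_(Q in S) ((\prod_(s < l) be s) * weighted_term b be f gamma Q x)%R%:E].
  by apply: eq_set => x; rewrite (sparse_sumE S gamma x Hb mf).
apply: leb_esum_le; [|exact: mB| | |].
- exact: (@lattice_countable _ _ n0 D latD S SD).
- by move=> Q x; apply: mulr_ge0; [exact: ltW|exact: weighted_term_ge0].
- move=> Q; apply: measurable_funM; first exact: measurable_cst.
  apply: measurable_funM; last by apply: measurable_indic; exact: measurable_cube.
  by apply: measurable_funM; [exact: measurable_cst|exact: measurable_outer].
- move=> s us sS'; have sD : {in s, forall Q, D Q} by move=> Q /sS' /SD.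
  have -> : [set x | \prod_(s < l) be s * Lam < \sum_(Q <- s) \prod_(s < l) be s * weighted_term b be f gamma Q x]%R =
    [set x | Lam < \sum_(Q <- s) weighted_term b be f gamma Q x]%R.
    by apply: eq_set => x; rewrite -mulr_sumr ltr_pM2l.
  apply: (HM D s latD sD us) => Q Qs.
  have := sS Q (sS' Q Qs); rewrite [X in _ <= _ * X](leb_vol Q) -EFinM; apply: le_trans.
  apply: le_lebesgue_outer => x [Q' [Q's QQ] xQ]; exists Q' => //; split => //; exact: sS'.
Qed.

(** If |g| exceeds a level times the number 3^n 2^l of sparse sums, one of these sums exceeds the
    level. [C0] may have any sign, hence its maximum with 1. *)
Lemma dominated_weak (b : 'I_l -> Rn -> R) be f (S : 'I_(3 ^ n) -> set (cube R n)) (C0 eta Lam : R)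
    (g : Rn -> R) (B : set Rn) (M : R) :
  (forall s, bmo_bound (b s) (be s)) -> (forall i, lmeasurable (f i)) ->
  (forall j, sparse eta (S j)) -> measurable (B : set lT) -> (0 <= Lam)%R ->
  dominated hlm C0 b f S g ->
  (forall gamma (D : set (cube R n)) (s : seq (cube R n)), dyadic_lattice D ->
     {in s, forall Q, D Q} -> uniq s -> sparse_seq eta s ->
     leb (B `&` [set x | Lam < \sum_(Q <- s) weighted_term b be f gamma Q x]%R) <= M%:E) ->
  leb (B `&` [set x | Num.max C0 1 * (3 ^ n * 2 ^ l)%:R * ((\prod_(s < l) be s) * Lam) < `|g x|]%R)
    <= ((3 ^ n * 2 ^ l)%:R * M)%:E.
Proof.
move=> Hb mf sS mB Lam0 [A [mA A0 HA]] HM; have W0 := prod_be_gt0 Hb.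
have cnt (c : R) : \sum_(j < 3 ^ n) \sum_(gamma : {ffun 'I_l -> bool}) c%:E = ((3 ^ n * 2 ^ l)%:R * c)%:E.
  under eq_bigr do rewrite sumEFin.
  rewrite sumEFin !sumr_const card_ord card_ffun card_bool card_ord -mulrnA.
  by rewrite mulnC mulr_natl.
pose E j gamma : set Rn :=
  B `&` [set x | ((\prod_(s < l) be s) * Lam)%:E < sparse_sum hlm b f (S j) gamma x].
have HE j gamma : leb (E j gamma) <= M%:E.
  apply: (sparse_sum_weak Hb mf (sS j) mB) => D s; exact: HM.
apply: (@le_trans _ _ (leb (A `|` \big[setU/set0]_(j < 3 ^ n) \big[setU/set0]_(gamma : {ffun 'I_l -> bool}) E j gamma))).
  apply: le_lebesgue_outer => x [xB /= Hx].
  have [xA|xA] := pselect (A x); [by left|right].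
  have Hg : `|g x|%:E <=
      C0%:E * \sum_(j < 3 ^ n) \sum_(gamma : {ffun 'I_l -> bool}) sparse_sum hlm b f (S j) gamma x.
    by apply: contrapT => Hn; apply: xA; apply: HA.
  rewrite -bigcup_fin; apply: contrapT => Hn.
  have Hle j gamma : sparse_sum hlm b f (S j) gamma x <= ((\prod_(s < l) be s) * Lam)%:E.
    rewrite leNgt; apply/negP => H; apply: Hn; exists j => //; rewrite -bigcup_fin; exists gamma => //.
  move: Hx; rewrite ltNge => /negP; apply; rewrite -lee_fin; apply: (le_trans Hg).
  apply: (@le_trans _ _ ((Num.max C0 1)%:E * \sum_(j < 3 ^ n) \sum_(gamma : {ffun 'I_l -> bool}) sparse_sum hlm b f (S j) gamma x)).
    apply: lee_wpmul2r; last by rewrite lee_fin le_max lexx.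
    by apply: sume_ge0 => j _; apply: sume_ge0 => gamma _; exact: sparse_sum_ge0 Hb mf.
  rewrite -mulrA EFinM; apply: lee_wpmul2l; first by rewrite lee_fin le_max ler01 orbT.
  apply: (@le_trans _ _ (\sum_(j < 3 ^ n) \sum_(gamma : {ffun 'I_l -> bool}) ((\prod_(s < l) be s) * Lam)%:E)).
    by apply: lee_sum => j _; apply: lee_sum => gamma _; exact: Hle.
  by rewrite cnt.
apply: le_trans (outer_measureU2 (@lebesgue_outer R n) _ _) _.
rewrite [X in X + _](_ : _ = 0); last exact: A0.
rewrite add0e; apply: le_trans (leb_bigsetU_le _ _) _.
apply: (@le_trans _ _ (\sum_(j < 3 ^ n) \sum_(gamma : {ffun 'I_l -> bool}) M%:E)).
  apply: lee_sum => j _; apply: le_trans (leb_bigsetU_le _ _) _.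
  by apply: lee_sum => gamma _; exact: HE.
by rewrite cnt.
Qed.

End SparseSum.

Lemma prod_powR_sum (R : realType) (m : nat) (x : R) (w : 'I_m -> R) : 0 < x ->
  \prod_i x `^ (w i) = x `^ (\sum_i w i).
Proof.
move=> x0; elim/big_rec2: _ => [|i y1 y2 _ ->]; first by rewrite powRr0.
by rewrite powRD// (gt_eqF x0) implybT.
Qed.

Lemma cross_sum_le (R : realDomainType) (x y a b : R) : 0 <= x -> 0 <= y -> 0 <= a -> 0 <= b ->
  x * a + y * b <= (x + y) * (a + b).
Proof.
move=> x0 y0 a0 b0; rewrite mulrDl !mulrDr; apply: lerD; first by rewrite lerDl mulr_ge0.
by rewrite lerDr mulr_ge0.
Qed.

Section LocalEstimate.
Context {R : realType} {n l m : nat}.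
Hypotheses (n0 : (0 < n)%N) (l0 : (0 < l)%N).
Variable hlm : (l <= m)%N.
Local Notation Rn := 'rV[R]_n.
Local Notation lT := (lebesgue_type R n).
Local Open Scope ereal_scope.

(** The normalised dyadic values of all the [g i] are added before [smooth_majorant] is applied. One
    [Z] then serves every [i], and the product of the Z^(1/q_i) is Z^(1/q), which takes the place of
    Hoelder's inequality. The loss 2^(de |k| / q_i) is at most 2^(de |k|) because [1 <= qs i]. *)
Lemma dyadic_majorant (ps qs : 'I_m -> R) (de : R) : (forall i, 1 < ps i)%R ->
  (forall i, 1 <= qs i)%R -> (0 < de)%R ->
  exists2 CZ : R, (0 < CZ)%R & forall (g : 'I_m -> Rn -> \bar R) (L : 'I_m -> R),
  (forall i, 0 < L i)%R -> (forall i, lorentz (ps i) (qs i)%:E (g i) <= (L i)%:E) ->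
  exists Z : int -> R, [/\ forall j, (0 < Z j)%R,
    forall s, uniq s -> (\sum_(j <- s) Z j <= CZ)%R &
    forall i (j k : int), leb [set x | (2 * L i * dy j `^ (- (ps i)^-1) * Z j `^ (qs i)^-1 *
       2 `^ (- (k%:~R * (ps i)^-1) + de * `|k|%:~R))%:E < `|g i x|] <= (dy k * dy j)%:E].
Proof.
move=> ps1 qs1 de0.
have p0 i : (0 < ps i)%R by apply: lt_trans (ps1 i).
have q0 i : (0 < qs i)%R by apply: lt_le_trans (qs1 i).
pose rho : R := (2 `^ (- de))%R.
have rho01 : (0 < rho < 1)%R by rewrite pow2_gt0/= -(powRr0 2) pow2_lt// oppr_lt0.
pose A i : R := (2 * (2 `^ (ps i)^-1) `^ (qs i))%R.
have A0 i : (0 <= A i)%R by rewrite /A; apply: mulr_ge0 => //; exact: powR_ge0.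
have AA0 : (0 <= \sum_i A i)%R by apply: sumr_ge0.
have [CZ CZ0 HZ] := smooth_majorant rho01 AA0.
exists CZ => // g L L0 gL.
have [x Hx] := choice (fun i => lorentz_dyadic_sum (p0 i) (q0 i) (ltW (L0 i)) (gL i)).
pose a i k := ((dy k `^ (ps i)^-1 * x i k / L i) `^ (qs i))%R.
have a0 i k : (0 <= a i k)%R by exact: powR_ge0.
have x0 i k : (0 <= x i k)%R by have [] := Hx i.
have [||Z [Z0 Zle Zs]] := HZ (fun k => \sum_i a i k)%R.
- by move=> k; apply: sumr_ge0.
- move=> s us; rewrite exchange_big/=; apply: ler_sum => i _.
  have [_ _ /(_ s us) H] := Hx i.
  have Lq : (0 < L i `^ qs i)%R by exact: powR_gt0.
  rewrite -(ler_pM2r Lq); apply: le_trans H; rewrite le_eqVlt; apply/orP; left; apply/eqP.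
  rewrite mulr_suml; apply: eq_bigr => k _; rewrite /a.
  rewrite powRM ?invr_ge0 ?(ltW (L0 i))//; last by apply: mulr_ge0 => //; exact: powR_ge0.
  by rewrite powRV ?(ltW (L0 i))// mulfVK// gt_eqF.
exists Z; split => // i j k.
have -> : (dy k * dy j = dy (j + k) :> R)%R by rewrite dyD mulrC.
apply: leb_rearrangement.
have [_ -> _] := Hx i; rewrite lte_fin.
have Zj := Z0 j; have dj := @dy_gt0 R j; have djk := @dy_gt0 R (j + k).
pose v := (dy (j + k) `^ (ps i)^-1 * x i (j + k) / L i)%R.
have v0 : (0 <= v)%R.
  by apply: divr_ge0; [apply: mulr_ge0 => //; exact: powR_ge0|exact: ltW].
have Hv : (v `^ (qs i) <= Z j * 2 `^ (de * `|k|%:~R))%R.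
  have H : (rho ^+ `|k|%N * a i (j + k) <= Z j)%R.
    apply: le_trans (Zle j k); rewrite ler_wpM2l//; first by rewrite exprn_ge0// ltW//; case/andP: rho01.
    by rewrite (bigD1 i)//= lerDl sumr_ge0.
  have E : (rho ^+ `|k|%N = (2 `^ (de * `|k|%:~R))^-1)%R.
    by rewrite /rho pow2E -powRN; congr (_ `^ _)%R; rewrite -abszE; ring.
  by move: H; rewrite E mulrC ler_pdivrMr ?pow2_gt0.
have Hv' : (v <= Z j `^ (qs i)^-1 * 2 `^ (de * `|k|%:~R))%R.
  have := @ge0_ler_powR R (qs i)^-1 _ _ _ _ _ Hv; rewrite powRK//.
  rewrite invr_ge0 !nnegrE powR_ge0 (ltW (q0 i)) mulr_ge0 ?(ltW Zj) ?powR_ge0//.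
  move=> /(_ isT isT isT) /le_trans; apply.
  rewrite (powRM _ (ltW Zj) (powR_ge0 _ _)) ler_wpM2l ?powR_ge0// -powRrM pow2_le//.
  by rewrite ler_piMr ?mulr_ge0 ?(ltW de0) ?ler0z// invf_le1.
have dE : (dy (j + k) `^ (ps i)^-1 = dy j `^ (ps i)^-1 * 2 `^ (k%:~R * (ps i)^-1))%R.
  by rewrite dyD (powRM _ (ltW dj) (ltW (dy_gt0 _))); congr (_ * _)%R; rewrite /dy -powRrM.
have xE : (x i (j + k) = v * L i * (dy j `^ (- (ps i)^-1)) * 2 `^ (- (k%:~R * (ps i)^-1)))%R.
  rewrite /v dE !powRN; field.
  by rewrite !gt_eqF ?powR_gt0// (L0 i).
rewrite xE pow2D.
have wp : (0 < dy j `^ (- (ps i)^-1))%R by exact: powR_gt0.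
have kp : (0 < 2 `^ (- (k%:~R * (ps i)^-1)) :> R)%R by exact: powR_gt0.
have Zp : (0 < Z j `^ (qs i)^-1)%R by exact: powR_gt0.
have dp : (0 < 2 `^ (de * `|k|%:~R) :> R)%R by exact: powR_gt0.
have Lp := L0 i.
set w := (dy j `^ _)%R in wp *; set kk := (2 `^ (- _))%R in kp *.
set z := (Z j `^ _)%R in Hv' Zp *; set d := (2 `^ (de * _))%R in Hv' dp *.
have -> : (v * L i * w * kk = v * (L i * w * kk))%R by ring.
have -> : (2 * L i * w * z * (kk * d) = 2 * (z * d) * (L i * w * kk))%R by ring.
rewrite ltr_pM2r ?mulr_gt0//; apply: (le_lt_trans Hv').
by rewrite ltr_pMl ?mulr_gt0// ltr1n.
Qed.

Lemma restrict_level (f : Rn -> R) (B : set Rn) (s : R) : (0 <= s)%R ->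
  [set x | s%:E < `|((EFin \o f) \_ B) x|] = B `&` [set x | s < `|f x|]%R.
Proof.
move=> s0; apply/seteqP; split => x /=; rewrite patchE; case: ifPn => [xB|xB].
- by rewrite lte_fin => H; split => //; exact/set_mem.
- by rewrite abse0 lte_fin ltNge s0.
- by case=> _; rewrite lte_fin.
- by case=> /mem_set; rewrite (negbTE xB).
Qed.

Lemma commutator_lorentz (p q theta C0 eta : R) (ps qs : 'I_m -> R) : (1 < p)%R ->
  (forall i, 1 < ps i)%R -> (1 <= q)%R -> (forall i, 1 <= qs i)%R ->
  (p^-1 = \sum_i (ps i)^-1)%R -> (q^-1 = \sum_i (qs i)^-1)%R ->
  (forall i, theta < (ps i)^-1)%R -> (0 < eta < 1)%R ->
  exists2 C : R, (0 < C)%R & forall (b : 'I_l -> Rn -> R) be f (S : 'I_(3 ^ n) -> set (cube R n))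
    (g : Rn -> R) (x0 : Rn) (r : R) (L : 'I_m -> R),
  (forall s, bmo_bound (b s) (be s)) -> (forall i, lmeasurable (f i)) ->
  (forall j, sparse eta (S j)) ->
  dominated hlm C0 b f S g ->
  (0 < r)%R -> (forall i, 0 < L i)%R ->
  (forall i (k : nat), lorentz (ps i) (qs i)%:E ((EFin \o f i) \_ (eball x0 (2 ^+ (n + 2) * 2 ^+ k * r)))
     <= (L i * 2 `^ (k%:R * (n%:R * theta)))%:E) ->
  lorentz p q%:E ((EFin \o g) \_ (eball x0 r)) <= (C * ((\prod_s be s) * \prod_i L i))%:E.
Proof.
move=> p1 ps1 q1 qs1 psum qsum th eta01.
have m0 : (0 < m)%N by apply: leq_trans hlm.
have p0 : (0 < p)%R by apply: lt_trans p1.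
have ps0 i : (0 < ps i)%R by apply: lt_trans (ps1 i).
have qs0 i : 0 < (qs i)%:E by rewrite lte_fin; apply: lt_le_trans (qs1 i).
have [N [de [sg [sg' [N0 de0 psP [sgP Nsg] [sgP' Nsg' Np]]]]]] :=
  exponent_parameters n0 m0 p1 ps1 th.
have [K K0 HK] := @inner_weighted R n l m N.
have [H H0 HH] := @outer_tail R n l N l0.
have [C1 [C1' [C10 C1'0 HC]]] := local_sum n0 N0 (ltW K0) (ltW H0) eta01 de0 psP sgP Nsg sgP' Nsg'.
have [CZ CZ0 HZ] := dyadic_majorant ps1 qs1 de0.
have exw i : exists c : R, (0 < c)%R /\ forall (g : Rn -> \bar R) (L t : R), (0 < L)%R -> (0 < t)%R ->
  lorentz (ps i) (qs i)%:E g <= L%:E -> leb [set x | (c * L * t `^ (- (ps i)^-1))%:E < `|g x|] <= t%:E.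
  by have [c c0 Hc] := @lorentz_weak R n (ps i) (qs i)%:E (ps0 i) (qs0 i); exists c.
have [cw Hcw] := choice exw.
pose cnt : R := (3 ^ n * 2 ^ l)%:R.
have cnt0 : (0 < cnt)%R by rewrite ltr0n muln_gt0 !expn_gt0.
(* The measure bound at level j is a constant times 2^j; rounding the constant up to 2^c0 moves it
   to a dyadic point of the rearrangement. *)
have [c0 Hc0] : exists c0 : nat, (cnt * C1' <= 2 ^+ c0)%R.
  exists (Num.truncn (cnt * C1')).+1; apply: ltW; apply: lt_trans (truncnS_gt _) _.
  by rewrite -natrX ltr_nat ltn_expl.
have K20 : (0 < 2 ^+ n :> R)%R by exact: exprn_gt0.
have [C2 C20 HC2] := @lorentz_from_levels R n p q N%:R^-1 (2 ^+ n) CZ c0 p0 q1 Np K20 (ltW CZ0).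
pose A : R := (Num.max C0 1 * cnt)%R.
have A0 : (0 < A)%R by rewrite mulr_gt0// lt_max ltr01 orbT.
pose Pc := (\prod_i cw i)%R; have Pc0 : (0 < Pc)%R by apply: prodr_gt0 => i _; have [] := Hcw i.
pose E0 := (A * C1 * (2 ^+ m + Pc))%R.
have E00 : (0 < E0)%R by apply: mulr_gt0; [exact: mulr_gt0|by rewrite addr_gt0// exprn_gt0].
exists (C2 * E0)%R; first exact: mulr_gt0.
move=> b be f S g x0 r L Hb mf sS Hg r0 L0 HL.
pose W := (\prod_(s < l) be s)%R; have W0 : (0 < W)%R by exact: (prod_be_gt0 Hb).
pose PL := (\prod_i L i)%R; have PL0 : (0 < PL)%R by apply: prodr_gt0 => i _.
pose v := (r ^+ n)%R; have v0 : (0 < v)%R by exact: exprn_gt0.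
have [|Z [Z0 Zs Zf]] := HZ (fun i => (EFin \o f i) \_ (eball x0 (2 ^+ (n + 2) * r)))%R L L0.
  by move=> i; have := HL i 0%N; rewrite expr0 mulr1 mul0r powRr0 mulr1.
pose xi (j : int) i := (2 * L i * dy j `^ (- (ps i)^-1) * Z j `^ (qs i)^-1)%R.
pose G i := (cw i * L i)%R.
have xi0 j i : (0 < xi j i)%R.
  rewrite /xi; apply: mulr_gt0; last by rewrite powR_gt0.
  by apply: mulr_gt0; [exact: mulr_gt0|rewrite powR_gt0// dy_gt0].
have G0 i : (0 < G i)%R by apply: mulr_gt0; [have [] := Hcw i|].
pose Lam j := (C1 * (\prod_i xi j i + (\prod_i (G i * v `^ (- (ps i)^-1))) * (v / dy j) `^ N%:R^-1))%R.
have prodxi j : (\prod_i xi j i = 2 ^+ m * PL * (dy j `^ (- p^-1) * Z j `^ q^-1))%R.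
  rewrite psum qsum -sumrN -!prod_powR_sum ?dy_gt0//.
  by rewrite /PL /xi !big_split/= prodr_const card_ord -!mulrA.
have prodG : (\prod_i (G i * v `^ (- (ps i)^-1)) = Pc * PL * v `^ (- p^-1))%R.
  by rewrite psum -sumrN -prod_powR_sum// !big_split.
have Lam0 j : (0 <= Lam j)%R.
  apply: mulr_ge0; first exact: ltW.
  apply: addr_ge0; first by apply: prodr_ge0 => i _; exact: ltW.
  apply: mulr_ge0; last exact: powR_ge0.
  by apply: prodr_ge0 => i _; apply: mulr_ge0; [exact: ltW|exact: powR_ge0].
have LamE j : (A * (W * Lam j) <= E0 * (W * PL) * (dy j `^ (- p^-1) * Z j `^ q^-1 + v `^ (- p^-1) * (v / dy j) `^ N%:R^-1))%R.
  rewrite /Lam prodxi prodG /E0.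
  set a := (dy j `^ _ * _)%R; set c := (v `^ _)%R; set d := (_ `^ N%:R^-1)%R.
  have a0 : (0 <= a)%R by apply: mulr_ge0; exact: powR_ge0.
  have cd0 : (0 <= c * d)%R by apply: mulr_ge0; exact: powR_ge0.
  have m20 : (0 <= 2 ^+ m :> R)%R by exact: exprn_ge0.
  have -> : (A * (W * (C1 * (2 ^+ m * PL * a + Pc * PL * c * d))) = A * C1 * (W * PL) * (2 ^+ m * a + Pc * (c * d)))%R by ring.
  have -> : (A * C1 * (2 ^+ m + Pc) * (W * PL) * (a + c * d) = A * C1 * (W * PL) * ((2 ^+ m + Pc) * (a + c * d)))%R by ring.
  apply: ler_wpM2l; first by apply/ltW; apply: mulr_gt0; [exact: mulr_gt0|exact: mulr_gt0].
  exact: cross_sum_le m20 (ltW Pc0) a0 cd0.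
rewrite -mulrA; have EW0 : (0 <= E0 * (W * PL))%R by apply/ltW; apply: mulr_gt0 => //; exact: mulr_gt0.
apply: (HC2 _ v _ Z v0 EW0 Z0 Zs).
  rewrite (restrict_level g (eball x0 r) (lexx 0%R)).
  apply: (@le_trans _ _ (leb (eball x0 r))); first by apply: le_lebesgue_outer => x [].
  by rewrite -exprMn; exact: leb_eball_le.
move=> j; apply: (@le_trans _ _ (A * (W * Lam j))%:E); last by rewrite lee_fin.
have AL0 : (0 <= A * (W * Lam j))%R by apply: mulr_ge0; [exact: ltW|apply: mulr_ge0; [exact: ltW|exact: Lam0]].
apply: rearrangement_le => //; rewrite restrict_level//.
apply: (@le_trans _ _ (cnt * (C1' * dy j))%:E); last first.
  by rewrite lee_fin dyD dy_nat mulrA [leRHS]mulrC ler_wpM2r// ltW// dy_gt0.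
apply: (dominated_weak n0 Hb mf sS (measurable_eball x0 r) (Lam0 j) Hg) => gamma D s latD sD us ss.
apply: (HC D f x0 r (xi j) G (dy j) s (inner b be gamma) (outer b be gamma)) => //.
- exact: dy_gt0.
- move=> i k; have := Zf i j k; rewrite restrict_level//.
  by apply: mulr_ge0; [exact: (ltW (xi0 j i))|exact: powR_ge0].
- move=> i k t t0; have [_ Hw] := Hcw i.
  have := Hw _ _ t _ t0 (HL i k); rewrite restrict_level; last first.
    by rewrite !mulr_ge0 ?powR_ge0// ltW//; have [] := Hcw i.
  by rewrite (mulrA (cw i)); apply; rewrite mulr_gt0// pow2_gt0.
- by move=> i Q; exact: HK.
- by move=> Q; exact: HH.
Qed.

End LocalEstimate.

(** * Positivity of the operator norms *)

Section LorentzFacts.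
Context {R : realType} {n : nat}.
Hypothesis n0 : (0 < n)%N.
Local Notation Rn := 'rV[R]_n.
Local Notation lT := (lebesgue_type R n).
Local Open Scope ereal_scope.

Lemma lorentz_bounded (p : R) (q : \bar R) : (0 < p)%R -> 1 <= q ->
  exists2 C : R, (0 < C)%R & forall (g : Rn -> \bar R) (M v : R), (0 <= M)%R -> (0 < v)%R ->
  (forall x, `|g x| <= M%:E) -> leb [set x | 0 < `|g x|] <= v%:E ->
  lorentz p q g <= (C * (M * v `^ p^-1))%:E.
Proof.
move=> p0 q1.
have rearr_small (g : Rn -> \bar R) (M t : R) : (0 <= M)%R -> (0 <= t)%R -> (forall x, `|g x| <= M%:E) ->
    rearrangement g t <= M%:E.
  move=> M0 t0 gM; apply: rearrangement_le => //.
  have -> : [set x | M%:E < `|g x|] = set0.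
    by rewrite -subset0 => x /=; rewrite ltNge gM.
  by rewrite measure0 lee_fin.
have rearr0 (g : Rn -> \bar R) (v t : R) : (v <= t)%R -> leb [set x | 0 < `|g x|] <= v%:E ->
    rearrangement g t <= 0.
  by move=> vt H; apply: rearrangement_le => //; apply: le_trans H _; rewrite lee_fin.
case: q q1 => [q| |]// q1.
- rewrite lee_fin in q1.
  have r01 : (((0 : R) <= 2^-1) && (2^-1 < (1 : R)))%R by apply/andP; split; lra.
  have CZ0 : (0 <= 2 / (1 - 2^-1) :> R)%R by rewrite divr_ge0// subr_ge0 ltW//; case/andP: r01.
  (* With [nu = 0] the second term at each level is v^(-1/p), which alone matches the bound [M]; any
     positive summable sequence, here 2^(-|j|), can serve as [Z]. *)
  have [C C0 HC] := @lorentz_from_levels R n p q 0%R 1%R (2 / (1 - 2^-1))%R 0 p0 q1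
    (ltac:(by rewrite invr_gt0)) ltr01 CZ0.
  exists C => // g M v M0 v0 gM supp.
  have ME : (0 <= M * v `^ p^-1)%R by apply: mulr_ge0 => //; exact: powR_ge0.
  apply: (HC g v _ (fun j => 2^-1 ^+ `|j|%N)%R v0 ME); first by move=> j; rewrite exprn_gt0.
  + by move=> s us; exact: sum_int_geometric_le.
  + by rewrite mul1r.
  move=> j; rewrite addr0 powRr0 mulr1; set X := (_ * _ `^ q^-1)%R.
  have X0 : (0 <= X)%R by apply: mulr_ge0; exact: powR_ge0.
  have [vj|vj] := leP v (dy j).
    apply: le_trans (rearr0 g v _ vj supp) _; rewrite lee_fin; apply: mulr_ge0 => //.
    by apply: addr_ge0 => //; exact: powR_ge0.
  apply: le_trans (rearr_small g M _ M0 (ltW (dy_gt0 _)) gM) _; rewrite lee_fin.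
  have {1}-> : (M = M * v `^ p^-1 * v `^ (- p^-1))%R.
    by rewrite -mulrA powRN mulfV ?mulr1// gt_eqF ?powR_gt0.
  by rewrite ler_wpM2l// lerDr.
- exists 1%R => // g M v M0 v0 gM supp; rewrite mul1r; apply: ge_ereal_sup => _ [t /= + <-].
  rewrite in_itv/= andbT => t0.
  have [vt|tv] := leP v t.
    apply: (@le_trans _ _ 0); last by rewrite lee_fin; apply: mulr_ge0 => //; exact: powR_ge0.
    rewrite mule_ge0_le0 ?lee_fin ?powR_ge0//; exact: rearr0 vt supp.
  rewrite [X in _ <= X%:E]mulrC EFinM; apply: lee_pmul.
  + by rewrite lee_fin powR_ge0.
  + exact: rearrangement_ge0.
  + by rewrite lee_fin; apply: ge0_ler_powR; rewrite ?nnegrE ?invr_ge0 ?ltW.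
  + by apply: rearr_small => //; exact: ltW.
Qed.

Lemma leb_eball_ge_side (x : Rn) (r : R) : (0 < r)%R ->
  (((r / n%:R) ^+ n)%:E <= leb (eball x r))%E.
Proof.
move=> r0; have [Q QB sQ] := leb_eball_ge x n0 r0.
by rewrite -sQ -/(vol Q) -leb_vol; exact: le_lebesgue_outer.
Qed.

(** The weak-type embedding read backwards, at a [t] that is half the volume of an inscribed cube of
    side r / n and hence below the measure of the ball. *)
Lemma lorentz_eball_ge (p : R) (q : \bar R) : (0 < p)%R -> 0 < q ->
  exists2 c : R, (0 < c)%R & forall (g : Rn -> \bar R) (x0 : Rn) (r y : R), (0 < r)%R -> (0 < y)%R ->
  (forall x, eball x0 r x -> y%:E <= `|g x|) ->
  (c * y * (r ^+ n) `^ p^-1)%:E <= lorentz p q (g \_ (eball x0 r)).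
Proof.
move=> p0 q0; have [C C0 HC] := @lorentz_weak R n p q p0 q0.
have d0 : (0 < (n%:R^-1) ^+ n / 2 :> R)%R by rewrite divr_gt0// exprn_gt0// invr_gt0 ltr0n.
set d := (_ / 2)%R in d0.
exists (C^-1 * d `^ p^-1)%R; first by rewrite mulr_gt0 ?invr_gt0 ?powR_gt0.
move=> g x0 r y r0 y1 gy; rewrite leNgt; apply/negP => Hlt.
have v0 : (0 < r ^+ n)%R by exact: exprn_gt0.
pose t := (d * r ^+ n)%R; have t0 : (0 < t)%R by exact: mulr_gt0.
have tp : (C^-1 * d `^ p^-1 * y * (r ^+ n) `^ p^-1 = C^-1 * y * t `^ p^-1)%R.
  by rewrite /t (powRM _ (ltW d0) (ltW v0)); ring.
rewrite tp in Hlt.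
(* [lorentz_weak] wants a positive bound, while the norm could be 0 at this point; [L] is put
   between the norm and the supposed strict upper bound. *)
have [L [L0 HL Ly]] : exists L : R, [/\ (0 < L)%R, lorentz p q (g \_ (eball x0 r)) <= L%:E &
    (L < C^-1 * y * t `^ p^-1)%R].
  have P0 : (0 < C^-1 * y * t `^ p^-1)%R by rewrite !mulr_gt0 ?invr_gt0 ?powR_gt0.
  case: (lorentz p q _) Hlt => [z| |]//; rewrite ?lte_fin => Hlt.
    exists (Num.max z (C^-1 * y * t `^ p^-1 / 2))%R; split.
    + by rewrite lt_max divr_gt0 ?orbT.
    + by rewrite lee_fin le_max lexx.
    + by rewrite gt_max Hlt/= ltr_pdivrMr// ltr_pMr// ltr1n.
  exists (C^-1 * y * t `^ p^-1 / 2)%R; split; rewrite ?divr_gt0 ?leNye//.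
  by rewrite ltr_pdivrMr// ltr_pMr// ltr1n.
have := HC _ L t L0 t0 HL; apply/negP; rewrite -ltNge.
apply: (@lt_le_trans _ _ (leb (eball x0 r))).
  apply: lt_le_trans (leb_eball_ge_side x0 r0); rewrite lte_fin /t /d exprMn mulrC ltr_pM2l//.
  by rewrite ltr_pdivrMr// ltr_pMr ?ltr1n// exprn_gt0// invr_gt0 ltr0n.
apply: le_lebesgue_outer => x xB /=; rewrite patchE mem_set//.
apply: lt_le_trans (gy x xB); rewrite lte_fin powRN ltr_pdivrMr ?powR_gt0//.
by rewrite -ltr_pdivlMl// mulrA.
Qed.

End LorentzFacts.

Section Bmo.
Context {R : realType} {n : nat}.
Local Notation Rn := 'rV[R]_n.
Local Open Scope ereal_scope.

Lemma cube_sub_compact (Q : cube R n) : exists K : set Rn,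
  [/\ compact K, measurable (K : set (lebesgue_type R n)) & cube_set Q `<=` K].
Proof.
exists [set x : Rn | forall i, `[Q.1 ord0 i, Q.1 ord0 i + (Q.2)%:num]%classic (x ord0 i)]%R.
split.
- by apply: (@rV_compact R n (fun i => `[Q.1 ord0 i, Q.1 ord0 i + (Q.2)%:num]%classic)%R) => i;
    exact: segment_compact.
- have -> : [set x : Rn | forall i, `[Q.1 ord0 i, Q.1 ord0 i + (Q.2)%:num]%classic (x ord0 i)]%R =
      \bigcap_(i in [set: 'I_n]) ((fun x : Rn => x ord0 i) @^-1` `[Q.1 ord0 i, Q.1 ord0 i + (Q.2)%:num]%classic)%R.
    by apply/seteqP; split => x /= Hx i; [move=> _|]; exact: Hx.
  apply: fin_bigcap_measurable; first exact: finite_finset.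
  move=> i _; rewrite -[X in measurable X]setTI.
  by apply: (measurable_coord i measurableT); exact: measurable_itv.
- move=> x /cube_setP xQ i; have /andP[x1 x2] := xQ i.
  by rewrite /= in_itv/= x1 ltW.
Qed.

Lemma bmo_boundP (b : Rn -> R) (be : R) : BMO b -> (0 < be)%R -> bmo_norm b < be%:E ->
  bmo_bound b be.
Proof.
move=> [mb ib _] be0 bbe.
have ibQ (Q : cube R n) : (@leb R n).-integrable (cube_set Q) (EFin \o b).
  have [K [cK mK QK]] := cube_sub_compact Q.
  exact: integrableS mK (measurable_cube Q) QK (ib K cK).
split => // Q; have v0 := vol_gt0 Q.
have : eavg (fun x => (b x - avg b Q)%:E) (cube_set Q) <= be%:E.
  by apply/ltW/(le_lt_trans _ bbe)/ereal_sup_ubound; exists Q.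
rewrite /eavg [X in X^-1](leb_vol Q) inver (gt_eqF v0).
have -> : \int[leb]_(x in cube_set Q) `|(b x - avg b Q)%:E| = (osc b Q (avg b Q))%:E.
  by rewrite -oscE.
by rewrite -EFinM lee_fin mulrC ler_pdivrMr.
Qed.

Lemma bmo_norm_ge0 (b : Rn -> R) : 0 <= bmo_norm b.
Proof.
pose Q : cube R n := (0%R, PosNum (@ltr01 R)).
apply: (@le_trans _ _ (eavg (fun x => (b x - avg b Q)%:E) (cube_set Q))).
  by apply: mule_ge0; [rewrite inve_ge0; exact: measure_ge0|exact: integral_ge0].
by apply: ereal_sup_ubound; exists Q.
Qed.

End Bmo.

(** * Weights and Morrey norms of test functions *)

Section Morrey.
Context {R : realType} {n : nat}.
Hypothesis n0 : (0 < n)%N.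
Local Notation Rn := 'rV[R]_n.
Local Notation lT := (lebesgue_type R n).
Local Open Scope ereal_scope.

Lemma lorentz_ge0 (p : R) (q : \bar R) (g : Rn -> \bar R) : 0 <= lorentz p q g.
Proof.
case: q => [q| |]//=; first exact: poweR_ge0.
apply: (@le_trans _ _ ((1 `^ p^-1)%:E * rearrangement g 1)).
  by apply: mule_ge0; [rewrite lee_fin powR_ge0|exact: rearrangement_ge0].
by apply: ereal_sup_ubound; exists 1%R => //=; rewrite in_itv/= ltr01.
Qed.

Lemma morrey_ge (p : R) (q : \bar R) (u : Rn -> R -> R) (g : Rn -> \bar R) (x : Rn) (r : R) :
  (0 < r)%R -> ((u x r)^-1)%:E * lorentz p q (g \_ (eball x r)) <= morrey p q u g.
Proof. by move=> r0; apply: ereal_sup_ubound; exists x, r. Qed.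

Lemma lorentz_le_morrey (p : R) (q : \bar R) (u : Rn -> R -> R) (g : Rn -> \bar R) (x : Rn) (r y : R) :
  (0 < r)%R -> (0 < u x r)%R -> morrey p q u g <= y%:E ->
  lorentz p q (g \_ (eball x r)) <= (y * u x r)%:E.
Proof.
move=> r0 u0 gy; have := le_trans (morrey_ge p q u g x r0) gy.
by rewrite lee_pdivrMl// -EFinM mulrC.
Qed.

Lemma morrey_ge0 (p : R) (q : \bar R) (u : Rn -> R -> R) (g : Rn -> \bar R) :
  (forall x r, 0 < r -> 0 < u x r)%R -> 0 <= morrey p q u g.
Proof.
move=> u0; apply: le_trans (morrey_ge p q u g 0 ltr01).
by apply: mule_ge0; [rewrite lee_fin invr_ge0 ltW ?u0|exact: lorentz_ge0].
Qed.

Lemma compact_sub_eball (K : set Rn) : compact K -> exists2 r : R, (0 < r)%R & K `<=` eball 0 r.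
Proof.
move=> cK.
have ex (i : 'I_n) : exists d : R, (0 <= d)%R /\ forall x, K x -> (`|x ord0 i| <= d)%R.
  have : compact [set x ord0 i | x in K].
    apply: (continuous_compact _ cK); apply: continuous_subspaceT; exact: coord_continuous.
  move=> /compact_bounded [d [_ Hd]]; exists (Num.max d 0 + 1)%R; split.
    by rewrite addr_ge0// le_max lexx orbT.
  move=> x Kx; apply: (Hd (Num.max d 0 + 1)%R); last by exists x.
  by rewrite (@le_lt_trans _ _ (Num.max d 0)%R) ?le_max ?lexx// ltrDl.
have [d Hd] := choice ex.
have d0 : (0 <= \sum_i d i)%R by apply: sumr_ge0 => i _; have [] := Hd i.
exists (n%:R * (\sum_i d i) + 1)%R; first by rewrite ltr_wpDl// mulr_ge0.
move=> x Kx; apply: (@coord_eball _ _ _ _ (\sum_i d i)%R) => // [i|]; last by rewrite ltrDl.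
rewrite mxE subr0; have [_ /(_ x Kx) H] := Hd i; apply: (le_trans H).
by rewrite (bigD1 i)//= lerDl sumr_ge0// => j _; have [] := Hd j.
Qed.

(** The first weight condition with the norms of the indicators replaced by the comparable r^(n/p).
    Free of [q], it also serves the blocks, whose exponents are conjugate. *)
Definition eball_ratio (C p : R) (u : Rn -> R -> R) :=
  forall (x1 x2 : Rn) (r1 r2 : R), (0 < r1)%R -> (0 < r2)%R -> (u x1 r1 <= u x2 r2)%R ->
     ((r1 ^+ n) `^ p^-1 / u x1 r1 <= C * ((r2 ^+ n) `^ p^-1 / u x2 r2))%R.

Lemma lorentz_indic_bounds (p q : R) : (0 < p)%R -> (1 <= q)%R ->
  exists c C : R, [/\ (0 < c)%R, (0 < C)%R &
   forall (x : Rn) (r : R), (0 < r)%R ->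
     (c * (r ^+ n) `^ p^-1)%:E <= lorentz p q%:E (EFin \o \1_(eball x r)) <= (C * (r ^+ n) `^ p^-1)%:E].
Proof.
move=> p0 q1; have q0 : (0 < q)%R by apply: lt_le_trans q1.
have [c c0 Hc] := @lorentz_eball_ge R n n0 p q%:E p0 q0.
have [C C0 HC] := @lorentz_bounded R n p q%:E p0 q1.
exists c, (C * (2 ^+ n) `^ p^-1)%R; split => //; first by rewrite mulr_gt0// powR_gt0// exprn_gt0.
move=> x r r0; apply/andP; split.
  have -> : EFin \o \1_(eball x r) = (EFin \o \1_(eball x r)) \_ (eball x r) :> (Rn -> \bar R).
    apply/funext => y; rewrite patchE; case: ifPn => //= yB.
    by rewrite indicE (negbTE yB).
  rewrite -[X in (X * _)%:E]mulr1; apply: Hc => // y yB.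
  by rewrite /= indicE mem_set//= normr1.
have r2 : (0 < (2 * r) ^+ n)%R by rewrite exprn_gt0// mulr_gt0.
have := HC (EFin \o \1_(eball x r)) 1%R ((2 * r) ^+ n)%R ler01 r2.
rewrite mul1r exprMn powRM ?exprn_ge0 ?(ltW r0)// mulrA; apply.
  by move=> y; rewrite /= lee_fin indicE; case: (_ \in _); rewrite ?normr1// normr0.
rewrite -exprMn; apply: le_trans (leb_eball_le x r0); apply: le_lebesgue_outer => y /=.
by rewrite lte_fin indicE; case: (boolP (y \in _)) => [/set_mem//|]; rewrite normr0 ltxx.
Qed.

Lemma weight_ratio (C theta p q : R) (u : Rn -> R -> R) : (0 < p)%R -> (1 <= q)%R -> (0 < C)%R ->
  (forall x r, 0 < r -> 0 < u x r)%R -> weight_condition C theta p q u ->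
  exists2 C' : R, (0 < C')%R & eball_ratio C' p u.
Proof.
move=> p0 q1 C0 u0 [H _]; have [c [D [c0 D0 HcD]]] := lorentz_indic_bounds p0 q1.
exists (C * D / c)%R; first by rewrite !mulr_gt0 ?invr_gt0.
move=> x1 x2 r1 r2 r10 r20 u12.
have /andP[H1 _] := HcD x1 r1 r10; have /andP[_ H2] := HcD x2 r2 r20.
have i1 : (0 <= (u x1 r1)^-1)%R by rewrite invr_ge0 ltW ?u0.
have i2 : (0 <= (u x2 r2)^-1)%R by rewrite invr_ge0 ltW ?u0.
rewrite -(ler_pM2l c0) -lee_fin.
apply: (@le_trans _ _ (lorentz p q%:E (EFin \o \1_(eball x1 r1)) * ((u x1 r1)^-1)%:E)).
  by rewrite mulrA EFinM; apply: lee_wpmul2r; rewrite ?lee_fin.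
apply: le_trans (H x1 x2 r1 r2 r10 r20 u12) _.
apply: (@le_trans _ _ (C%:E * ((D * (r2 ^+ n) `^ p^-1)%:E * ((u x2 r2)^-1)%:E))).
  by apply: lee_wpmul2l; [rewrite lee_fin ltW|apply: lee_wpmul2r; rewrite ?lee_fin].
rewrite -!EFinM lee_fin le_eqVlt; apply/orP; left; apply/eqP; field.
by rewrite !gt_eqF ?u0.
Qed.

(** The weight [u x r] is compared with that of a fixed ball containing the support. If it is not
    larger, the weight condition bounds the quotient for the ball at hand; if it is larger, passing
    to the fixed ball and its weight only increases the bound. *)
Lemma morrey_bounded_compact (C theta p q : R) (u : Rn -> R -> R) (f : Rn -> R) :
  (0 < p)%R -> (1 <= q)%R -> (0 < C)%R ->
  (forall x r, 0 < r -> 0 < u x r)%R -> weight_condition C theta p q u ->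
  bounded_compact f -> morrey p q%:E u (EFin \o f) < +oo.
Proof.
move=> p0 q1 C0 u0 wu [mf [M0 fM0] [K cK fK]].
have [C' C'0 Hratio] := weight_ratio p0 q1 C0 u0 wu.
have [r1 r10 Kr1] := compact_sub_eball cK.
have [D D0 HD] := @lorentz_bounded R n p q%:E p0 q1.
pose M := Num.max M0 0%R; have M_ge0 : (0 <= M)%R by rewrite le_max lexx orbT.
have fM x : (`|f x| <= M)%R by apply: le_trans (fM0 x) _; rewrite le_max lexx.
pose cc := ((2 ^+ n) `^ p^-1)%R; have cc0 : (0 <= cc)%R by exact: powR_ge0.
pose Y := (D * M * cc * ((C' + 1) * ((r1 ^+ n) `^ p^-1 / u 0 r1)))%R.
apply: (@le_lt_trans _ _ Y%:E); last exact: ltry.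
have u1 : (0 < u 0 r1)%R by exact: u0.
have Lbound (x : Rn) (r s : R) (z : Rn) : (0 < s)%R ->
    (forall y, ((EFin \o f) \_ (eball x r)) y != 0 -> eball z s y) ->
    lorentz p q%:E ((EFin \o f) \_ (eball x r)) <= (D * M * cc * (s ^+ n) `^ p^-1)%:E.
  move=> s0 Hs; have s2 : (0 < (2 * s) ^+ n)%R by rewrite exprn_gt0// mulr_gt0.
  have := HD ((EFin \o f) \_ (eball x r)) M ((2 * s) ^+ n)%R M_ge0 s2.
  rewrite exprMn (powRM _ (exprn_ge0 _ _)) ?exprn_ge0 ?(ltW s0)// !mulrA; apply.
    by move=> y; rewrite patchE; case: ifP => _; rewrite ?abse0 lee_fin.
  rewrite -exprMn; apply: le_trans (leb_eball_le z s0); apply: le_lebesgue_outer => y /= Hy.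
  by apply: Hs; rewrite -abse_eq0 gt_eqF.
have rp (r : R) : (0 <= (r ^+ n) `^ p^-1)%R by exact: powR_ge0.
apply: ge_ereal_sup => _ [x [r [r0 ->]]]; have ux := u0 x r r0.
rewrite lee_pdivrMl// -EFinM.
have A0 : (0 <= D * M * cc)%R by rewrite !mulr_ge0 ?(ltW D0).
have [u12|u21] := leP (u x r) (u 0 r1)%R.
  apply: le_trans (Lbound x r r x r0 _) _.
    by move=> y; rewrite patchE; case: ifPn => [/set_mem//|]; rewrite eqxx.
  rewrite lee_fin /Y mulrCA ler_wpM2l//.
  have := Hratio x 0%R r r1 r0 r10 u12; rewrite ler_pdivrMr// mulrC => /le_trans; apply.
  rewrite ler_wpM2l ?(ltW ux)// ler_wpM2r ?divr_ge0 ?(ltW u1)//; lra.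
apply: le_trans (Lbound x r r1 0%R r10 _) _.
  move=> y; rewrite patchE; case: ifPn => _; last by rewrite eqxx.
  by move=> fy; apply/Kr1/fK; apply: contraNneq fy => /= ->.
rewrite lee_fin /Y mulrCA ler_wpM2l//.
apply: (@le_trans _ _ (u x r * ((r1 ^+ n) `^ p^-1 / u 0 r1))%R).
  by rewrite mulrCA ler_peMr// ler_pdivlMr// mul1r ltW.
rewrite ler_wpM2l ?(ltW ux)// ler_peMl ?divr_ge0 ?(ltW u1)// ; lra.
Qed.

End Morrey.

Section Positivity.
Context {R : realType} {n : nat}.
Hypothesis n0 : (0 < n)%N.
Local Notation Rn := 'rV[R]_n.
Local Notation lT := (lebesgue_type R n).
Local Open Scope ereal_scope.

Lemma operator_norm_gt0 (X Y : Type) (D : set X) (N : X -> \bar R) (N' : Y -> \bar R) (S : X -> Y)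
    (f : X) (y c : R) : D f -> N f <= y%:E -> (0 < y)%R -> (0 < c)%R -> c%:E <= N' (S f) ->
  0 < operator_norm D N N' S.
Proof.
move=> Df Nf y0 c0 cS; apply: (@lt_le_trans _ _ (c / y)%:E); first by rewrite lte_fin divr_gt0.
apply: le_ereal_inf_tmp => _ [C [C0 HC] <-].
rewrite lee_fin ler_pdivrMr// -lee_fin EFinM.
by apply: le_trans cS (le_trans (HC f Df) _); apply: lee_wpmul2l; rewrite ?lee_fin.
Qed.

Lemma prode_le_EFin (I : finType) (F : I -> \bar R) (y : I -> R) :
  (forall i, 0 <= F i <= (y i)%:E) -> 0 <= \prod_i F i <= (\prod_i y i)%:E.
Proof.
move=> H; elim/big_rec2: _ => [|i x z _ /andP[z0 zx]]; first by rewrite lee_fin ler01 lexx.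
have /andP[F0 Fy] := H i; rewrite mule_ge0//= EFinM; exact: lee_pmul.
Qed.

Variable Q1 : cube R n.
Hypothesis Q1_sub : cube_set Q1 `<=` eball 0%R 1%R.

Definition bump (a : R) (x : Rn) : R := (a * \1_(cube_set Q1) x)%R.

Lemma measurable_bump a : lmeasurable (bump a).
Proof.
apply: measurable_funM; first exact: measurable_cst.
by apply: measurable_indic; exact: measurable_cube.
Qed.

Lemma bump_bounded_compact a : bounded_compact (bump a).
Proof.
have [K [cK _ QK]] := cube_sub_compact Q1; split; first exact: measurable_bump.
- exists `|a|%R => x; rewrite /bump indicE; case: (_ \in _); rewrite ?mulr1// mulr0 normr0//.
- exists K => // x; rewrite /bump indicE; case: (boolP (x \in _)) => [/set_mem/QK//|_].
  by rewrite mulr0 eqxx.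
Qed.

Lemma eavg_bump a (A : set Rn) : (0 <= a)%R -> measurable (A : set lT) -> cube_set Q1 `<=` A ->
  leb A <= (2 ^+ n)%:E -> (a * (vol Q1 / 2 ^+ n))%:E <= eavg (EFin \o bump a) A.
Proof.
move=> a0 mA QA A2; have v0 := vol_gt0 Q1.
have vA : (vol Q1)%:E <= leb A by rewrite -leb_vol; exact: le_lebesgue_outer.
rewrite /eavg.
have -> : \int[leb]_(x in A) `|(EFin \o bump a) x| = (a * vol Q1)%:E.
  have -> : \int[leb]_(x in A) `|(EFin \o bump a) x| =
      \int[leb]_(x in A) (a%:E * (\1_(cube_set Q1) x)%:E).
    apply: eq_integral => x _; rewrite /= /bump ger0_norm ?EFinM//.
    by rewrite mulr_ge0// indicE ler0n.
  rewrite ge0_integralZl; [|exact: mA| | |].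
  - rewrite integral_indic; [|exact: mA|exact: measurable_cube].
    by rewrite (setIidl QA) [X in _ * X](leb_vol Q1) -EFinM.
  - by apply/measurable_EFinP; apply: measurable_funTS; apply: measurable_indic; exact: measurable_cube.
  - by move=> x _; rewrite lee_fin indicE.
  - by rewrite lee_fin.
case: (leb A) vA A2 => [w| |]//; rewrite !lee_fin => vw w2.
have w0 : (0 < w)%R by apply: lt_le_trans vw.
rewrite inver gt_eqF// -EFinM lee_fin mulrA mulrC ler_wpM2r ?mulr_ge0 ?(ltW v0)//.
by rewrite lef_pV2// posrE exprn_gt0.
Qed.

Lemma eball_cube (x : Rn) (r : R) (r0 : (0 < r)%R) : exists2 Q : cube R n, eball x r `<=` cube_set Q & vol Q = ((2 * r) ^+ n)%R.
Proof.
have r2 : (0 < 2 * r)%R by rewrite mulr_gt0.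
exists (x - const_mx r, PosNum r2)%R; last by [].
move=> y yB; apply/cube_setP => i; rewrite !mxE /=.
have := eball_coord i yB; rewrite ltr_norml => /andP[]; lra.
Qed.

Lemma maximal_bump a x : (0 <= a)%R -> eball 0%R 1%R x ->
  (a * (vol Q1 / 2 ^+ n))%:E <= maximal (EFin \o bump a) x.
Proof.
move=> a0 xB; have [Q BQ vQ] := eball_cube 0%R (@ltr01 R); rewrite mulr1 in vQ.
apply: (@le_trans _ _ (eavg (EFin \o bump a) (cube_set Q))).
  apply: eavg_bump => //; first exact: measurable_cube.
    exact: subset_trans BQ.
  by rewrite leb_vol vQ.
by apply: ereal_sup_ubound; exists Q => //; exact: BQ.
Qed.

Lemma multi_maximal_bump (m : nat) x : eball 0%R 1%R x ->
  ((vol Q1 / 2 ^+ n) ^+ m)%:E <= multi_maximal (fun _ : 'I_m => EFin \o bump 1) x.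
Proof.
move=> xB; apply: (@le_trans _ _ (\prod_(i < m) eavg (EFin \o bump 1) (eball 0%R 1%R))); last first.
  by apply: ereal_sup_ubound; exists 0%R, 1%R.
have H : (vol Q1 / 2 ^+ n)%:E <= eavg (EFin \o bump 1) (eball 0%R 1%R).
  rewrite -[X in X%:E <= _]mul1r; apply: eavg_bump => //; first exact: measurable_eball.
  by rewrite -[X in (X ^+ n)%R]mulr1; exact: leb_eball_le.
have c0 : (0 <= vol Q1 / 2 ^+ n)%R by rewrite divr_ge0// ltW// vol_gt0.
elim: m => [|m IH]; first by rewrite big_ord0 expr0.
rewrite big_ord_recl exprS EFinM; apply: lee_pmul => //; rewrite lee_fin// exprn_ge0//.
Qed.

Section WeightTests.
Variables (C theta : R).
Hypothesis C0 : (0 < C)%R.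

Lemma morrey_test (p q : R) (u : Rn -> R -> R) (g : Rn -> \bar R) (y : R) :
  (0 < p)%R -> (1 <= q)%R -> (forall x r, 0 < r -> 0 < u x r)%R -> (0 < y)%R ->
  (forall x, eball 0%R 1%R x -> y%:E <= g x) ->
  exists2 c : R, (0 < c)%R & c%:E <= morrey p q%:E u g.
Proof.
move=> p0 q1 u0 y0 gy; have q0 : (0 < q)%R by apply: lt_le_trans q1.
have [c c0 Hc] := @lorentz_eball_ge R n n0 p q%:E p0 q0.
have u1 := u0 0%R 1%R ltr01.
exists ((u 0 1)^-1 * (c * y * (1 ^+ n) `^ p^-1))%R.
  by rewrite !mulr_gt0 ?invr_gt0// powR_gt0// exprn_gt0.
apply: le_trans (morrey_ge p q%:E u g 0%R ltr01); rewrite EFinM.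
apply: lee_wpmul2l; first by rewrite lee_fin invr_ge0 ltW.
by apply: Hc => // x xB; apply: le_trans (gy x xB) (lee_abs _).
Qed.

Lemma morrey_bump (p q : R) (u : Rn -> R -> R) : (0 < p)%R -> (1 <= q)%R ->
  (forall x r, 0 < r -> 0 < u x r)%R -> weight_condition C theta p q u ->
  morrey_space p q%:E u (EFin \o bump 1) /\
  exists2 y : R, (0 < y)%R & morrey p q%:E u (EFin \o bump 1) <= y%:E.
Proof.
move=> p0 q1 u0 wu.
have H := morrey_bounded_compact n0 p0 q1 C0 u0 wu (bump_bounded_compact 1).
split; first by split => //; apply/measurable_EFinP; exact: measurable_bump.
have := @morrey_ge0 R n p q%:E u (EFin \o bump 1) u0.
case: (morrey _ _ _ _) H => [y| |]// _; rewrite lee_fin => y0.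
by exists (y + 1)%R; [rewrite ltr_wpDl|rewrite lee_fin lerDl].
Qed.

Lemma maximal_morrey_norm_gt0 (p q : R) (u : Rn -> R -> R) : (0 < p)%R -> (1 <= q)%R ->
  (forall x r, 0 < r -> 0 < u x r)%R -> weight_condition C theta p q u ->
  0 < maximal_morrey_norm p q u.
Proof.
move=> p0 q1 u0 wu; have [Sf [y y0 Hy]] := morrey_bump p0 q1 u0 wu.
have v0 : (0 < vol Q1 / 2 ^+ n)%R by rewrite divr_gt0 ?vol_gt0// exprn_gt0.
have [c c0 Hc] := @morrey_test p q u (maximal (EFin \o bump 1)) _ p0 q1 u0 v0
  (ltac:(by move=> x xB; have := maximal_bump ler01 xB; rewrite mul1r)).
exact: (operator_norm_gt0 Sf Hy y0 c0 Hc).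
Qed.

Lemma multi_maximal_morrey_norm_gt0 (m : nat) (p q : R) (ps qs : 'I_m -> R)
    (us : 'I_m -> Rn -> R -> R) (u : Rn -> R -> R) : (0 < p)%R -> (1 <= q)%R ->
  (forall i, 0 < ps i)%R -> (forall i, 1 <= qs i)%R ->
  (forall x r, 0 < r -> 0 < u x r)%R -> (forall i x r, 0 < r -> 0 < us i x r)%R ->
  (forall i, weight_condition C theta (ps i) (qs i) (us i)) ->
  0 < multi_maximal_morrey_norm ps qs us p q u.
Proof.
move=> p0 q1 ps0 qs1 u0 us0 wu.
have Hb i := morrey_bump (ps0 i) (qs1 i) (us0 i) (wu i).
have v0 : (0 < (vol Q1 / 2 ^+ n) ^+ m)%R by rewrite exprn_gt0// divr_gt0 ?vol_gt0// exprn_gt0.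
have [c c0 Hc] := @morrey_test p q u (multi_maximal (fun _ : 'I_m => EFin \o bump 1)) _ p0 q1 u0 v0
  (ltac:(by move=> x xB; exact: multi_maximal_bump)).
have exy i : exists y : R, (0 < y)%R /\ morrey (ps i) (qs i)%:E (us i) (EFin \o bump 1) <= y%:E.
  by have [_ [y y0 Hy]] := Hb i; exists y.
have [y Hy] := choice exy.
apply: (@operator_norm_gt0 _ _ _ _ _ _ (fun _ : 'I_m => EFin \o bump 1) (\prod_i y i) c _ _ _ c0 Hc).
- by move=> i; have [] := Hb i.
- have /andP[] // : 0 <= \prod_(i < m) morrey (ps i) (qs i)%:E (us i) (EFin \o bump 1) <= (\prod_i y i)%:E.
  apply: prode_le_EFin => i; have [_ ->] := Hy i; rewrite andbT; exact: morrey_ge0 (us0 i).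
- by apply: prodr_gt0 => i _; have [] := Hy i.
Qed.

End WeightTests.

(** Hoelder's inequality against the indicator of a cube, derived for finite and infinite [q] alike
    from [weighted_avg_weak] with weight 1, the cube alone and half its volume: a larger integral
    would give [vol Q <= vol Q / 2]. *)
Lemma cube_pairing (p : R) (q : \bar R) : (1 < p)%R -> 0 < q ->
  exists2 D : R, (0 < D)%R & forall (g : Rn -> R) (L : R) (Q : cube R n), (0 < L)%R ->
  lmeasurable g -> lorentz p q (EFin \o g) <= L%:E ->
  \int[leb]_(x in cube_set Q) (`|g x|)%:E <= (D * L * (vol Q) `^ (1 - p^-1))%:E.
Proof.
move=> p1 q0; have p0 : (0 < p)%R by apply: lt_trans p1.
have ip1 : (p^-1 < 1)%R by rewrite invf_lt1.
have [Cw Cw0 HC] := @lorentz_weak R n p q p0 q0.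
have [N HN] : exists N : nat, ((1 - p^-1)^-1 < N%:R)%R by exists (Num.truncn (1 - p^-1)^-1).+1; exact: truncnS_gt.
have d0 : (0 < 1 - p^-1)%R by rewrite subr_gt0.
have N0 : (0 < N%:R :> R)%R by apply: lt_trans HN; rewrite invr_gt0.
have Np : (N%:R^-1 < 1 - p^-1)%R by rewrite -[ltRHS]invrK ltf_pV2 ?posrE ?invr_gt0.
have N0' : (0 < N)%N by rewrite -(ltr0n R).
have r1 : (1 < 2 `^ p^-1 :> R)%R.
  by rewrite -[ltLHS](powRr0 2); apply: pow2_lt; rewrite invr_gt0.
have rs2 : (2 `^ p^-1 * 2 `^ N%:R^-1 < 2 :> R)%R.
  by rewrite -pow2D -[ltRHS](powRr1 (ler0n R 2)) pow2_lt//; lra.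
have sN : ((2 `^ N%:R^-1) ^+ N = 2 :> R)%R by rewrite pow2E mulfV ?gt_eqF// powRr1.
have [A A0 HA] := @weighted_avg_weak R n N 1 _ _ N0' ler01 r1 (pow2_gt0 _) sN rs2.
exists (A * Cw * 2 `^ p^-1)%R; first by rewrite !mulr_gt0// powR_gt0.
move=> g L Q L0 mg gL; have v0 := vol_gt0 Q.
pose t := (vol Q / 2)%R; have t0 : (0 < t)%R by rewrite divr_gt0.
pose lam := (Cw * L * t `^ (- p^-1))%R; have lam0 : (0 < lam)%R by rewrite !mulr_gt0// powR_gt0.
have lamE : (A * Cw * 2 `^ p^-1 * L * vol Q `^ (1 - p^-1) = A * lam * vol Q)%R.
  rewrite /lam /t (powRM _ (ltW v0)) ?invr_ge0// [in RHS]powRV// [(2 `^ (- _))%R]powRN invrK.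
  rewrite powRD ?(gt_eqF v0) ?implybT// powRr1 ?(ltW v0)//; ring.
rewrite lamE leNgt; apply/negP => Hlt.
have : (\sum_(P <- [:: Q]) vol P <= t)%R.
  apply: (HA g (cube_set Q) lam t [:: Q] (fun _ _ => 1%R)) => //.
  - exact: ltW.
  - move=> l; have tl : (0 < t * 2^-1 ^+ l)%R by rewrite mulr_gt0// exprn_gt0 ?invr_gt0.
    apply: le_trans (HC _ L _ L0 tl gL); apply: le_lebesgue_outer => x [_ /=]; rewrite lte_fin.
    apply: le_lt_trans; rewrite le_eqVlt; apply/orP; left; apply/eqP.
    have E : ((t * 2^-1 ^+ l) `^ (- p^-1) = t `^ (- p^-1) * (2 `^ p^-1) ^+ l)%R.
      rewrite (powRM _ (ltW t0)); last by rewrite exprn_ge0// invr_ge0.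
      congr (_ * _)%R; rewrite pow2E exprVn powRV ?exprn_ge0// powRN invrK.
      by rewrite -powR_mulrn// -powRrM.
    by rewrite E /lam mulrA.
  - by move=> P P'; rewrite !inE => /eqP -> /eqP ->; rewrite eqxx.
  - by move=> P; rewrite inE => /eqP ->.
  - move=> P _; split => //.
    under eq_integral do rewrite expr1n.
    rewrite integral_cst; last exact: measurable_cube.
    by rewrite mul1e mul1r [X in X <= _](leb_vol P).
  - move=> P; rewrite inE => /eqP ->; under eq_integral do rewrite mul1r.
    exact: ltW.
by rewrite big_seq1 /t; lra.
Qed.

(** A block whose ball has weight at least that of the unit ball has bounded norm, and pairing with
    [Q] suffices. For a smaller weight the norm may be large; then the integral is enlarged to a
    cube around the supporting ball, and the weight condition controls its volume power divided by
    the weight. *)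
Lemma block_pairing (p : R) (q : \bar R) (C' : R) (u : Rn -> R -> R) (Q : cube R n) :
  (1 < p)%R -> 0 < q -> (0 < C')%R -> (forall x r, 0 < r -> 0 < u x r)%R ->
  eball_ratio C' ((1 - p^-1)^-1) u ->
  exists2 K : R, (0 < K)%R & forall g : Rn -> R, is_block (lorentz p q) u g ->
  \int[leb]_(x in cube_set Q) (`|g x|)%:E <= K%:E.
Proof.
move=> p1 q0 C'0 u0 Hratio; have [D D0 HD] := cube_pairing p1 q0.
have u1 := u0 0%R 1%R ltr01.
pose e := (1 - p^-1)%R.
pose K1 := (D * (u 0 1)^-1 * vol Q `^ e)%R.
pose K2 := (D * (2 ^+ n) `^ e * (C' * ((1 ^+ n) `^ e / u 0 1)))%R.
have K10 : (0 < K1)%R by rewrite !mulr_gt0 ?invr_gt0// powR_gt0// vol_gt0.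
have K20 : (0 < K2)%R.
  apply: mulr_gt0; first by apply: mulr_gt0 => //; rewrite powR_gt0// exprn_gt0.
  by apply: mulr_gt0 => //; apply: divr_gt0 => //; rewrite powR_gt0// exprn_gt0.
exists (K1 + K2)%R; first exact: addr_gt0.
move=> g [mg [x [r [r0 gs gL]]]]; have ux := u0 x r r0.
have L0 : (0 < (u x r)^-1)%R by rewrite invr_gt0.
have mag (A : set Rn) : measurable_fun (T := lT) A (fun x => (`|g x|)%:E).
  by apply: measurable_funTS; apply/measurable_EFinP; apply: measurableT_comp; [exact: normr_measurable|exact: mg].
have [u21|u12] := leP (u 0 1)%R (u x r).
  apply: le_trans (HD g _ Q L0 mg gL) _; rewrite lee_fin; apply: (@le_trans _ _ K1); last by rewrite lerDl ltW.
  by rewrite /K1 ler_wpM2r ?powR_ge0// ler_wpM2l ?(ltW D0)// lef_pV2.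
have [QB BQB vQB] := eball_cube x r0.
apply: (@le_trans _ _ (\int[leb]_(x in cube_set QB) (`|g x|)%:E)).
  have -> : \int[leb]_(x in cube_set Q) (`|g x|)%:E = \int[leb]_(x in cube_set Q `&` cube_set QB) (`|g x|)%:E.
    rewrite integral_mkcondr; apply: eq_integral => y _; rewrite patchE; case: ifPn => // yQ.
    rewrite gs ?normr0// => /BQB/mem_set; exact/negP.
  apply: ge0_subset_integral.
  - by apply: measurableI; exact: measurable_cube.
  - exact: measurable_cube.
  - exact: mag.
  - by move=> y _; rewrite lee_fin.
  - by move=> y [].
apply: le_trans (HD g _ QB L0 mg gL) _; rewrite lee_fin; apply: (@le_trans _ _ K2); last by rewrite lerDr ltW.
have rn0 : (0 <= r ^+ n)%R by rewrite exprn_ge0// ltW.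
rewrite vQB exprMn -/e (powRM _ (exprn_ge0 _ (ler0n R 2)) rn0).
have := Hratio x 0%R r 1%R r0 ltr01 (ltW u12); rewrite invrK -/e => H.
have -> : (D * (u x r)^-1 * ((2 ^+ n) `^ e * (r ^+ n) `^ e) =
  D * (2 ^+ n) `^ e * ((r ^+ n) `^ e / u x r))%R by ring.
by rewrite ler_wpM2l// mulr_ge0 ?powR_ge0// ltW.
Qed.

(** Integrated over [Q], any block decomposition of [h] bounds [c * vol Q] by [K] times the sum of
    its coefficients. *)
Lemma block_norm_ge (normY : (Rn -> \bar R) -> \bar R) (u : Rn -> R -> R) (Q : cube R n) (K c : R)
    (h : Rn -> \bar R) : (0 < K)%R -> (0 < c)%R ->
  (forall g : Rn -> R, is_block normY u g -> \int[leb]_(x in cube_set Q) (`|g x|)%:E <= K%:E) ->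
  (forall x, cube_set Q x -> c%:E <= h x) ->
  (c * vol Q / K)%:E <= block_norm normY u h.
Proof.
move=> K0 c0 HK ch; apply: le_ereal_inf_tmp => _ [lam [g [[Bg Slam Hae] ->]]].
have mQ := measurable_cube Q.
have mg k : measurable_fun (T := lT) (cube_set Q) (fun x => (`|lam k| * `|g k x|)%:E).
  apply: measurable_funTS; apply/measurable_EFinP; apply: measurable_funM; first exact: measurable_cst.
  by apply: measurableT_comp; [exact: normr_measurable|have [] := Bg k].
have t0 k x : 0 <= (`|lam k| * `|g k x|)%:E by rewrite lee_fin mulr_ge0.
have H1 : \int[leb]_(x in cube_set Q) c%:E <=
    \int[leb]_(x in cube_set Q) \sum_(k <oo) (`|lam k| * `|g k x|)%:E.
  apply: ae_ge0_le_integral.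
  - exact: mQ.
  - by move=> x _; rewrite lee_fin ltW.
  - exact: measurable_cst.
  - by move=> x _; apply: nneseries_ge0.
  - by apply: ge0_emeasurable_sum => k; [move=> x _ _; exact: t0|move=> _; exact: mg].
  - move: Hae => [A [mA A0 HA]]; exists A; split => // x /= Hn; apply: HA => /= Hx; apply: Hn => xQ.
    apply: le_trans (ch x xQ) _.
    rewrite -(cvg_lim _ Hx)//; apply: lime_le; first by apply/cvg_ex; exists (h x).
    apply: nearW => N; apply: (@le_trans _ _ (\sum_(0 <= k < N) (`|lam k| * `|g k x|)%:E)).
      rewrite sumEFin lee_fin big_mkord; apply: le_trans (ler_norm _) _.
      apply: le_trans (ler_norm_sum _ _ _) _.
      by apply: ler_sum => k _; rewrite normrM.
    exact: nneseries_lim_ge.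
have H2 : \int[leb]_(x in cube_set Q) \sum_(k <oo) (`|lam k| * `|g k x|)%:E <=
    K%:E * \sum_(k <oo) `|lam k|%:E.
  rewrite integral_nneseries//; rewrite -nneseriesZl//; apply: lee_nneseries => [k _ _|k _].
    by apply: integral_ge0 => x _.
  under eq_integral do rewrite EFinM.
  rewrite ge0_integralZl; [|exact: mQ| | |by rewrite lee_fin].
  - by rewrite [leRHS]muleC; apply: lee_wpmul2l; [rewrite lee_fin|exact: HK].
  - apply: measurable_funTS; apply/measurable_EFinP.
    by apply: measurableT_comp; [exact: normr_measurable|have [] := Bg k].
  - by move=> x _; rewrite lee_fin.
have := le_trans H1 H2; rewrite integral_cst// [X in _ * X](leb_vol Q) -lee_pdivrMl// -EFinM.
by rewrite mulrC.
Qed.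

Lemma hoelder_conjugate_fine (p : R) : (1 < p)%R ->
  (1 < fine (hoelder_conjugate p%:E))%R /\ (1 - (fine (hoelder_conjugate p%:E))^-1 = p^-1)%R.
Proof.
move=> p1; have p0 : (0 < p)%R by apply: lt_trans p1.
have -> : hoelder_conjugate p%:E = (p / (p - 1))%:E.
  by rewrite /hoelder_conjugate/= gt_eqF ?lte_fin// inver subr_eq0 gt_eqF.
rewrite /= ltr_pdivlMr ?subr_gt0// mul1r ltrBlDr ltrDl; split => //.
by field; rewrite !gt_eqF// subr_gt0.
Qed.

Lemma maximal_block_norm_gt0 (C theta p q : R) (u : Rn -> R -> R) :
  (1 < p)%R -> (1 <= q)%R -> (0 < C)%R -> (forall x r, 0 < r -> 0 < u x r)%R ->
  weight_condition C theta p q u ->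
  0 < maximal_block_norm (lorentz_conjugate p q) u.
Proof.
move=> p1 q1 C0 u0 wu; have p0 : (0 < p)%R by apply: lt_trans p1.
have [C' C'0 Hratio] := weight_ratio n0 p0 q1 C0 u0 wu.
have [p'1 p'E] := hoelder_conjugate_fine p1.
rewrite /lorentz_conjugate; set p' := fine _ in p'1 p'E *; set q' := hoelder_conjugate _.
have q'1 : 1 <= q' by apply: hoelder_conj_ge1; rewrite lee_fin.
have q'0 : 0 < q' by apply: lt_le_trans q'1.
have p'0 : (0 < p')%R by apply: lt_trans p'1.
have Hr : eball_ratio C' ((1 - p'^-1)^-1) u by rewrite p'E invrK.
have [K K0 HK] := block_pairing Q1 p'1 q'0 C'0 u0 Hr.
have [D D0 HD] := @lorentz_bounded R n p' q' p'0 q'1.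
have u1 := u0 0%R 1%R ltr01.
have vp : (0 < (2 ^+ n) `^ p'^-1 :> R)%R by rewrite powR_gt0// exprn_gt0.
(* Scaled so that [lorentz_bounded] gives [bump a] a norm of at most the inverse of [u 0 1], as a
   block on the unit ball requires. *)
pose a := ((u 0 1)^-1 / (D * (2 ^+ n) `^ p'^-1))%R.
have a0 : (0 < a)%R by rewrite divr_gt0 ?invr_gt0 ?mulr_gt0.
have Ba : is_block (lorentz p' q') u (bump a).
  split; first exact: measurable_bump.
  exists 0%R, 1%R; split => // [y yB|].
    by rewrite /bump indicE memNset ?mulr0// => /Q1_sub.
  have v2 : (0 < 2 ^+ n :> R)%R by rewrite exprn_gt0.
  apply: le_trans (HD (EFin \o bump a) a (2 ^+ n)%R (ltW a0) v2 _ _) _.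
  - move=> x; rewrite /= lee_fin /bump indicE; case: (_ \in _).
      by rewrite mulr1 gtr0_norm.
    by rewrite mulr0 normr0 ltW.
  - apply: (@le_trans _ _ (leb (eball (0%R : Rn) 1%R))).
      apply: le_lebesgue_outer => x /=; rewrite lte_fin /bump indicE.
      case: (boolP (x \in _)) => [/set_mem/Q1_sub//|_]; by rewrite mulr0 normr0 ltxx.
    by rewrite -[X in (X ^+ n)%R]mulr1; exact: leb_eball_le.
  - rewrite lee_fin /a le_eqVlt; apply/orP; left; apply/eqP; field.
    by rewrite !gt_eqF.
have dec : block_decomposition (lorentz p' q') u (EFin \o bump a) (fun k => (k == 0)%:R%R) (fun=> bump a).
  split => //.
  - apply: (@le_lt_trans _ _ 1); last exact: ltry.
    apply: nneseries_le_bound => // J; case: J => [|J]; first by rewrite big_ord0.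
    by rewrite big_ord_recl big1 ?normr1 ?addr0// => i _; rewrite normr0.
  - apply: aeW => x; apply: (@cvg_near_cst _ _ _ _ _ _ _).
    exists 1%N => // N /= N1; case: N N1 => // N _.
    by rewrite big_ord_recl big1 ?mul1r ?addr0// => i _; rewrite mul0r.
have v0 : (0 < a * (vol Q1 / 2 ^+ n))%R by rewrite mulr_gt0// divr_gt0 ?vol_gt0// exprn_gt0.
apply: (@operator_norm_gt0 _ _ _ _ _ _ (EFin \o bump a) 1%R (a * (vol Q1 / 2 ^+ n) * vol Q1 / K)%R).
- by exists (fun k => (k == 0)%:R%R), (fun=> bump a).
- apply: (@le_trans _ _ (\sum_(k <oo) `|(k == 0)%:R%R|%:E)).
    by apply: ereal_inf_lbound; exists (fun k => (k == 0)%:R%R), (fun=> bump a).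
  apply: nneseries_le_bound => // J; case: J => [|J]; first by rewrite big_ord0.
  by rewrite big_ord_recl big1 ?normr1 ?addr0// => i _; rewrite normr0.
- exact: ltr01.
- by rewrite divr_gt0// mulr_gt0// vol_gt0.
- apply: (block_norm_ge K0 v0 HK) => x /Q1_sub xB.
  by apply: maximal_bump => //; exact: ltW.
Qed.

End Positivity.

(** * The Morrey-Lorentz norm of the commutator *)

Section Conclusion.
Context {R : realType}.
Local Open Scope ereal_scope.

Lemma prod_shift_le (I : Type) (s : seq I) (x : I -> R) : (forall i, 0 <= x i)%R ->
  exists2 D : R, (0 <= D)%R & forall e : R, (0 <= e <= 1)%R ->
  (\prod_(i <- s) (x i + e) <= \prod_(i <- s) x i + e * D)%R.
Proof.
move=> x0; elim: s => [|i s [D D0 HD]].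
  by exists 0%R => // e _; rewrite !big_nil mulr0 addr0.
have P0 : (0 <= \prod_(j <- s) x j)%R by apply: prodr_ge0.
exists (x i * D + \prod_(j <- s) x j + D)%R.
  by rewrite !addr_ge0// mulr_ge0.
move=> e e01; have := HD e e01; rewrite !big_cons; case/andP: e01 => e0 e1 H.
apply: le_trans (ler_wpM2l (addr_ge0 (x0 i) e0) H) _.
set P := (\prod_(j <- s) x j)%R in P0 *.
have -> : ((x i + e) * (P + e * D) = x i * P + e * (x i * D + P + e * D))%R by ring.
by rewrite lerD2l ler_wpM2l// lerD2l ler_piMl.
Qed.

Lemma le_prod_limit (I : finType) (y : \bar R) (C : R) (x : I -> R) : (0 < C)%R ->
  (forall i, 0 <= x i)%R ->
  (forall e : R, (0 < e)%R -> y <= (C * \prod_i (x i + e))%:E) -> y <= (C * \prod_i x i)%:E.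
Proof.
move=> C0 x0 H; have [D D0 HD] := prod_shift_le (index_enum I) x0.
apply/lee_addgt0Pr => d d0.
have T0 : (0 < C * (D + 1))%R by rewrite mulr_gt0// ltr_wpDl.
pose e := Num.min 1%R (d / (C * (D + 1)))%R.
have e0 : (0 < e)%R by rewrite lt_min ltr01 divr_gt0.
have e1 : (e <= 1)%R by rewrite ge_min lexx.
apply: le_trans (H e e0) _; rewrite -EFinD lee_fin.
have := HD e; rewrite (ltW e0) e1 => /(_ isT) HP.
apply: le_trans (ler_wpM2l (ltW C0) HP) _; rewrite mulrDr lerD2l.
have ed : (e * (C * (D + 1)) <= d)%R by rewrite -ler_pdivlMr// ge_min lexx orbT.
apply: le_trans ed; rewrite mulrCA ler_wpM2l ?(ltW e0)// ler_wpM2l ?(ltW C0)// lerDl//.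
Qed.

Lemma prode_fine (I : finType) (x : I -> \bar R) : (forall i, x i \is a fin_num) ->
  \prod_i x i = (\prod_i fine (x i))%:E.
Proof.
move=> H; elim/big_rec2: _ => // i a b _ ->; by rewrite -{1}(fineK (H i)).
Qed.

Lemma prode_gt0 (I : finType) (x : I -> \bar R) : (forall i, 0 < x i) -> 0 < \prod_i x i.
Proof. by move=> H; elim/big_ind: _ => // a b; exact: mule_gt0. Qed.

Lemma expe_gt0 (x : \bar R) k : 0 < x -> 0 < x ^+ k.
Proof.
move=> x0; elim: k => [|k IH]; first by rewrite expe0.
by rewrite expeS mule_gt0.
Qed.

Lemma mule_rearrange (c x y z w v : \bar R) :
  c * x * y * z * (w * v) = c * ((y * z * w) * (x * v)).
Proof. by rewrite -!muleA (muleCA x y) (muleCA x z) (muleCA x w). Qed.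

Lemma le_scaled_product (y K P : \bar R) (C : R) : (0 < C)%R -> 0 < K -> 0 <= P ->
  y <= C%:E * P -> y <= (if K \is a fin_num then C / fine K else 1)%:E * (K * P).
Proof.
move=> C0 K0 P0 Hy; case: K K0 => [k| |]// k0 /=; last first.
  move: P0; rewrite le_eqVlt => /predU1P[PE|P0]; first by move: Hy; rewrite -PE !mule0.
  by rewrite mul1e gt0_mulye// leey.
by rewrite muleA -EFinM divfK ?gt_eqF// -lte_fin.
Qed.

Context {n l m : nat}.
Hypotheses (n0 : (0 < n)%N) (l0 : (0 < l)%N).
Variable hlm : (l <= m)%N.
Local Notation Rn := 'rV[R]_n.

Lemma commutator_morrey (p q theta C0 eta Cw : R) (ps qs : 'I_m -> R)
    (us : 'I_m -> Rn -> R -> R) : (1 < p)%R ->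
  (forall i, 1 < ps i)%R -> (1 <= q)%R -> (forall i, 1 <= qs i)%R ->
  (p^-1 = \sum_i (ps i)^-1)%R -> (q^-1 = \sum_i (qs i)^-1)%R ->
  (forall i, theta < (ps i)^-1)%R -> (0 < eta < 1)%R -> (0 < Cw)%R ->
  (forall i (x : Rn) (r : R), 0 < r -> 0 < us i x r)%R ->
  (forall i (x : Rn) (r : R) (j : nat), 0 < r ->
     us i x (2 ^+ j * r) <= Cw * 2 `^ (j%:R * n%:R * theta) * us i x r)%R ->
  exists2 C : R, (0 < C)%R & forall (b : 'I_l -> Rn -> R) be f mu (S : 'I_(3 ^ n) -> set (cube R n))
    (g : Rn -> R),
  (forall s, bmo_bound (b s) (be s)) -> (forall i, lmeasurable (f i)) ->
  (forall j, sparse eta (S j)) ->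
  dominated hlm C0 b f S g ->
  (forall i, 0 < mu i)%R ->
  (forall i, morrey (ps i) (qs i)%:E (us i) (EFin \o f i) <= (mu i)%:E) ->
  morrey p q%:E (prod_weight us) (EFin \o g) <= (C * ((\prod_s be s) * \prod_i mu i))%:E.
Proof.
move=> p1 ps1 q1 qs1 psum qsum th eta01 Cw0 us0 grow.
have [C1 C10 HC1] := commutator_lorentz n0 l0 hlm C0 p1 ps1 q1 qs1 psum qsum th eta01.
(* The growth condition is used with exponent [n + 2 + k]: the part [n + 2] stems from the enlarged
   ball and goes into the constant, the part [k] leaves the factor 2^(k n theta) for the series over
   the scales. *)
pose A := (Cw * 2 `^ ((n + 2)%:R * n%:R * theta))%R.
have A0 : (0 < A)%R by rewrite mulr_gt0// pow2_gt0.
exists (C1 * A ^+ m)%R; first by rewrite mulr_gt0// exprn_gt0.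
move=> b be f mu S g Hb mf sS Hg mu0 Hmu.
have u0 (x : Rn) (r : R) : (0 < r)%R -> (0 < prod_weight us x r)%R.
  by move=> r0; apply: prodr_gt0 => i _; exact: us0.
apply: ge_ereal_sup => _ [x [r [r0 ->]]]; rewrite lee_pdivrMl ?u0// -EFinM.
pose L i := (mu i * (A * us i x r))%R.
have L0 i : (0 < L i)%R by rewrite !mulr_gt0 ?us0.
have LE : (\prod_i L i = \prod_i mu i * (A ^+ m * prod_weight us x r))%R.
  by rewrite /L big_split/= big_split/= [X in (_ * (X * _))%R]prodr_const card_ord.
have -> : (prod_weight us x r * (C1 * A ^+ m * (\prod_s be s * \prod_i mu i)) =
  C1 * ((\prod_s be s) * \prod_i L i))%R by rewrite LE; ring.
apply: (HC1 b be f S g x r L Hb mf sS Hg r0 L0) => i k.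
have E2 : (2 ^+ (n + 2) * 2 ^+ k * r = 2 ^+ (n + 2 + k) * r)%R by rewrite -exprD.
rewrite E2; have rk : (0 < 2 ^+ (n + 2 + k) * r)%R by rewrite mulr_gt0// exprn_gt0.
apply: le_trans (lorentz_le_morrey rk (us0 i x _ rk) (Hmu i)) _; rewrite lee_fin /L -!mulrA.
rewrite ler_wpM2l ?(ltW (mu0 i))//; apply: le_trans (grow i x r (n + 2 + k)%N r0) _.
rewrite le_eqVlt; apply/orP; left; apply/eqP; rewrite /A -!mulrA; congr (_ * _)%R.
by rewrite (natrD _ (n + 2) k) (mulrDl (n + 2)%:R) pow2D -mulrA; congr (_ * _)%R; exact: mulrC.
Qed.

End Conclusion.

Theorem theorem5p1 (R : realType) (n l m : nat)
    (hn : (0 < n)%N) (hl : (1 <= l)%N) (hlm : (l <= m)%N)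
    (p q : R) (ps qs : 'I_m -> R) (theta : R)
    (hp : 1 < p) (hps : forall i, 1 < ps i)
    (hq : 1 <= q) (hqs : forall i, 1 <= qs i)
    (hpsum : p^-1 = \sum_(i < m) (ps i)^-1)
    (hqsum : q^-1 = \sum_(i < m) (qs i)^-1)
    (htheta0 : 0 < theta) (htheta : forall i, theta < (ps i)^-1)
    (us : 'I_m -> 'rV[R]_n -> R -> R)
    (hus_pos : forall i (x : 'rV[R]_n) (r : R), 0 < r -> 0 < us i x r)
    (hus_meas : forall i, weight_measurable (us i))
    (hus : exists C : R, [/\ 0 < C,
       weight_condition C theta p q (prod_weight us) &
       forall i, weight_condition C theta (ps i) (qs i) (us i)])
    (dom : 'I_m -> set ('rV[R]_n -> R)) (T : @operator R n m)
    (hT : multilinear_operator dom T)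
    (C0 eta : R) (heta : 0 < eta < 1) :
  exists C : R, 0 < C /\
  forall b : 'I_l -> 'rV[R]_n -> R,
    (forall s, BMO (b s)) ->
    (forall s g, bounded_compact g ->
       dom (widen_ord hlm s) (fun x => b s x * g x)) ->
    sparse_domination hlm C0 eta b (iter_commutator hlm b T) ->
  forall f : 'I_m -> 'rV[R]_n -> R,
    (forall i, bounded_compact (f i)) ->
    (morrey p q%:E (prod_weight us) (EFin \o iter_commutator hlm b T f) <=
     C%:E * (\prod_(s < l) bmo_norm (b s)) *
     maximal_block_norm (lorentz_conjugate p q) (prod_weight us) ^+ (2 + l) *
     multi_maximal_morrey_norm ps qs us p q (prod_weight us) *
     \prod_(i < m) (maximal_morrey_norm (ps i) (qs i) (us i) *
                    morrey (ps i) (qs i)%:E (us i) (EFin \o f i)))%E.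
Proof.
have [Cw [Cw0 wu wus]] := hus.
have m0 : (0 < m)%N by apply: leq_trans hlm.
have p0 : 0 < p by apply: lt_trans hp.
have ps0 i : 0 < ps i by apply: lt_trans (hps i).
have u0 (x : 'rV[R]_n) (r : R) : 0 < r -> 0 < prod_weight us x r.
  by move=> r0; apply: prodr_gt0 => i _; exact: hus_pos.
have [C1 C10 HC1] := commutator_morrey hn hl hlm C0 hp hps hq hqs hpsum hqsum htheta heta Cw0
  hus_pos (fun i => (wus i).2).
have [Q QB _] := leb_eball_ge (0 : 'rV[R]_n) hn (@ltr01 R).
have Kb0 := maximal_block_norm_gt0 hn QB hp hq Cw0 u0 wu.
have Km0 := multi_maximal_morrey_norm_gt0 hn QB Cw0 p0 hq ps0 hqs u0 hus_pos wus.
have Ki0 i := maximal_morrey_norm_gt0 hn QB Cw0 (ps0 i) (hqs i) (hus_pos i) (wus i).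
pose K := (maximal_block_norm (lorentz_conjugate p q) (prod_weight us) ^+ (2 + l) *
  multi_maximal_morrey_norm ps qs us p q (prod_weight us) *
  \prod_(i < m) maximal_morrey_norm (ps i) (qs i) (us i))%E.
have K0 : (0 < K)%E.
  by apply: mule_gt0; [apply: mule_gt0 => //; exact: expe_gt0|exact: prode_gt0].
exists (if K \is a fin_num then C1 / fine K else 1); split.
  case: ifPn => // Kfin; rewrite divr_gt0//; apply: fine_gt0; rewrite K0/= ltey.
  by apply: contraTneq Kfin => ->.
move=> b Hb _ Hdom f Hf; have [S sS Hae] := Hdom f Hf.
set g := iter_commutator hlm b T f in Hae *.
pose P := (\prod_(s < l) bmo_norm (b s) * \prod_(i < m) morrey (ps i) (qs i)%:E (us i) (EFin \o f i))%E.
rewrite [X in (_ <= X)%E](_ : _ = ((if K \is a fin_num then C1 / fine K else 1)%:E * (K * P))%E); last first.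
  by rewrite /K /P big_split; exact: mule_rearrange.
have bmo_fin s : bmo_norm (b s) \is a fin_num.
  by rewrite ge0_fin_numE ?bmo_norm_ge0//; have [] := Hb s.
have mor0 i : (0 <= morrey (ps i) (qs i)%:E (us i) (EFin \o f i))%E by apply: morrey_ge0 (hus_pos i).
have mor_fin i : morrey (ps i) (qs i)%:E (us i) (EFin \o f i) \is a fin_num.
  rewrite ge0_fin_numE//.
  exact: (morrey_bounded_compact hn (ps0 i) (hqs i) Cw0 (hus_pos i) (wus i) (Hf i)).
(* BMO and Morrey norms share one index type, so that a single limit lowers all the strict upper
   bounds to the norms. *)
pose x (i : 'I_l + 'I_m) : R := match i with
  | inl s => fine (bmo_norm (b s))
  | inr i => fine (morrey (ps i) (qs i)%:E (us i) (EFin \o f i)) end.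
have x0 i : 0 <= x i by case: i => i /=; rewrite fine_ge0// bmo_norm_ge0.
apply: le_scaled_product => //.
  by apply: mule_ge0; elim/big_ind: _ => //; [exact: mule_ge0|move=> s _; exact: bmo_norm_ge0|exact: mule_ge0].
rewrite /P (prode_fine bmo_fin) (prode_fine mor_fin) -!EFinM.
have -> : \prod_s fine (bmo_norm (b s)) * \prod_i fine (morrey (ps i) (qs i)%:E (us i) (EFin \o f i)) =
  \prod_i x i by rewrite big_sumType.
apply: le_prod_limit => // e e0; rewrite big_sumType /=.
apply: (HC1 b (fun s => x (inl s) + e) f (fun i => x (inr i) + e) S g) => //.
- move=> s; apply: bmo_boundP; [exact: Hb|by rewrite ltr_wpDl|].
  by rewrite /= EFinD fineK// lteDl// lte_fin.
- by move=> i; have [] := Hf i.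
- by move=> i; rewrite ltr_wpDl.
- by move=> i; rewrite /= EFinD fineK// leeDl// lee_fin ltW.
Qed.
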